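(* Let $m\ge1$. The map $$H^{\frac12}(\mathbb{S}^1,\mathbb{R}^m)\to H^{-3}(\mathbb{S}^1),\qquad u\mapsto\mathscr{H}_{\frac12}(u)$$ is well defined, where $\mathscr{H}_{\frac12}(u)$ is the distribution on $\mathbb{S}^1$ with Fourier coefficients $$\mathscr{F}\left(\mathscr{H}_{\frac12}(u)\right)(k)=\begin{cases}\displaystyle\sum_{\substack{a,b\in\mathbb{N}_{>0} \\ a+b=k}}a\,\widehat u(a)\cdot_{\mathbb{C}^m}b\,\widehat u(b)&\text{if }k>0, \\ 0&\text{if }k\le0.\end{cases}$$ Moreover, $u\in H^{\frac12}(\mathbb{S}^1,\mathbb{R}^m)$ is a stationary point of the half Dirichlet energy if and only if $\mathscr{H}_{\frac12}(u)=0$ as a distribution.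
   Context: $\mathbb{S}^1=\mathbb{R}/2\pi\mathbb{Z}$, identified with $\partial D^2$ via $x\mapsto e^{ix}$. $\widehat f(k)=\frac1{2\pi}\langle f,e^{-ik\cdot}\rangle$ (also written $\mathscr{F}(f)(k)$), $\|f\|_{H^s}^2=\sum_k(1+k^2)^s|\widehat f(k)|^2$, $(-\Delta)^s$ is the Fourier multiplier $|k|^{2s}$. $z\cdot_{\mathbb{C}^m}w=\sum_jz_jw_j$ is the $\mathbb{C}$-bilinear product on $\mathbb{C}^m$. The half Dirichlet energy is $E(u)=\int_{\mathbb{S}^1}|(-\Delta)^{\frac14}u(x)|^2dx$, $u\in H^{\frac12}(\mathbb{S}^1,\mathbb{R}^m)$. $u$ is a stationary point of $E$ if for every $X\in C^1(\mathbb{S}^1,\mathbb{R})$ there holds $\frac{d}{dt}\big|_{t=0}E\big(u(\cdot+tX(\cdot))\big)=0$. $\mathscr{H}_{\frac12}(u)$ is called the $\frac12$-fractional Hopf differential of $u$; formally it is $v_+\cdot_{\mathbb{C}^m}v_+$, where $v=(-\Delta)^{\frac12}u$ and $v_+=\sum_{k>0}\widehat v(k)e^{ikx}$. *)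

(* Defs.v *)
From HB Require Import structures.
From mathcomp Require Import all_boot all_order all_algebra.
From mathcomp Require Import all_classical all_reals all_analysis.
From mathcomp Require Import complex.

Set Implicit Arguments.
Unset Strict Implicit.
Unset Printing Implicit Defensive.

Import Order.TTheory GRing.Theory Num.Theory.
Import numFieldNormedType.Exports.

Local Open Scope classical_set_scope.
Local Open Scope ring_scope.

(* Functions on the circle R / 2 pi Z are 2 pi-periodic functions on R, and
   integrals over the circle are Lebesgue integrals over [0, 2 pi]. *)
Section Circle.
Context {R : realType}.
Local Notation C := (complex R).

Definition circle_int (f : R -> R) : R :=
  \int[@lebesgue_measure R]_(x in `[0, pi *+ 2]) f x.

Definition circle_cint (f : R -> C) : C :=
  Complex (circle_int (fun x => complex.Re (f x)))
          (circle_int (fun x => complex.Im (f x))).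

Definition smooth (f : R -> R) : Prop :=
  forall (n : nat) (x : R), derivable (derive1n n f) x 1.

Definition cderive (n : nat) (f : R -> C) (x : R) : C :=
  Complex (derive1n n (fun y => complex.Re (f y)) x)
          (derive1n n (fun y => complex.Im (f y)) x).

Definition test_function (phi : R -> C) : Prop :=
  [/\ periodic phi (pi *+ 2),
      smooth (fun x => complex.Re (phi x)) &
      smooth (fun x => complex.Im (phi x))].

(* A distribution on the circle is a functional on C^oo(S^1, C); its values
   outside test functions are irrelevant, hence [distribution_eq] below. *)
Definition functional : Type := (R -> C) -> C.

(* The last clause is continuity for the Frechet topology of C^oo(S^1, C):
   |T phi| <= K * max_(j <= N) sup |phi^(j)|. *)
Definition is_distribution (T : functional) : Prop :=
  (forall (a : C) (phi psi : R -> C), test_function phi -> test_function psi ->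
     T (fun x => a * phi x + psi x) = a * T phi + T psi) /\
  (exists (N : nat) (K : R), forall (phi : R -> C) (M : R),
     test_function phi ->
     (forall (j : nat) (x : R), (j <= N)%N -> Normc.normc (cderive j phi x) <= M) ->
     Normc.normc (T phi) <= K * M).

Definition distribution_eq (T S : functional) : Prop :=
  forall phi, test_function phi -> T phi = S phi.

Definition zero_distribution : functional := fun=> 0.

Definition regular_distribution (f : R -> C) : functional :=
  fun phi => circle_cint (fun x => f x * phi x).

Definition expi (k : int) (x : R) : C :=
  Complex (cos (k%:~R * x)) (sin (k%:~R * x)).

Definition fourier (T : functional) (k : int) : C :=
  real_complex R (pi *+ 2)^-1 * T (expi (- k)).

Definition in_Hs (s : R) (T : functional) : Prop :=
  is_distribution T /\
  (\esum_(k in [set: int])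
     ((1 + k%:~R ^+ 2) `^ s * Normc.normc (fourier T k) ^+ 2)%:E < +oo)%E.

(* S = (- Delta)^s T. For s > 0 the symbol vanishes at k = 0, as 0 `^ r = 0
   when r != 0. *)
Definition is_frac_laplacian (s : R) (T S : functional) : Prop :=
  is_distribution S /\
  forall k : int,
    fourier S k = real_complex R (`|k%:~R| `^ (2 * s)) * fourier T k.

Section VectorValued.
Context {m : nat}.

(* Every class in L^2(S^1, R^m) has a Borel representative. *)
Definition circle_L2 (u : R -> 'rV[R]_m) : Prop :=
  periodic u (pi *+ 2) /\
  forall j : 'I_m,
    measurable_fun setT (fun x => u x 0 j) /\
    (@lebesgue_measure R).-integrable `[0, pi *+ 2]
      (fun x => ((u x 0 j) ^+ 2)%:E).

Definition component (u : R -> 'rV[R]_m) (j : 'I_m) : functional :=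
  regular_distribution (fun x => real_complex R (u x 0 j)).

Definition vfourier (u : R -> 'rV[R]_m) (k : int) : 'rV[C]_m :=
  \row_j fourier (component u j) k.

Definition H_half (u : R -> 'rV[R]_m) : Prop :=
  circle_L2 u /\ forall j, in_Hs (1 / 2) (component u j).

(* The L^2 function g = (- Delta)^s u. It is R^m-valued when u is, because the
   symbol |k|^(2s) is even. It is determined up to a null set, and [xget] picks
   a representative; the value is 0 if (- Delta)^s u is not in L^2. *)
Definition frac_laplacian (s : R) (u : R -> 'rV[R]_m) : R -> 'rV[R]_m :=
  xget (fun=> 0)
    [set g | circle_L2 g /\
             forall j, is_frac_laplacian s (component u j) (component g j)].

(* |.| is the Euclidean norm of R^m; the norm of 'rV[R]_m is the sup norm. *)
Definition half_energy (u : R -> 'rV[R]_m) : R :=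
  circle_int (fun x => \sum_(j < m) (frac_laplacian (1 / 4) u x 0 j) ^+ 2).

Definition C1_vector_field (X : R -> R) : Prop :=
  [/\ periodic X (pi *+ 2), forall x, derivable X x 1 & continuous (derive1 X)].

(* For |t| small, x |-> x + t X x is a C^1 diffeomorphism of the circle, so that
   its composition with u in H^(1/2) is again in H^(1/2): the default value of
   [frac_laplacian] plays no role in the derivative at t = 0. *)
Definition stationary (u : R -> 'rV[R]_m) : Prop :=
  forall X : R -> R, C1_vector_field X ->
    is_derive (0 : R) (1 : R)
      (fun t : R => half_energy (fun x => u (x + t * X x))) (0 : R).

Definition bilinear_dot (z w : 'rV[C]_m) : C := \sum_(j < m) z 0 j * w 0 j.

(* Positive a, b with a + b = k are smaller than k, hence range over 'I_k. *)
Definition hopf_coef (u : R -> 'rV[R]_m) (k : int) : C :=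
  if 0 < k then
    \sum_(ab : 'I_`|k|%N * 'I_`|k|%N
          | [&& (0 < ab.1)%N, (0 < ab.2)%N & (ab.1 + ab.2 == `|k|)%N])
       bilinear_dot ((ab.1)%:R *: vfourier u (Posz ab.1))
                    ((ab.2)%:R *: vfourier u (Posz ab.2))
  else 0.

Definition is_hopf_differential (u : R -> 'rV[R]_m) (T : functional) : Prop :=
  is_distribution T /\ forall k : int, fourier T k = hopf_coef u k.

End VectorValued.
End Circle.

(* Main.v *)
Require Import Defs.
From HB Require Import structures.
From mathcomp Require Import all_boot all_order all_algebra.
From mathcomp Require Import all_classical all_reals all_analysis.
From mathcomp Require Import complex ring lra zify measurable_realfun.

Set Implicit Arguments.
Unset Strict Implicit.
Unset Printing Implicit Defensive.

Import Order.TTheory GRing.Theory Num.Theory.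
Import numFieldNormedType.Exports.

Local Open Scope classical_set_scope.
Local Open Scope ring_scope.

(* Write the half Dirichlet energy of u in Gagliardo form,
     (1 / 2 pi) int int |u x - u y|^2 / (4 sin^2 ((x - y) / 2)) dx dy.
   Changing variables along phi_t x = x + t X x shows that its derivative at t = 0 is
   the integral of the same density against
     rho_X x y = cot ((x - y) / 2) (X x - X y) - X' x - X' y,
   a bounded function. For X = cos (n x) and X = sin (n x), the product of rho_X and the
   kernel is a trigonometric polynomial with frequencies (s, n - s) and coefficients
   proportional to s (n - s), so that the derivative is, up to a constant, the imaginary
   or the real part of the n-th Fourier coefficient of the Hopf differential. Since rho_X
   depends on X continuously in C^1, Fejer's theorem reduces the case of a general C^1
   field to trigonometric polynomials.

   By the Cauchy-Schwarz inequality, the n-th coefficient of the Hopf differential is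
   O(n), hence the Hopf differential is the second derivative of an L^2 function. *)

(** * Integration over one period *)

Section CircleMeasure.
Context {R : realType}.
Local Notation leb := (@lebesgue_measure R).

(** The Fourier coefficients of a composition [u (x + t * X x)] are out of reach; in a double
    integral the composition is undone by a change of variables, and only the kernel and the
    Jacobian depend on [t]. The difficulty is the diagonal. The kernel is not integrable there, so
    every error is measured relative to [energy_density u]; this works because [(X x - X y) ^+ 2] is
    at most a multiple of [1 - cos (x - y)], so that the ratio of the kernels expands in [t]
    uniformly. After the change of variables the first-order term sits at the moved points, and for
    a C^1 field it need not be Lipschitz; it is therefore replaced, up to a uniform error [eta], by
    a Lipschitz kernel, which for trigonometric fields is exact off the diagonal. Since only
    positive frequencies meet in that kernel, the terms [u x ^+ 2] and [u y ^+ 2] integrate to zero,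
    and the cross term leaves the products of coefficients in the Hopf differential. Fejer kernels
    serve three purposes: completeness of the trigonometric system, density in C^1, and, at order
    [k], the weight [k] of the Gagliardo form. *)

Definition period_itv : set R := `[0, pi *+ 2].

Lemma measurable_period_itv : measurable period_itv.
Proof. exact: measurable_itv. Qed.

Lemma leb_period_itv : leb period_itv = (pi *+ 2)%:E.
Proof.
rewrite /period_itv lebesgue_measure_itv/= lte_fin pmulrn_lgt0// pi_gt0.
by rewrite sube0.
Qed.

Lemma leb_period_itv_lty : (leb period_itv < +oo)%E.
Proof. by rewrite leb_period_itv ltry. Qed.

(** Lebesgue measure cut down to one period, kept as a finite measure on all of [R]: constants are
    integrable, and Fubini and the convergence theorems apply on [setT]. *)
Definition circ : {finite_measure set (measurableTypeR R) -> \bar R} :=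
  @mfrestr _ (measurableTypeR R) R period_itv leb measurable_period_itv leb_period_itv_lty.

Lemma circT : circ setT = (pi *+ 2)%:E.
Proof. by rewrite /circ /= /mfrestr /mrestr setTI leb_period_itv. Qed.

Lemma circC : circ (~` period_itv) = 0%E.
Proof. by rewrite /circ /= /mfrestr /mrestr setICl measure0. Qed.

Lemma integral_circ_period (f : R -> \bar R) :
  (\int[circ]_(x in period_itv) f x = \int[leb]_(x in period_itv) f x)%E.
Proof.
apply: eq_measure_integral => A mA AD.
by rewrite /= /mfrestr /mrestr setIidl.
Qed.

Lemma ge0_integral_circ (f : R -> \bar R) : measurable_fun setT f ->
  (forall x, 0 <= f x)%E ->
  (\int[circ]_x f x = \int[leb]_(x in period_itv) f x)%E.
Proof.
move=> mf f0; rewrite -integral_circ_period.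
rewrite (@ge0_negligible_integral _ _ _ circ setT (~` period_itv))//; last 2 first.
- exact: (measurableC measurable_period_itv).
- exact: circC.
by rewrite setDE setCK setTI.
Qed.

Lemma integral_circ (f : R -> \bar R) : measurable_fun setT f ->
  (\int[circ]_x f x = \int[leb]_(x in period_itv) f x)%E.
Proof.
move=> mf; rewrite integralE [RHS]integralE.
by rewrite !ge0_integral_circ//; [exact: measurable_funeneg|exact: measurable_funepos].
Qed.

Lemma integrable_circP (f : R -> \bar R) : measurable_fun setT f ->
  circ.-integrable setT f <-> leb.-integrable period_itv f.
Proof.
move=> mf; have mD := measurable_period_itv.
have mfD : measurable_fun period_itv f by exact: measurable_funS mf.
split=> /integrableP[_ fi]; apply/integrableP; split=> //.
  by rewrite -ge0_integral_circ//; exact: measurableT_comp.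
by rewrite ge0_integral_circ//; exact: measurableT_comp.
Qed.

Implicit Types f g : R -> R.

Definition Ic (f : R -> R) : R := \int[circ]_x f x.
Definition L1 (f : R -> R) : Prop := circ.-integrable setT (EFin \o f).

Lemma circle_intE f : measurable_fun setT f -> circle_int f = Ic f.
Proof.
move=> mf; rewrite /circle_int /Ic /Rintegral integral_circ//.
exact/measurable_EFinP.
Qed.

Lemma L1_measurable f : L1 f -> measurable_fun setT f.
Proof. by move/integrableP => [/measurable_EFinP]. Qed.

Lemma EFin_Ic f : L1 f -> (Ic f)%:E = (\int[circ]_x (f x)%:E)%E.
Proof. by move=> f1; rewrite /Ic /Rintegral fineK// integrable_fin_num. Qed.

Lemma eq_L1 f g : (forall x, f x = g x) -> L1 f -> L1 g.
Proof. by move=> /funext ->. Qed.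

Lemma L1_le f g : measurable_fun setT f -> (forall x, `|f x| <= g x) ->
  L1 g -> L1 f.
Proof.
move=> mf fg g1; apply: (le_integrable _ _ _ g1) => //.
  exact/measurable_EFinP.
move=> x _ /=; rewrite lee_fin (le_trans (fg x))// ler_norm//.
Qed.

Lemma L1_cst c : L1 (cst c).
Proof. exact: (finite_measure_integrable_cst circ c measurableT). Qed.

Lemma L1_bounded f M : measurable_fun setT f -> (forall x, `|f x| <= M) -> L1 f.
Proof. by move=> mf fM; apply: (L1_le mf fM); exact: L1_cst. Qed.

Lemma L1D f g : L1 f -> L1 g -> L1 (fun x => f x + g x).
Proof.
move=> f1 g1; apply: eq_integrable (integrableD measurableT f1 g1) => //.
Qed.

Lemma L1Z c f : L1 f -> L1 (fun x => c * f x).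
Proof. by move=> f1; apply: eq_integrable (integrableZl measurableT c f1). Qed.

Lemma L1N f : L1 f -> L1 (fun x => - f x).
Proof. by move=> /(L1Z (-1)); apply: eq_integrable => // x _ /=; rewrite mulN1r. Qed.

Lemma L1B f g : L1 f -> L1 g -> L1 (fun x => f x - g x).
Proof. by move=> f1 /L1N; exact: L1D. Qed.

Lemma L1_norm f : L1 f -> L1 (fun x => `|f x|).
Proof. by move=> f1; apply: eq_integrable (integrable_abse f1). Qed.

Lemma L1_sum I (s : seq I) (P : pred I) (F : I -> R -> R) :
  (forall i, L1 (F i)) -> L1 (fun x => \sum_(i <- s | P i) F i x).
Proof.
move=> F1; elim: s => [|i s IH].
  by apply: eq_integrable (L1_cst 0) => // x _; rewrite /= big_nil.
have [Pi|nPi] := boolP (P i).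
  apply: eq_integrable (L1D (F1 i) IH) => // x _.
  by rewrite /= big_cons Pi.
by apply: eq_integrable IH => // x _; rewrite /= big_cons (negbTE nPi).
Qed.

Lemma L1_mul_bounded f g M : L1 f -> measurable_fun setT g ->
  (forall x, `|g x| <= M) -> L1 (fun x => f x * g x).
Proof.
move=> f1 mg gM; apply: (@L1_le _ (fun x => M * `|f x|)).
- exact: measurable_funM (L1_measurable f1) mg.
- by move=> x; rewrite normrM mulrC ler_wpM2r.
- exact/L1Z/L1_norm.
Qed.

Lemma eq_Ic f g : (forall x, f x = g x) -> Ic f = Ic g.
Proof. by move=> fg; congr Ic; apply/funext. Qed.

Lemma IcD f g : L1 f -> L1 g -> Ic (fun x => f x + g x) = Ic f + Ic g.
Proof. by move=> f1 g1; rewrite /Ic RintegralD. Qed.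

Lemma IcZ c f : L1 f -> Ic (fun x => c * f x) = c * Ic f.
Proof. by move=> f1; rewrite /Ic RintegralZl. Qed.

Lemma IcZr c f : L1 f -> Ic (fun x => f x * c) = Ic f * c.
Proof. by move=> f1; rewrite mulrC -IcZ//; apply: eq_Ic => x; rewrite mulrC. Qed.

Lemma IcN f : L1 f -> Ic (fun x => - f x) = - Ic f.
Proof.
by move=> f1; rewrite -mulN1r -IcZ//; apply: eq_Ic => x; rewrite mulN1r.
Qed.

Lemma IcB f g : L1 f -> L1 g -> Ic (fun x => f x - g x) = Ic f - Ic g.
Proof. by move=> f1 g1; rewrite IcD ?IcN//; exact: L1N. Qed.

Lemma Ic_cst c : Ic (cst c) = c * (pi *+ 2).
Proof. by rewrite /Ic Rintegral_cst//= circT. Qed.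

Lemma Ic0 : Ic (fun=> 0) = 0.
Proof. by have := Ic_cst 0; rewrite mul0r. Qed.

Lemma Ic_sum I (s : seq I) (P : pred I) (F : I -> R -> R) :
  (forall i, L1 (F i)) ->
  Ic (fun x => \sum_(i <- s | P i) F i x) = \sum_(i <- s | P i) Ic (F i).
Proof.
move=> F1; elim: s => [|i s IH].
  by rewrite big_nil -[RHS]Ic0; apply: eq_Ic => x; rewrite big_nil.
rewrite big_cons; case: ifPn => Pi; last first.
  by rewrite -IH; apply: eq_Ic => x; rewrite big_cons (negbTE Pi).
rewrite -IH -IcD//; last exact: L1_sum.
by apply: eq_Ic => x; rewrite big_cons Pi.
Qed.

Lemma Ic_ge0 f : (forall x, 0 <= f x) -> 0 <= Ic f.
Proof. by move=> f0; apply: Rintegral_ge0. Qed.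

Lemma le_Ic f g : L1 f -> L1 g -> (forall x, f x <= g x) -> Ic f <= Ic g.
Proof. by move=> f1 g1 fg; apply: le_Rintegral. Qed.

Lemma le_norm_Ic f : L1 f -> `|Ic f| <= Ic (fun x => `|f x|).
Proof. by move=> f1; apply: le_normr_Rintegral. Qed.

Lemma continuous_measurable (f : R -> R) : continuous f -> measurable_fun setT f.
Proof. by move=> cf; exact: continuous_measurable_fun. Qed.

Lemma continuous_L1 f : continuous f -> L1 f.
Proof.
move=> cf; apply/integrable_circP.
  by apply/measurable_EFinP; exact: continuous_measurable_fun.
apply: continuous_compact_integrable; first exact: segment_compact.
exact: continuous_subspaceT.
Qed.

Definition L2 (f : R -> R) : Prop :=
  measurable_fun setT f /\ L1 (fun x => f x ^+ 2).

Lemma L2_measurable f : L2 f -> measurable_fun setT f.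
Proof. by case. Qed.

Lemma L2_mul f g : L2 f -> L2 g -> L1 (fun x => f x * g x).
Proof.
move=> [mf f2] [mg g2].
apply: (@L1_le _ (fun x => f x ^+ 2 + g x ^+ 2)); last exact: L1D.
  exact: measurable_funM.
move=> x; rewrite normrM -(real_normK (num_real (f x))) -(real_normK (num_real (g x))).
nra.
Qed.

Lemma L2_cst c : L2 (cst c).
Proof. by split; [exact: measurable_cst|exact: eq_L1 (L1_cst (c ^+ 2))]. Qed.

Lemma L2_L1 f : L2 f -> L1 f.
Proof.
by move=> f2; apply: eq_integrable (L2_mul f2 (L2_cst 1)) => // x _ /=; rewrite mulr1.
Qed.

Lemma L2Z c f : L2 f -> L2 (fun x => c * f x).
Proof.
move=> [mf f2]; split; first exact: measurable_funM.
by apply: eq_integrable (L1Z (c ^+ 2) f2) => // x _ /=; rewrite exprMn.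
Qed.

Lemma L2D f g : L2 f -> L2 g -> L2 (fun x => f x + g x).
Proof.
move=> f2 g2; split; first exact: measurable_funD (L2_measurable f2) (L2_measurable g2).
have := L1D (L1D f2.2 (L1Z 2 (L2_mul f2 g2))) g2.2.
by apply: eq_integrable => // x _ /=; congr (_%:E); ring.
Qed.

Lemma L2B f g : L2 f -> L2 g -> L2 (fun x => f x - g x).
Proof.
move=> f2 /(L2Z (-1)) g2; have [mh h] := L2D f2 g2.
have E : (fun x => f x + -1 * g x) = (fun x => f x - g x).
  by apply/funext => x; rewrite mulN1r.
by split; rewrite -?E//; apply: eq_integrable h => // x _ /=; rewrite mulN1r.
Qed.

Lemma L2_bounded f M : measurable_fun setT f -> (forall x, `|f x| <= M) -> L2 f.
Proof.
move=> mf fM; split=> //; apply: (@L1_bounded _ (M ^+ 2)).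
  exact: measurable_funX.
by move=> x; rewrite normrX; apply: lerXn2r; rewrite ?nnegrE// (le_trans _ (fM x)).
Qed.

(* AM-GM: [|f| <= (e + f^2 / e) / 2]. *)
Lemma Ic_norm_amgm f e : 0 < e -> L2 f ->
  Ic (fun x => `|f x|) <= e * pi + Ic (fun x => f x ^+ 2) / (2 * e).
Proof.
move=> e0 f2; have f1 := L1_norm (L2_L1 f2).
have -> : e * pi + Ic (fun x => f x ^+ 2) / (2 * e) =
    Ic (fun x => e / 2 + (2 * e)^-1 * f x ^+ 2).
  rewrite IcD; [|exact: L1_cst|exact/L1Z/f2.2].
  rewrite (Ic_cst (e / 2)) IcZ; last exact: f2.2.
  rewrite -mulr_natl; field; lra.
apply: le_Ic => //; first by apply: L1D; [exact: L1_cst|exact/L1Z/f2.2].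
move=> x; rewrite -(real_normK (num_real (f x))) -subr_ge0.
have -> : e / 2 + (2 * e)^-1 * `|f x| ^+ 2 - `|f x| = (e - `|f x|) ^+ 2 / (2 * e).
  by field; lra.
by rewrite divr_ge0 ?sqr_ge0//; lra.
Qed.

Lemma ae_eq_Ic f g : measurable_fun setT f -> measurable_fun setT g ->
  {ae leb, forall x, f x = g x} -> Ic f = Ic g.
Proof.
move=> mf mg [N [mN N0 fgN]]; rewrite /Ic /Rintegral; congr fine.
rewrite !integral_circ; try exact/measurable_EFinP.
apply: ae_eq_integral; first exact: measurable_period_itv.
- exact: measurable_funS (iffRL (measurable_EFinP _ _) mf).
- exact: measurable_funS (iffRL (measurable_EFinP _ _) mg).
exists N; split=> // x xfg; apply: fgN => /= fg; apply: xfg => _ /=.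
by rewrite fg.
Qed.

End CircleMeasure.

(** * Fourier coefficients and Fejer means *)

Section Trig.
Context {R : realType}.
Implicit Types (f g : R -> R) (x y h : R).
Local Notation T := ((pi : R) *+ 2).

Lemma period_gt0 : 0 < T.
Proof. by rewrite pmulrn_lgt0// pi_gt0. Qed.

Lemma derive_Ic F f : (forall x, is_derive x 1 F (f x)) -> continuous f ->
  Ic f = F T - F 0.
Proof.
move=> dF cf; have dF' x : derivable F x 1 by case: (dF x).
have T0 := period_gt0.
have cF : continuous F by move=> x; exact/differentiable_continuous/derivable1_diffP.
rewrite /Ic /Rintegral integral_circ; last first.
  by apply/measurable_EFinP; exact: continuous_measurable.
rewrite /period_itv (@continuous_FTC2 _ f F)//.
- exact: continuous_subspaceT.
- split=> [x _||].
  + exact: dF'.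
  + exact: cvg_at_right_filter (cF 0).
  + exact: cvg_at_left_filter (cF T).
- by move=> x _; rewrite derive1E; case: (dF x).
Qed.

Lemma cosDz (z : int) x : cos (z%:~R * T + x) = cos x.
Proof.
have H (n : nat) y : cos (n%:R * T + y) = cos y.
  by rewrite addrC mulr_natl; exact: (periodicn (@cosD2pi R)).
case: z => n; first exact: H.
rewrite NegzE mulrNz mulNr -(H n.+1).
by congr cos; rewrite -[_%:~R]pmulrn; ring.
Qed.

Lemma sinDz (z : int) x : sin (z%:~R * T + x) = sin x.
Proof.
have H (n : nat) y : sin (n%:R * T + y) = sin y.
  by rewrite addrC mulr_natl; exact: (periodicn (@sinD2pi R)).
case: z => n; first exact: H.
rewrite NegzE mulrNz mulNr -(H n.+1).
by congr sin; rewrite -[_%:~R]pmulrn; ring.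
Qed.

Lemma is_derive_scale (a x : R) : is_derive x 1 (fun y => a * y) a.
Proof.
by have := is_deriveZ a (is_derive_id x (1 : R)); rewrite /GRing.scale/= mulr1.
Qed.

Lemma is_derive_cosM (a x : R) : is_derive x 1 (fun y => cos (a * y)) (- (a * sin (a * x))).
Proof.
have := @is_derive1_comp _ cos ( *%R a) x _ _ (is_derive_cos (a * x)) (is_derive_scale a x).
by rewrite mulNr mulrC.
Qed.

Lemma is_derive_sinM (a x : R) : is_derive x 1 (fun y => sin (a * y)) (a * cos (a * x)).
Proof.
have := @is_derive1_comp _ sin ( *%R a) x _ _ (is_derive_sin (a * x)) (is_derive_scale a x).
by rewrite mulrC.
Qed.

Lemma is_derive_continuous F (f : R -> R) : (forall x, is_derive x 1 F (f x)) -> continuous F.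
Proof.
move=> dF x; apply/differentiable_continuous/derivable1_diffP.
by case: (dF x).
Qed.

Lemma continuous_cosM (a : R) : continuous (fun y => cos (a * y)).
Proof. exact: is_derive_continuous (is_derive_cosM a). Qed.

Lemma continuous_sinM (a : R) : continuous (fun y => sin (a * y)).
Proof. exact: is_derive_continuous (is_derive_sinM a). Qed.

Lemma L1_cosM (a : R) : L1 (fun y => cos (a * y)).
Proof. exact/continuous_L1/continuous_cosM. Qed.

Lemma L1_sinM (a : R) : L1 (fun y => sin (a * y)).
Proof. exact/continuous_L1/continuous_sinM. Qed.

Lemma Ic_cosz (z : int) : Ic (fun y : R => cos (z%:~R * y)) = T *+ (z == 0).
Proof.
case: eqP => [->|/eqP z0].
  rewrite -[RHS]mul1r -Ic_cst; apply: eq_Ic => y.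
  by rewrite mul0r cos0.
have dF x : is_derive x 1 (fun y => z%:~R^-1 * sin (z%:~R * y)) (cos (z%:~R * x)).
  have := is_deriveZ z%:~R^-1 (is_derive_sinM z%:~R x).
  by rewrite /GRing.scale/= mulKf// intr_eq0.
rewrite (derive_Ic dF); last exact: continuous_cosM.
by rewrite mulr0 -[_ * T]addr0 sinDz subrr.
Qed.

Lemma Ic_sinz (z : int) : Ic (fun y : R => sin (z%:~R * y)) = 0.
Proof.
have [->|z0] := eqVneq z 0.
  by rewrite -[RHS]Ic0; apply: eq_Ic => y; rewrite mul0r sin0.
have dF x : is_derive x 1 (fun y => - z%:~R^-1 * cos (z%:~R * y)) (sin (z%:~R * x)).
  have := is_deriveZ (- z%:~R^-1) (is_derive_cosM z%:~R x).
  by rewrite /GRing.scale/= mulrNN mulKf// intr_eq0.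
rewrite (derive_Ic dF); last exact: continuous_sinM.
by rewrite mulr0 -[_ * T]addr0 cosDz subrr.
Qed.

Lemma Ic_cos_cos (j k : nat) : (0 < k)%N ->
  Ic (fun y : R => cos (j%:R * y) * cos (k%:R * y)) = pi *+ (j == k).
Proof.
move=> k0.
have E (y : R) : cos (j%:R * y) * cos (k%:R * y) =
    2^-1 * cos ((j%:Z - k%:Z)%:~R * y) + 2^-1 * cos ((j%:Z + k%:Z)%:~R * y).
  by rewrite rmorphB rmorphD/= !mulrDl mulNr cosB cosD; field.
rewrite (eq_Ic E) IcD; try exact/L1Z/L1_cosM.
rewrite !IcZ; try exact: L1_cosM.
have jk0 : (j%:Z + k%:Z == 0) = false by lia.
rewrite !Ic_cosz subr_eq0 eqz_nat jk0.
by case: eqP => _; rewrite ?mulr0n ?mulr1n; field.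
Qed.

Lemma Ic_sin_sin (j k : nat) : (0 < k)%N ->
  Ic (fun y : R => sin (j%:R * y) * sin (k%:R * y)) = pi *+ (j == k).
Proof.
move=> k0.
have E (y : R) : sin (j%:R * y) * sin (k%:R * y) =
    2^-1 * cos ((j%:Z - k%:Z)%:~R * y) + - 2^-1 * cos ((j%:Z + k%:Z)%:~R * y).
  by rewrite rmorphB rmorphD/= !mulrDl mulNr cosB cosD; field.
rewrite (eq_Ic E) IcD; try exact/L1Z/L1_cosM.
rewrite !IcZ; try exact: L1_cosM.
have jk0 : (j%:Z + k%:Z == 0) = false by lia.
rewrite !Ic_cosz subr_eq0 eqz_nat jk0.
by case: eqP => _; rewrite ?mulr0n ?mulr1n; field.
Qed.

Lemma Ic_sin_cos (j k : nat) :
  Ic (fun y : R => sin (j%:R * y) * cos (k%:R * y)) = 0.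
Proof.
have E (y : R) : sin (j%:R * y) * cos (k%:R * y) =
    2^-1 * sin ((j%:Z - k%:Z)%:~R * y) + 2^-1 * sin ((j%:Z + k%:Z)%:~R * y).
  by rewrite rmorphB rmorphD/= !mulrDl mulNr sinB sinD; field.
rewrite (eq_Ic E) IcD; try exact/L1Z/L1_sinM.
rewrite !IcZ; try exact: L1_sinM.
by rewrite !Ic_sinz mulr0 addr0.
Qed.

(** Unnormalised real coefficients: [2 pi] times the [k]-th Fourier coefficient of [f] is
    [acoef f k - i * bcoef f k]. *)
Definition acoef (f : R -> R) (k : nat) : R := Ic (fun x => f x * cos (k%:R * x)).
Definition bcoef (f : R -> R) (k : nat) : R := Ic (fun x => f x * sin (k%:R * x)).

Lemma L1_mul_cos f (a : R) : L1 f -> L1 (fun x => f x * cos (a * x)).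
Proof.
move=> f1; apply: (L1_mul_bounded (M := 1) f1).
  exact: continuous_measurable (@continuous_cosM a).
by move=> x; exact: cos_max.
Qed.

Lemma L1_mul_sin f (a : R) : L1 f -> L1 (fun x => f x * sin (a * x)).
Proof.
move=> f1; apply: (L1_mul_bounded (M := 1) f1).
  exact: continuous_measurable (@continuous_sinM a).
by move=> x; exact: sin_max.
Qed.

Definition trigpoly (n : nat) (a b : nat -> R) (x : R) : R :=
  \sum_(j < n) (a j * cos (j%:R * x) + b j * sin (j%:R * x)).

Lemma trigpolyS n a b x : trigpoly n.+1 a b x =
  trigpoly n a b x + (a n * cos (n%:R * x) + b n * sin (n%:R * x)).
Proof. by rewrite /trigpoly big_ord_recr. Qed.

Lemma trigpoly_periodic n a b : periodic (trigpoly n a b) T.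
Proof.
move=> x; apply: eq_bigr => j _.
rewrite (_ : j%:R * (x + T) = (j : int)%:~R * T + j%:R * x).
  by rewrite cosDz sinDz.
by rewrite -[(j : int)%:~R]pmulrn; ring.
Qed.

Lemma is_derive_trigpoly n a b x : is_derive x 1 (trigpoly n a b)
  (trigpoly n (fun j => j%:R * b j) (fun j => - (j%:R * a j)) x).
Proof.
elim: n => [|n IH].
  have -> : trigpoly 0 a b = cst 0 by apply/funext => y; rewrite /trigpoly big_ord0.
  by rewrite /trigpoly big_ord0; exact: is_derive_cst.
have -> : trigpoly n.+1 a b =
    trigpoly n a b + (fun y => a n * cos (n%:R * y)) + (fun y => b n * sin (n%:R * y)).
  by apply/funext => y; rewrite trigpolyS addrA.
have d1 := is_deriveZ (a n) (is_derive_cosM n%:R x).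
have d2 := is_deriveZ (b n) (is_derive_sinM n%:R x).
have := is_deriveD (is_deriveD IH d1) d2; rewrite /GRing.scale/=.
rewrite trigpolyS.
by move=> d; apply: is_derive_eq d _; ring.
Qed.

Lemma trigpoly_continuous n a b : continuous (trigpoly n a b).
Proof. by move=> x; apply: (is_derive_continuous (is_derive_trigpoly n a b)). Qed.

(** Coefficients of [(sin (n h / 2) / sin (h / 2))^2], which is [n] times the usual Fejer kernel,
    with the frequencies [j] and [- j] merged. Without the division by [n], the kernel of order [k]
    is the one that arises in [gagliardoE]. *)
Definition fejer_weight (n j : nat) : R := if j is 0%N then n%:R else 2 * (n%:R - j%:R).

Definition fejer_kernel (n : nat) (h : R) : R :=
  \sum_(j < n) fejer_weight n j * cos (j%:R * h).

(** The Fejer kernel is the sum of the Dirichlet kernels [D 1], ..., [D n]. Multiplied by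
    [1 - cos h], each of these telescopes to a difference of two cosines, and their sum telescopes
    once more. *)
Lemma fejer_kernelE n h : (1 - cos h) * fejer_kernel n h = 1 - cos (n%:R * h).
Proof.
pose D k := \sum_(j < k) (if j == 0%N :> nat then 1 else 2) * cos (j%:R * h).
have DE k : (1 - cos h) * D k.+1 = cos (k%:R * h) - cos (k.+1%:R * h).
  elim: k => [|k IH].
    by rewrite /D big_ord_recr/= big_ord0 !mul0r cos0 !mul1r; ring.
  rewrite /D big_ord_recr/= mulrDr -/(D _) IH.
  rewrite (_ : k.+2%:R * h = k.+1%:R * h + h); last by rewrite -[in LHS]natr1; ring.
  rewrite (_ : k%:R * h = k.+1%:R * h - h); last by rewrite -[in RHS]natr1; ring.
  by rewrite cosB cosD; ring.
elim: n => [|n IH]; first by rewrite /fejer_kernel big_ord0 mul0r cos0; ring.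
have -> : fejer_kernel n.+1 h = fejer_kernel n h + D n.+1.
  rewrite /fejer_kernel /D !big_ord_recr/= addrA -big_split/=; congr (_ + _).
    by apply: eq_bigr => -[[|j] /= jn] _; rewrite -natr1; ring.
  by case: n {IH} => [|n]//=; rewrite -!natr1; ring.
by rewrite mulrDr IH DE; ring.
Qed.

Lemma fejer_kernel0 n : fejer_kernel n 0 >= 0.
Proof.
apply: sumr_ge0 => -[[|j] /= jn] _; rewrite mulr0 cos0 mulr1//.
by rewrite mulr_ge0// subr_ge0 ler_nat ltnW.
Qed.

Lemma cos_eq1_fejer_kernel n h : cos h = 1 -> fejer_kernel n h = fejer_kernel n 0.
Proof.
move=> h1; apply: eq_bigr => j _; rewrite mulr0 cos0; congr (_ * _).
have s0 : sin h = 0 by apply: cos1sin0; rewrite h1 normr1.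
have : cos (j%:R * h) = 1 /\ sin (j%:R * h) = 0.
  elim: (nat_of_ord j) => [|k [c s]]; first by rewrite mul0r cos0 sin0.
  by rewrite -natr1 mulrDl mul1r cosD sinD c s h1 s0; split; ring.
by case.
Qed.

(** Where [cos h = 1], [fejer_kernelE] reads [0 = 0]; there the kernel is the sum of its nonnegative
    weights. *)
Lemma fejer_kernel_ge0 n h : 0 <= fejer_kernel n h.
Proof.
have [h1|h1] := eqVneq (cos h) 1; first by rewrite (cos_eq1_fejer_kernel _ h1) fejer_kernel0.
have h0 : 0 < 1 - cos h by rewrite subr_gt0 lt_neqAle h1 cos_le1.
by rewrite -(pmulr_rge0 _ h0) fejer_kernelE subr_ge0 cos_le1.
Qed.

Lemma fejer_kernel_continuous n : continuous (fejer_kernel n).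
Proof.
have -> : fejer_kernel n = trigpoly n (fejer_weight n) (fun=> 0).
  by apply/funext => h; apply: eq_bigr => j _; rewrite mul0r addr0.
exact: trigpoly_continuous.
Qed.

Definition fejer (n : nat) (f : R -> R) (x : R) : R :=
  (n%:R * T)^-1 * Ic (fun y => f y * fejer_kernel n (x - y)).

Lemma fejerE n f x : L1 f -> fejer n f x =
  trigpoly n (fun j => (n%:R * T)^-1 * fejer_weight n j * acoef f j)
             (fun j => (n%:R * T)^-1 * fejer_weight n j * bcoef f j) x.
Proof.
move=> f1; rewrite /fejer /trigpoly.
have E y : f y * fejer_kernel n (x - y) = \sum_(j < n)
    (fejer_weight n j * cos (j%:R * x) * (f y * cos (j%:R * y)) +
     fejer_weight n j * sin (j%:R * x) * (f y * sin (j%:R * y))).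
  rewrite /fejer_kernel mulr_sumr; apply: eq_bigr => j _.
  by rewrite mulrBr cosB; ring.
rewrite (eq_Ic E) Ic_sum; last first.
  by move=> j; apply: L1D; apply: L1Z; [exact: L1_mul_cos|exact: L1_mul_sin].
rewrite mulr_sumr; apply: eq_bigr => j _.
rewrite IcD; [|exact/L1Z/L1_mul_cos|exact/L1Z/L1_mul_sin].
rewrite !IcZ; [|exact/L1_mul_sin|exact/L1_mul_cos].
by rewrite -/(acoef f j) -/(bcoef f j); ring.
Qed.

Lemma Ic_cosB (k : nat) x : (0 < k)%N -> Ic (fun y : R => cos (k%:R * (x - y))) = 0.
Proof.
move=> k0; have E y : cos (k%:R * (x - y)) =
    cos (k%:R * x) * cos ((k : int)%:~R * y) + sin (k%:R * x) * sin ((k : int)%:~R * y).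
  by rewrite mulrBr cosB.
rewrite (eq_Ic E) IcD; [|exact/L1Z/L1_cosM|exact/L1Z/L1_sinM].
rewrite !IcZ; [|exact: L1_sinM|exact: L1_cosM].
by rewrite Ic_cosz Ic_sinz eqz_nat (negbTE (lt0n_neq0 k0)) !mulr0 addr0.
Qed.

Lemma L1_cosB (a x : R) : L1 (fun y : R => cos (a * (x - y))).
Proof.
have E y : cos (a * x) * cos (a * y) + sin (a * x) * sin (a * y) = cos (a * (x - y)).
  by rewrite mulrBr cosB.
by apply: (eq_L1 E); apply: L1D; apply: L1Z; [exact: L1_cosM|exact: L1_sinM].
Qed.

Lemma Ic_fejer_kernel n x : Ic (fun y => fejer_kernel n (x - y)) = n%:R * T.
Proof.
rewrite /fejer_kernel Ic_sum; last by move=> j; exact/L1Z/L1_cosB.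
case: n => [|n]; first by rewrite big_ord0 mul0r.
rewrite big_ord_recl/= big1 ?addr0.
  rewrite IcZ; last exact: L1_cosB.
  congr (_ * _); rewrite -[RHS]mul1r -Ic_cst; apply: eq_Ic => y.
  by rewrite mul0r cos0.
by move=> j _; rewrite IcZ ?Ic_cosB ?mulr0//; exact: L1_cosB.
Qed.

(** Against the kernel, [e] integrates to [e * n * 2 pi], while [c * (1 - cos)] becomes
    [c * (1 - cos (n (x - y)))] by [fejer_kernelE], of integral [c * 2 pi] whatever [n]. The
    normalisation divides both by [n * 2 pi]. *)
Lemma fejer_err n f x e c : L1 f -> (0 < n)%N -> 0 <= e -> 0 <= c ->
  (forall y, `|f y - f x| <= e + c * (1 - cos (x - y))) ->
  `|fejer n f x - f x| <= e + c / n%:R.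
Proof.
move=> f1 n0 e0 c0 fe.
have nT0 : 0 < n%:R * T by rewrite mulr_gt0 ?ltr0n// period_gt0.
have cB : continuous (fun y : R => x - y).
  by move=> y; apply: continuousB; [exact: cst_continuous|exact: cvg_id].
have cK : continuous (fun y => fejer_kernel n (x - y)).
  move=> y; apply: (@continuous_comp _ _ _ (fun y => x - y) (fejer_kernel n)); first exact: cB.
  exact: fejer_kernel_continuous.
have KL1 : L1 (fun y => fejer_kernel n (x - y)) := continuous_L1 cK.
have [M KM] : exists M, forall y, `|fejer_kernel n (x - y)| <= M.
  exists (\sum_(j < n) `|fejer_weight n j|) => y.
  rewrite (le_trans (ler_norm_sum _ _ _))//; apply: ler_sum => j _.
  by rewrite normrM ler_piMr// cos_max.
have fK : L1 (fun y => f y * fejer_kernel n (x - y)).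
  by apply: (L1_mul_bounded f1 _ KM); exact: continuous_measurable.
have -> : fejer n f x - f x =
    (n%:R * T)^-1 * Ic (fun y => f y * fejer_kernel n (x - y) - f x * fejer_kernel n (x - y)).
  rewrite IcB//; last exact: L1Z.
  by rewrite IcZ// Ic_fejer_kernel /fejer mulrBr (mulrC (f x)) mulrA mulVf ?mul1r// gt_eqF.
rewrite normrM gtr0_norm ?invr_gt0// ler_pdivrMl//.
have dK : L1 (fun y => f y * fejer_kernel n (x - y) - f x * fejer_kernel n (x - y)).
  by apply: L1B => //; exact: L1Z.
apply: (le_trans (le_norm_Ic dK)).
have cL : L1 (fun y : R => c * (1 - cos (n%:R * (x - y)))).
  by apply: L1Z; apply: L1B; [exact: L1_cst|exact: L1_cosB].
apply: (@le_trans _ _ (Ic (fun y => e * fejer_kernel n (x - y) + c * (1 - cos (n%:R * (x - y)))))).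
  apply: le_Ic; [exact: L1_norm|by apply: L1D => //; exact: L1Z|move=> y].
  rewrite -mulrBl normrM (ger0_norm (fejer_kernel_ge0 _ _)) -fejer_kernelE mulrA -mulrDl.
  by rewrite ler_wpM2r// fejer_kernel_ge0.
rewrite IcD//; last exact: L1Z.
rewrite !IcZ//; last by apply: L1B; [exact: L1_cst|exact: L1_cosB].
rewrite Ic_fejer_kernel IcB; [|exact: L1_cst|exact: L1_cosB].
rewrite Ic_cosB// Ic_cst subr0 mul1r le_eqVlt; apply/orP; left; apply/eqP.
by field; rewrite pnatr_eq0 -lt0n.
Qed.

End Trig.

(** * Change of variables on the circle *)

Section WeightedImage.
Context {R : realType}.
Local Notation leb := (@lebesgue_measure R).
Variables (phi w : R -> R).
Hypothesis mphi : measurable_fun setT phi.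
Hypothesis mw : measurable_fun setT w.
Hypothesis w0 : forall x, 0 <= w x.

Let mphi_pre (A : set R) : measurable A -> measurable (phi @^-1` A).
Proof. by move=> mA; rewrite -[X in measurable X]setTI; exact: mphi. Qed.

(** The image under [phi] of the measure with density [w]. Once it agrees with Lebesgue measure on
    half-open intervals, it does so on all measurable sets, and substitution follows for indicators,
    simple functions and monotone limits. *)
Definition weighted_image (A : set (measurableTypeR R)) : \bar R :=
  (\int[leb]_(x in phi @^-1` A) (w x)%:E)%E.

Let wi0 : weighted_image set0 = 0%E.
Proof. by rewrite /weighted_image preimage_set0 integral_set0. Qed.

Let wi_ge0 A : (0 <= weighted_image A)%E.
Proof. by apply: integral_ge0 => x _; rewrite lee_fin. Qed.

Let wi_sigma_additive : semi_sigma_additive weighted_image.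
Proof.
move=> /= F mF tF mUF; rewrite /weighted_image; apply: cvg_toP.
  apply: ereal_nondecreasing_is_cvgn => m n mn.
  apply: lee_sum_nneg_natr => // k _ _; apply: integral_ge0 => /= x Fkx.
  by rewrite lee_fin.
rewrite preimage_bigcup ge0_integral_bigcup//=.
- by move=> k; exact (mphi_pre (mF k)).
- by apply: measurable_funTS; exact/measurable_EFinP.
- by move=> x _; rewrite lee_fin.
- apply/trivIsetP => i j _ _ ij; rewrite -preimage_setI.
  by move/trivIsetP : tF => /(_ i j Logic.I Logic.I ij) ->; rewrite preimage_set0.
Qed.

HB.instance Definition _ := isMeasure.Build _ _ _
  weighted_image wi0 wi_ge0 wi_sigma_additive.

Hypothesis wi_itv : forall a b : R, a < b ->
  weighted_image `]a, b]%classic = (b - a)%:E.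

Let wiE (A : set R) : measurable A -> weighted_image A = leb A.
Proof.
move=> mA; apply/esym/(lebesgue_measure_unique (mu := weighted_image)) => // X.
case/ocitvP => [->|[[a b]/= ab ->]]; first by rewrite !measure0.
by rewrite [RHS]wi_itv// lebesgue_measure_itv/= lte_fin ab.
Qed.

Import HBNNSimple.

Let integral_indic_comp (A : set R) : measurable A ->
  (\int[leb]_x ((\1_A (phi x))%:E * (w x)%:E) = leb A)%E.
Proof.
move=> mA; rewrite -wiE// /weighted_image [RHS]integral_mkcond.
apply: eq_integral => x _; rewrite patchE indicE.
rewrite (_ : (x \in phi @^-1` A) = (phi x \in A))//.
by case: (phi x \in A); rewrite ?mul1e ?mul0e.
Qed.

Let integral_nnsfun_comp (h : {nnsfun R >-> R}) :
  (\int[leb]_x ((h (phi x))%:E * (w x)%:E) = \int[leb]_x (h x)%:E)%E.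
Proof.
have mh r : measurable (h @^-1` [set r]) by [].
transitivity (\sum_(r \in range h)
    \int[leb]_x (r%:E * ((\1_(h @^-1` [set r]) (phi x))%:E * (w x)%:E)))%E.
  rewrite -ge0_integral_fsum//.
  - apply: eq_integral => x _; rewrite fimfunE -fsumEFin// ge0_mule_fsuml.
      by apply: eq_fsbigr => r _; rewrite EFinM muleA.
    by move=> r; rewrite EFinM nnfun_muleindic_ge0.
  - move=> r; apply: measurable_funeM; apply: emeasurable_funM.
      by apply/measurable_EFinP; apply: measurableT_comp.
    exact/measurable_EFinP.
  - by move=> r x _; rewrite muleA; apply: mule_ge0; rewrite ?lee_fin//; exact: nnfun_muleindic_ge0.
transitivity (\sum_(r \in range h) \int[leb]_x (r%:E * (\1_(h @^-1` [set r]) x)%:E))%E.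
  apply: eq_fsbigr => r /[!inE] -[y _ <-].
  rewrite ge0_integralZl//; last 3 first.
- apply: emeasurable_funM; last exact/measurable_EFinP.
  by apply/measurable_EFinP; apply: measurableT_comp.
- by move=> x _; rewrite mule_ge0// lee_fin.
- by rewrite lee_fin.
rewrite ge0_integralZl//.
- congr (_ * _)%E; rewrite (integral_indic_comp (mh (h y))) integral_indic.
  + by rewrite setIT.
  + exact: measurableT.
  + exact: mh.
- by apply/measurable_EFinP; exact: measurable_indic (mh (h y)).
- by rewrite lee_fin.
rewrite -ge0_integral_fsum//.
- by apply: eq_integral => x _; rewrite fimfunE -fsumEFin.
- move=> r; apply: measurable_funeM; apply/measurable_EFinP.
  exact: measurable_indic (mh r).
- by move=> r x _; rewrite nnfun_muleindic_ge0.
Qed.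

Lemma ge0_integral_weighted_image (f : R -> \bar R) : measurable_fun setT f ->
  (forall x, 0 <= f x)%E ->
  (\int[leb]_x (f (phi x) * (w x)%:E) = \int[leb]_x f x)%E.
Proof.
move=> mf f0; pose f_ := nnsfun_approx measurableT mf.
have mf_ n : measurable_fun setT (f_ n) by exact: measurable_funP.
have cf x : EFin \o f_^~ x @ \oo --> f x by exact: cvg_nnsfun_approx.
have nd x : {homo (fun n => (f_ n x)%:E) : m n / (m <= n)%N >-> (m <= n)%E}.
  by move=> a b ab; rewrite lee_fin; exact/lefP/nd_nnsfun_approx.
transitivity (limn (fun n => \int[leb]_x ((f_ n (phi x))%:E * (w x)%:E)))%E.
  rewrite -monotone_convergence//=.
  - apply: eq_integral => x _; apply/esym/cvg_lim => //.
    by apply: cvgeZr => //; exact: cf.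
  - move=> n; apply: emeasurable_funM; last exact/measurable_EFinP.
    by apply/measurable_EFinP; apply: measurableT_comp.
  - by move=> n x _; rewrite mule_ge0// lee_fin.
  - by move=> x _ a b ab; apply: lee_wpmul2r; [rewrite lee_fin|exact: nd].
transitivity (limn (fun n => \int[leb]_x (f_ n x)%:E))%E.
  by congr (limn _); apply/funext => n; exact: integral_nnsfun_comp.
rewrite -monotone_convergence//=.
- by apply: eq_integral => x _; apply/cvg_lim => //; exact: cf.
- by move=> n; apply/measurable_EFinP; exact: mf_.
- by move=> n x _; rewrite lee_fin.
Qed.

End WeightedImage.

Section PeriodicSubstitution.
Context {R : realType}.
Local Notation leb := (@lebesgue_measure R).
Local Notation T := ((pi : R) *+ 2).

Lemma ge0_integral_translate (f : R -> \bar R) (c : R) : measurable_fun setT f ->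
  (forall x, 0 <= f x)%E -> (\int[leb]_x f (x + c)%R = \int[leb]_x f x)%E.
Proof.
move=> mf f0; have mc : measurable_fun setT (fun x : R => x + c).
  by apply: measurable_funD => //; exact: measurable_cst.
rewrite -[RHS](@ge0_integral_weighted_image _ (fun x => x + c) (cst 1))//.
- by apply: eq_integral => x _; rewrite mule1.
- move=> a b ab; rewrite /weighted_image (_ : _ @^-1` _ = `]a - c, b - c]%classic).
    rewrite (eq_integral (cst 1%E))// integral_cst//= lebesgue_measure_itv/= lte_fin ltrD2r ab mul1e.
    by rewrite -EFinB; congr EFin; ring.
  by apply/seteqP; split=> x /=; rewrite !in_itv/= ltrBlDr lerBrDr.
Qed.

Lemma integral_indic_mul (A : set R) (f : R -> \bar R) :
  (\int[leb]_(x in A) f x = \int[leb]_x (f x * (\1_A x)%:E))%E.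
Proof.
rewrite integral_mkcond; apply: eq_integral => x _; rewrite patchE indicE.
by case: ifPn => _; rewrite ?mule1 ?mule0.
Qed.

Lemma measurable_indic_mul (A : set R) (f : R -> \bar R) : measurable A ->
  measurable_fun setT f -> measurable_fun setT (fun x => f x * (\1_A x)%:E)%E.
Proof.
move=> mA mf; apply: emeasurable_funM => //.
by apply/measurable_EFinP; exact: measurable_indic.
Qed.

Lemma ge0_integral_translate_itv (f : R -> \bar R) (a b c : R) : measurable_fun setT f ->
  (forall x, 0 <= f x)%E -> (forall x, f (x + c) = f x) ->
  (\int[leb]_(x in `](a + c)%R, (b + c)%R]) f x = \int[leb]_(x in `]a, b]) f x)%E.
Proof.
move=> mf f0 fc; rewrite [LHS]integral_indic_mul [RHS]integral_indic_mul.
rewrite -[LHS](@ge0_integral_translate _ c).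
- apply: eq_integral => x _; rewrite fc !indicE; congr (_ * _%:R%:E)%E.
  by congr nat_of_bool; apply/idP/idP; rewrite !inE/= !in_itv/= lerD2r ltrD2r.
- by apply: measurable_indic_mul => //; exact: measurable_itv.
- by move=> x; rewrite mule_ge0// lee_fin.
Qed.

Lemma periodic_shiftz (f : R -> \bar R) : (forall x, f (x + T) = f x) ->
  forall (z : int) x, f (x + z%:~R * T) = f x.
Proof.
move=> fT; have H (n : nat) y : f (y + n%:R * T) = f y.
  elim: n => [|n IH]; first by rewrite mul0r addr0.
  by rewrite -natr1 mulrDl mul1r addrA fT.
case=> n x; first exact: H.
rewrite NegzE mulrNz mulNr -[LHS](H n.+1).
by congr f; rewrite -[_%:~R]pmulrn; ring.
Qed.

Lemma ge0_integral_period (f : R -> \bar R) (a : R) : measurable_fun setT f ->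
  (forall x, 0 <= f x)%E -> (forall x, f (x + T) = f x) ->
  (\int[leb]_(x in `]a, (a + T)%R]) f x = \int[circ]_x f x)%E.
Proof.
move=> mf f0 fT; have T0 := @period_gt0 R.
rewrite ge0_integral_circ// /period_itv -integral_itv_obnd_cbnd; last first.
  exact: measurable_funTS.
(* A translation by [z] periods brings the left end to [b] in [[0, T[]. The window []b, b + T]] is
   then cut at [T], and its overhang []T, b + T]] is the translate of the missing piece []0, b]]. *)
pose z := Num.floor (a / T).
pose b := a - z%:~R * T.
have b0 : 0 <= b by rewrite subr_ge0 -ler_pdivlMr// floor_le.
have bT : b < T.
  have : a / T < (z + 1)%:~R by exact: floorD1_gt.
  by rewrite ltr_pdivrMr// intrD mulrDl mul1r ltrBlDl.
rewrite (_ : a = b + z%:~R * T); last by rewrite subrK.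
rewrite (_ : b + z%:~R * T + T = b + T + z%:~R * T); last by rewrite addrAC.
rewrite ge0_integral_translate_itv//; last exact: periodic_shiftz.
have split_itv (u v w : R) : u <= v -> v <= w ->
    (\int[leb]_(x in `]u, w]) f x =
     \int[leb]_(x in `]u, v]) f x + \int[leb]_(x in `]v, w]) f x)%E.
  move=> uv vw; rewrite -ge0_integral_setU//=.
  - by rewrite -itv_bndbnd_setU ?bnd_simp.
  - exact: measurable_funTS.
  - apply/disj_setPS => x [] /=; rewrite !in_itv/= => /andP[_ xv] /andP[vx _].
    by rewrite lt_geF in xv.
rewrite (split_itv b T (b + T)) ?(ltW bT)//; last by rewrite lerDr.
rewrite (split_itv 0 b T) ?(ltW bT)// addeC; congr (_ + _)%E.
by rewrite -{1}[T]add0r ge0_integral_translate_itv.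
Qed.

Variables (phi w : R -> R).
Hypothesis dphi : forall x : R, is_derive x (1 : R) phi (w x).
Hypothesis cw : continuous w.
Hypothesis w0 : forall x, 0 < w x.
Hypothesis phiT : forall x, phi (x + T) = phi x + T.

Let cphi : continuous phi. Proof. exact: is_derive_continuous dphi. Qed.

Let phi_incr x y : x < y -> phi x < phi y.
Proof.
move=> xy; have [c _ E] := MVT xy (fun x _ => dphi x) (continuous_subspaceT cphi).
by rewrite -subr_gt0 E mulr_gt0// subr_gt0.
Qed.

Let phi_mono x y : (phi x < phi y) = (x < y).
Proof.
apply/idP/idP; last exact: phi_incr.
by case: (ltgtP x y) => // [/phi_incr/ltW|->]; rewrite ?ltxx// leNgt => /negbTE ->.
Qed.

Let phi_monole x y : (phi x <= phi y) = (x <= y).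
Proof. by rewrite !leNgt phi_mono. Qed.

Let phi_surj b : exists x, phi x = b.
Proof.
have H (n : nat) x : phi (x + n%:R * T) = phi x + n%:R * T.
  elim: n => [|n IH]; first by rewrite !mul0r !addr0.
  rewrite (_ : x + n.+1%:R * T = x + n%:R * T + T); last by rewrite -natr1; ring.
  by rewrite phiT IH -natr1; ring.
have T0 := @period_gt0 R.
have [n nb] : exists n : nat, `|b - phi 0| < n%:R * T.
  exists (Num.bound (`|b - phi 0| / T)); rewrite -ltr_pdivrMr//.
  by apply: archi_boundP; rewrite divr_ge0// ltW.
have h1 : phi (0 + n%:R * T) = phi 0 + n%:R * T by [].
have h2 : phi (- (n%:R * T)) = phi 0 - n%:R * T.
  by rewrite -[in RHS](subrr (n%:R * T)) [X in phi X - _]addrC H addrK.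
have nT : - (n%:R * T) <= 0 + n%:R * T.
  by rewrite add0r -subr_ge0 opprK; apply: addr_ge0; rewrite mulr_ge0// ltW.
have [|c _ <-] := @IVT _ phi _ _ b nT (continuous_subspaceT cphi); last by exists c.
move: nb; rewrite ltr_norml => /andP[b1 b2].
by rewrite h1 h2 ge_min le_max; apply/andP; split; apply/orP; [left|right]; lra.
Qed.

(** [phi] carries []0, T]] bijectively onto []phi 0, phi 0 + T]], which is again a full period, so
    that [ge0_integral_period] brings the integral back to [circ]. *)
Lemma ge0_integral_subst (f : R -> \bar R) : measurable_fun setT f ->
  (forall x, 0 <= f x)%E -> (forall x, f (x + T) = f x) ->
  (\int[circ]_x (f (phi x) * (w x)%:E) = \int[circ]_x f x)%E.
Proof.
move=> mf f0 fT; have mphi := continuous_measurable cphi.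
have mw := continuous_measurable cw.
have T0 := @period_gt0 R.
have mfw : measurable_fun setT (fun x => f (phi x) * (w x)%:E)%E.
  by apply: emeasurable_funM; [exact: measurableT_comp|exact/measurable_EFinP].
rewrite -[RHS](@ge0_integral_period _ (phi 0))//.
rewrite ge0_integral_circ//; last by move=> x; rewrite mule_ge0// lee_fin ltW.
rewrite /period_itv -integral_itv_obnd_cbnd; last exact: measurable_funTS.
rewrite [LHS]integral_indic_mul [RHS]integral_indic_mul.
rewrite -[RHS](@ge0_integral_weighted_image _ phi w)//.
- apply: eq_integral => x _; rewrite muleAC; congr (_ * _ * _)%E; rewrite !indicE.
  congr (_%:R%:E); congr nat_of_bool; apply/idP/idP; rewrite !inE/= !in_itv/=.
    by move=> /andP[x0 xT]; rewrite phi_mono x0 -phiT add0r phi_monole.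
  by rewrite phi_mono -phiT add0r phi_monole.
- by move=> x; exact: ltW.
- move=> a b ab; have [x xa] := phi_surj a; have [y yb] := phi_surj b.
  have xy : x < y by rewrite -phi_mono xa yb.
  rewrite /weighted_image (_ : _ @^-1` _ = `]x, y]%classic); last first.
    by apply/seteqP; split=> z /=; rewrite !in_itv/= -xa -yb phi_mono phi_monole.
  rewrite integral_itv_obnd_cbnd; last first.
    by apply: measurable_funTS; exact/measurable_EFinP.
  rewrite (@continuous_FTC2 _ w phi)//.
  + by rewrite xa yb.
  + exact: continuous_subspaceT.
  + split=> [z _||]; first by case: (dphi z).
      by apply: cvg_at_right_filter; exact: cphi.
    by apply: cvg_at_left_filter; exact: cphi.
  + by move=> z _; rewrite derive1E; case: (dphi z).
- by apply: measurable_indic_mul => //; exact: measurable_itv.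
- by move=> x; rewrite mule_ge0// lee_fin.
Qed.

End PeriodicSubstitution.

(** * Integrable functions with vanishing Fourier coefficients *)

Section Uniqueness.
Context {R : realType}.
Implicit Types (f g h : R -> R) (x y : R).
Local Notation leb := (@lebesgue_measure R).
Local Notation T := ((pi : R) *+ 2).

Lemma ae_circ_impl (P Q : R -> Prop) : (forall x, P x -> Q x) ->
  {ae circ, forall x, P x} -> {ae circ, forall x, Q x}.
Proof.
move=> PQ [N [mN N0 sub]]; exists N; split=> // x nQ; apply: sub => /PQ.
exact: nQ.
Qed.

(** The dominating function is allowed the value [+oo]: in [riesz_fischer] it is a series that may
    diverge on a null set. *)
Lemma Ic_dct (F : nat -> R -> R) f (G : R -> \bar R) :
  (forall n, measurable_fun setT (F n)) -> measurable_fun setT f ->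
  {ae circ, forall x, F^~ x @ \oo --> f x} ->
  circ.-integrable setT G ->
  (forall n x, (`|F n x|%:E <= G x)%E) ->
  L1 f /\ (fun n => Ic (F n)) @ \oo --> Ic f.
Proof.
move=> mF mf Ff iG FG.
have [] := @dominated_convergence _ _ _ circ setT measurableT
  (fun n => EFin \o F n) (EFin \o f) G.
- by move=> n; apply/measurable_EFinP; exact: mF.
- exact/measurable_EFinP.
- apply: ae_circ_impl Ff => x Fx _.
  by apply: cvg_EFin; [exact: nearW|exact: Fx].
- exact: iG.
- by apply/aeW => x n _; exact: FG.
move=> f1 _ lim; split=> //.
have -> : (fun n => Ic (F n)) = fine \o (fun n => \int[circ]_x (EFin \o F n) x)%E.
  by [].
by apply: fine_cvg; rewrite (EFin_Ic f1).
Qed.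

(* Exactly what the Fejer means of [f] need to converge uniformly: the Fejer kernel
   of order [n] integrates [1 - cos] to [O(1 / n)]. *)
Definition circle_regular f := forall e, 0 < e -> exists2 c, 0 <= c &
  forall x y, `|f y - f x| <= e + c * (1 - cos (x - y)).

(** The hypothesis is a Lipschitz condition for the chord distance; the inequality
    [|a| <= e + a ^+ 2 / (4 * e)] makes it linear in [1 - cos (x - y)]. *)
Lemma lipschitz_circle_regular f c : 0 <= c ->
  (forall x y, (f y - f x) ^+ 2 <= c * (1 - cos (x - y))) -> circle_regular f.
Proof.
move=> c0 fc e e0; exists (c / (4 * e)); first by rewrite divr_ge0// mulr_ge0// ltW.
move=> x y; apply: (@le_trans _ _ (e + (f y - f x) ^+ 2 / (4 * e))).
  rewrite -(real_normK (num_real (f y - f x))) -subr_ge0.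
  have -> : e + `|f y - f x| ^+ 2 / (4 * e) - `|f y - f x| = (2 * e - `|f y - f x|) ^+ 2 / (4 * e).
    by field; lra.
  by rewrite divr_ge0 ?sqr_ge0//; lra.
by rewrite lerD2l [leRHS]mulrAC ler_wpM2r ?fc// invr_ge0; lra.
Qed.

Lemma cvg_fejer f : L1 f -> circle_regular f -> forall e, 0 < e ->
  exists N, forall n, (N <= n)%N -> (0 < n)%N -> forall x, `|fejer n f x - f x| <= e.
Proof.
move=> f1 fr e e0; have e2 : 0 < e / 2 by rewrite divr_gt0.
have [c c0 fc] := fr _ e2.
exists (Num.bound (c / (e / 2))) => n Nn n0 x.
rewrite (le_trans (fejer_err f1 n0 (ltW e2) c0 (fc x)))//.
rewrite [leRHS](splitr e) lerD2l ler_pdivrMr ?ltr0n// mulrC -ler_pdivrMr//.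
by rewrite (le_trans (ltW (archi_boundP _)))// ?ler_nat// divr_ge0// ltW.
Qed.

Lemma Ic_mul_trigpoly f n a b : L1 f -> Ic (fun x => f x * trigpoly n a b x) =
  \sum_(j < n) (a j * acoef f j + b j * bcoef f j).
Proof.
move=> f1; under eq_Ic do rewrite mulr_sumr.
rewrite Ic_sum.
  apply: eq_bigr => j _.
  have E x : f x * (a j * cos (j%:R * x) + b j * sin (j%:R * x)) =
    a j * (f x * cos (j%:R * x)) + b j * (f x * sin (j%:R * x)) by ring.
  rewrite (eq_Ic E) IcD; [|exact/L1Z/L1_mul_cos|exact/L1Z/L1_mul_sin].
  by rewrite !IcZ; [|exact/L1_mul_sin|exact/L1_mul_cos].
move=> j.
have E x : a j * (f x * cos (j%:R * x)) + b j * (f x * sin (j%:R * x)) =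
  f x * (a j * cos (j%:R * x) + b j * sin (j%:R * x)) by ring.
by apply: (eq_L1 E); apply: L1D; apply: L1Z; [exact: L1_mul_cos|exact: L1_mul_sin].
Qed.

Lemma trigpoly_bounded n (a b : nat -> R) : exists M, forall x, `|trigpoly n a b x| <= M.
Proof.
exists (\sum_(j < n) (`|a j| + `|b j|)) => x.
rewrite (le_trans (ler_norm_sum _ _ _))//; apply: ler_sum => j _.
rewrite (le_trans (ler_normD _ _))// !normrM.
by apply: lerD; rewrite ler_piMr// ?cos_max ?sin_max.
Qed.

Lemma measurable_trigpoly n (a b : nat -> R) : measurable_fun setT (trigpoly n a b).
Proof. exact: continuous_measurable (@trigpoly_continuous _ n a b). Qed.

Lemma L2_trigpoly n (a b : nat -> R) : L2 (trigpoly n a b).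
Proof.
have [M h] := trigpoly_bounded n a b.
exact: (L2_bounded (measurable_trigpoly n a b) h).
Qed.

(** [h] is orthogonal to all trigonometric polynomials, hence to the Fejer means of [f], and these
    converge to [f] uniformly. *)
Lemma Ic_mul_regular0 h f M : L1 h -> (forall k, acoef h k = 0) ->
  (forall k, bcoef h k = 0) -> measurable_fun setT f -> (forall x, `|f x| <= M) ->
  circle_regular f -> Ic (fun x => h x * f x) = 0.
Proof.
move=> h1 ha hb mf fM fr; have f1 := L1_bounded mf fM.
apply/eqP; rewrite -normr_le0; apply/ler_addgt0Pr => e e0; rewrite add0r.
pose H := Ic (fun x => `|h x|) + 1.
have H0 : 0 < H by rewrite ltr_wpDl// Ic_ge0.
have eH : 0 < e / H by rewrite divr_gt0.
have [N /(_ N.+1 (leqnSn N) isT) fe] := cvg_fejer f1 fr eH.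
have hf : L1 (fun x => h x * f x) := L1_mul_bounded h1 mf fM.
have [K hK] := trigpoly_bounded N.+1 (fun j => (N.+1%:R * T)^-1 * fejer_weight N.+1 j * acoef f j)
             (fun j => (N.+1%:R * T)^-1 * fejer_weight N.+1 j * bcoef f j).
set P := trigpoly _ _ _ in hK.
have PE : fejer N.+1 f = P by apply/funext => x; rewrite fejerE.
have mP : measurable_fun setT P := measurable_trigpoly _ _ _.
have hP : L1 (fun x => h x * P x) := L1_mul_bounded h1 mP hK.
have hP0 : Ic (fun x => h x * P x) = 0.
  by rewrite Ic_mul_trigpoly// big1// => j _; rewrite ha hb !mulr0 addr0.
have E x : h x * f x - h x * P x = h x * (f x - P x) by ring.
have hd : L1 (fun x => h x * (f x - P x)) by apply: (eq_L1 E); exact: L1B.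
rewrite -[X in `|X|]subr0 -hP0 -IcB// (eq_Ic E) (le_trans (le_norm_Ic hd))//.
apply: (@le_trans _ _ (Ic (fun x => e / H * `|h x|))).
  apply: le_Ic; [exact: L1_norm|exact/L1Z/L1_norm|move=> x].
  by rewrite normrM mulrC ler_wpM2r// -PE distrC fe.
rewrite IcZ; last exact: L1_norm.
by rewrite mulrAC ler_pdivrMr// ler_pM2l// lerDl.
Qed.

(** The right-hand side is the squared chord between two points of the unit circle, the left-hand
    side its horizontal part. *)
Lemma sqr_cosB x y : (cos x - cos y) ^+ 2 <= 2 * (1 - cos (x - y)).
Proof.
rewrite cosB; have cx := cos2Dsin2 x; have cy := cos2Dsin2 y.
have := sqr_ge0 (sin x - sin y); nra.
Qed.

(** The window for [u] is one period starting at the left end [- v] of the arc, so that the arc does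
    not wrap around. Beyond [pi], reflection to [T - u] returns to the range where cosine
    decreases. *)
Lemma cos_arc u v : 0 < v < pi -> - v <= u <= T - v -> (cos v < cos u) = (- v < u < v).
Proof.
move=> /andP[v0 vpi] /andP[u1 u2].
have vin : v \in `[0, pi] by rewrite in_itv/= !ltW.
have [uv|vu] := ltP `|u| v.
  rewrite -ltr_norml uv -(cos_norm u) ltr_cos// in_itv/= normr_ge0/=.
  by rewrite (le_trans (ltW uv)) // ltW.
rewrite -ltr_norml [RHS]ltNge vu/=; apply/negbTE; rewrite -leNgt.
have [u0|u0] := leP u 0.
  have -> : u = - v by move: vu; rewrite ler0_norm//; lra.
  by rewrite cosN.
rewrite gtr0_norm// in vu.
have [upi|upi] := leP u pi.
  by rewrite leNgt ltr_cos ?in_itv/= ?(ltW u0)// -leNgt.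
have -> : cos u = cos (T - u).
  rewrite -(cosDz (-1) (T - u)) mulN1r addrA addNr add0r cosN//.
rewrite leNgt ltr_cos ?in_itv//= -?leNgt; first lra.
by apply/andP; split; move: u2 upi v0 => /=; rewrite mulr2n; lra.
Qed.

Lemma clamp_lipschitz (a b : R) :
  `|Num.min 1 (Num.max 0 a) - Num.min 1 (Num.max 0 b)| <= `|a - b|.
Proof.
wlog ba : a b / b <= a.
  by move=> H; have [/H//|/ltW/H] := leP b a; rewrite distrC (distrC b).
rewrite [leRHS]ger0_norm ?subr_ge0// /Num.max /Num.min ler_norml.
case: (ltP 0 a) => a0; case: (ltP 0 b) => b0; rewrite ?ltr10; do ?case: ltP => ?;
  by apply/andP; split; lra.
Qed.

(* The functions [min 1 (max 0 (n psi))], [psi y = cos (y - r) - cos r], increase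
   to the indicator of the arc [0 < y < 2 r]. *)
Lemma Ic_arc0 h (r : R) : L1 h -> (forall k, acoef h k = 0) ->
  (forall k, bcoef h k = 0) -> 0 < r < pi ->
  Ic (fun x => h x * \1_(`]0, r *+ 2[%classic) x) = 0.
Proof.
move=> h1 ha hb /[dup] rpi /andP[r0 r1].
pose psi y : R := cos (y - r) - cos r.
pose f (n : nat) y : R := Num.min 1 (Num.max 0 (n%:R * psi y)).
have cpsi : continuous psi.
  move=> y; apply: continuousB; last exact: cst_continuous.
  apply: (@continuous_comp _ _ _ (fun y => y - r) cos).
    by apply: continuousB; [exact: cvg_id|exact: cst_continuous].
  exact: continuous_cos.
have mf n : measurable_fun setT (f n).
  apply: measurable_minr; first exact: measurable_cst.
  apply: measurable_maxr; first exact: measurable_cst.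
  apply: measurable_funM; first exact: measurable_cst.
  exact: continuous_measurable.
have f0 n y : 0 <= f n y by rewrite le_min ler01 le_max lexx.
have f1 n y : f n y <= 1 by rewrite ge_min lexx.
have fM n y : `|f n y| <= 1 by rewrite ger0_norm.
have fL n : circle_regular (f n).
  apply: (@lipschitz_circle_regular _ (2 * n%:R ^+ 2)); first by rewrite mulr_ge0// exprn_ge0.
  move=> x y; apply: (@le_trans _ _ ((n%:R * (psi y - psi x)) ^+ 2)).
    rewrite -(real_normK (num_real (f n y - _))) -(real_normK (num_real (n%:R * _))).
    apply: lerXn2r; rewrite ?nnegrE// mulrBr.
    exact: clamp_lipschitz.
  rewrite exprMn (_ : psi y - psi x = cos (y - r) - cos (x - r)); last by rewrite /psi; ring.
  rewrite [leRHS](_ : _ = n%:R ^+ 2 * (2 * (1 - cos (x - y)))); last ring.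
  rewrite ler_wpM2l ?sqr_ge0//.
  rewrite (le_trans (sqr_cosB _ _))// (_ : y - r - (x - r) = - (x - y)); last ring.
  by rewrite cosN.
have I0 n : Ic (fun x => h x * f n x) = 0 := Ic_mul_regular0 h1 ha hb (mf n) (fM n) (fL n).
pose g x := h x * \1_(`]0, r *+ 2[%classic) x.
have mg : measurable_fun setT g.
  by apply: measurable_funM; [exact: L1_measurable|exact: measurable_indic].
have h1n := L1_norm h1.
have [] := @Ic_dct (fun n x => h x * f n x) g (fun x => `|h x|%:E) _ mg _ h1n.
- by move=> n; apply: measurable_funM; [exact: L1_measurable|exact: mf].
(* The sign of [psi] identifies the arc within one period only; the complement of that period is
   null for [circ]. *)
- exists (~` period_itv); split; [exact: (measurableC measurable_period_itv)|exact: circC|].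
  move=> x /= nx; apply: contrapT => /contrapT xD; apply: nx; rewrite /g.
  have arc : (0 < psi x) = (0 < x < r *+ 2).
    move: xD; rewrite /period_itv/= in_itv/= => /andP[x0 xT].
    rewrite /psi subr_gt0 cos_arc//; last by apply/andP; split; move: xT; rewrite mulr2n; lra.
    by rewrite ltrBlDr -mulr2n ltrBrDr addNr.
  apply: (@cvgM _ _ _ _ (fun=> h x) (fun n => f n x)); first exact: cvg_cst.
  rewrite indicE; have -> : (x \in (`]0, r *+ 2[%classic : set R)) = (0 < psi x).
    by rewrite arc; apply/idP/idP; rewrite inE/= in_itv.
  have [psi0|psi0] := ltP 0 (psi x).
    apply: cvg_near_cst; exists (Num.bound (psi x)^-1) => // n /= Nn.
    apply/eqP; rewrite eq_le f1 le_min lexx le_max/=; apply/orP; right.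
    rewrite -ler_pdivrMr// div1r (le_trans (ltW (archi_boundP _)))//.
      by rewrite invr_ge0 ltW.
    by rewrite ler_nat.
  apply: cvg_near_cst; apply: nearW => n; apply/eqP; rewrite eq_le f0 andbT.
  by rewrite ge_min ge_max lexx mulr_ge0_le0 ?orbT.
- move=> n x; rewrite lee_fin normrM ler_piMr//.
- move=> _ lim; apply/esym/(cvg_unique _ _ lim) => //.
  by rewrite (_ : (fun n => _) = fun=> 0); [exact: cvg_cst|apply/funext => n].
Qed.

Lemma Ic_indic h (A : set R) : measurable A -> measurable_fun setT h ->
  A `<=` period_itv -> Ic (fun x => h x * \1_A x) = \int[leb]_(x in A) h x.
Proof.
move=> mA mh AD; rewrite /Ic /Rintegral; congr fine.
rewrite integral_circ; last first.
  by apply/measurable_EFinP; apply: measurable_funM => //; exact: measurable_indic.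
rewrite [LHS]integral_mkcond [RHS]integral_mkcond; apply: eq_integral => x _.
rewrite !patchE indicE; have [xA|xA] := boolP (x \in A).
  by rewrite ifT ?mulr1// inE; apply: AD; rewrite inE in xA.
by rewrite mulr0; case: ifP.
Qed.

Lemma circ_null (N : set R) : measurable N -> leb N = 0%E -> circ N = 0%E.
Proof.
move=> mN N0; apply/eqP; rewrite -measure_le0 -N0.
apply: (@le_measure _ _ _ leb); rewrite ?inE//.
  exact: (measurableI _ _ mN measurable_period_itv).
Qed.

Lemma circ_endpoints : circ (~` `]0, T[%classic) = 0%E.
Proof.
have mS x : @measurable _ (measurableTypeR R) [set x] by exact: measurable_set1.
apply/eqP; rewrite -measure_le0.
apply: (@le_trans _ _ (leb ([set 0] `|` [set T]))).
  apply: (@le_measure _ _ _ leb); rewrite ?inE.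
  - exact: (measurableI _ _ (measurableC (measurable_itv _)) measurable_period_itv).
  - exact: measurableU.
  - move=> x [/= nx]; rewrite /period_itv/= in_itv/= => /andP[x0 xT].
    have [->|x0'] := eqVneq x 0; first by left.
    right; apply/eqP; rewrite eq_le xT/= leNgt; apply/negP => xT'; apply: nx.
    by rewrite in_itv/= xT' lt_neqAle eq_sym x0' x0.
rewrite (le_trans (measureU2 _ _ _))//.
rewrite -[leRHS]adde0; apply: leeD; rewrite le_eqVlt; apply/orP; left; apply/eqP;
  exact: lebesgue_measure_set1.
Qed.

(** The integrals of [h] over the arcs []0, y[] vanish, so its primitive is zero inside the period;
    by Lebesgue differentiation the derivative of the primitive is [h] almost everywhere. *)
Lemma circ_ae0 h : L1 h -> (forall k, acoef h k = 0) -> (forall k, bcoef h k = 0) ->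
  {ae circ, forall x, h x = 0}.
Proof.
move=> h1 ha hb; have mh := L1_measurable h1.
have T0 := @period_gt0 R.
have hD : leb.-integrable period_itv (EFin \o h).
  by apply/integrable_circP => //; exact/measurable_EFinP.
(* Cutting [h] off outside the period makes it integrable on the whole line, as differentiation of
   the primitive requires. *)
pose h0 : R -> R := h \_ period_itv.
have mD : @measurable _ (measurableTypeR R) period_itv := @measurable_period_itv R.
have h0i : leb.-integrable setT (EFin \o h0).
  have := (@integrable_mkcond _ _ _ leb period_itv (EFin \o h) mD).1 hD.
  by apply: eq_integrable => // x _ /=; rewrite /h0 !patchE; case: ifP.
have h0l : locally_integrable [set: R] h0 by exact: integrable_locally.
have iy (y : R) : leb.-integrable `[0, y]%classic (EFin \o h0).
  by apply: integrableS h0i => //; exact: measurable_itv.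
have := @FTC1 R h0 (BLeft 0) iy h0l.
set F := fun y => \int[leb]_(t in `[0, y]) h0 t.
move=> /= [N [mN N0 sub]].
exists (N `|` ~` `]0, T[%classic); split.
- exact: (measurableU _ _ mN (measurableC (measurable_itv _))).
- apply: null_set_setU; [exact: mN|exact: (measurableC (measurable_itv _))| |].
    exact: circ_null.
  exact: circ_endpoints.
move=> x /= hx; apply: contrapT => /not_orP[xN /contrapT/= xT]; apply: hx.
have {xN} : 0 < x -> derivable F x 1 /\ derive1 F x = h0 x.
  by move=> x0; apply: contrapT => nd; apply: xN; apply: sub => /= /(_ x0).
have F0 y : 0 < y < T -> F y = 0.
  move=> /andP[y0 yT].
  (* [Ic_arc0] describes arcs by their half-length. *)
  have y2 : 0 < y / 2 < pi by rewrite divr_gt0//= ltr_pdivrMr// mulr_natr.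
  rewrite -(Ic_arc0 h1 ha hb y2) Ic_indic//.
  - rewrite /F (_ : y / 2 *+ 2 = y); last by rewrite -mulr_natr divfK.
    rewrite /Rintegral; congr fine; rewrite -integral_itv_obnd_cbnd; last first.
      exact: measurable_funS (measurable_int _ h0i).
    rewrite -integral_itv_bndo_bndc; last first.
      exact: measurable_funS (measurable_int _ h0i).
    apply: eq_integral => z; rewrite inE/= in_itv/= => /andP[z0 zy].
    by rewrite /h0 patchE mem_set// /period_itv/= in_itv/= (ltW z0) ltW// (lt_trans zy).
  - move=> z /=; rewrite /period_itv/= !in_itv/= => /andP[z0 zy].
    rewrite -[y / 2 *+ 2]mulr_natr divfK// in zy.
    by rewrite (ltW z0) ltW// (lt_trans zy).
move: xT; rewrite in_itv/= => /[dup] xT /andP[x0 xT'] /(_ x0)[dF F'].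
have -> : h x = h0 x.
  by rewrite /h0 patchE mem_set// /period_itv/= in_itv/= !ltW.
rewrite -F' -(derive1_cst 0 x) !derive1E; apply: near_eq_derive.
near=> y; rewrite F0//.
suff : y \in `]0, T[ by rewrite in_itv.
by near: y; apply: near_in_itvoo; rewrite in_itv.
Unshelve. all: by end_near. Qed.

End Uniqueness.

(** * The Riesz-Fischer theorem and Parseval's identity *)

Section RieszFischer.
Context {R : realType}.
Implicit Types (f g h : R -> R) (x y : R) (a b al be : nat -> R).
Local Notation T := ((pi : R) *+ 2).

Lemma pi_neq0 : (pi : R) != 0.
Proof. by rewrite gt_eqF// pi_gt0. Qed.

Lemma bcoef0 f : bcoef f 0 = 0.
Proof.
by rewrite -[RHS]Ic0; apply: eq_Ic => x; rewrite mul0r sin0 mulr0.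
Qed.

(** The constant mode has squared norm [2 pi], all other modes [pi]; with [a 0] equal to zero, a
    single normalisation serves every frequency. *)
Lemma acoef_trigpoly n a b k : a 0%N = 0 ->
  acoef (trigpoly n a b) k = if (k < n)%N then pi * a k else 0.
Proof.
move=> a0; rewrite /acoef; under eq_Ic do rewrite mulrC.
rewrite Ic_mul_trigpoly; last exact: L1_cosM.
have E (j : 'I_n) : a j * acoef (fun x : R => cos (k%:R * x)) j +
    b j * bcoef (fun x : R => cos (k%:R * x)) j = if j == k :> nat then pi * a j else 0.
  rewrite /bcoef; under eq_Ic do rewrite mulrC.
  rewrite Ic_sin_cos mulr0 addr0 /acoef.
  have [j0|j0] := posnP j; first by rewrite j0 a0 mul0r mulr0; case: ifP.
  by rewrite Ic_cos_cos// eq_sym; case: eqP => _; rewrite ?mulr1n ?mulr0n ?mulr0// mulrC.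
rewrite (eq_bigr _ (fun j _ => E j)) -big_mkcond/=.
case: ifPn => kn; last first.
  by rewrite big1// => j /eqP jk; rewrite -jk ltn_ord in kn.
by rewrite (big_pred1 (Ordinal kn)).
Qed.

Lemma bcoef_trigpoly n a b k : b 0%N = 0 ->
  bcoef (trigpoly n a b) k = if (k < n)%N then pi * b k else 0.
Proof.
move=> b0; rewrite /bcoef; under eq_Ic do rewrite mulrC.
rewrite Ic_mul_trigpoly; last exact: L1_sinM.
have E (j : 'I_n) : a j * acoef (fun x : R => sin (k%:R * x)) j +
    b j * bcoef (fun x : R => sin (k%:R * x)) j = if j == k :> nat then pi * b j else 0.
  rewrite /acoef Ic_sin_cos mulr0 add0r /bcoef.
  have [j0|j0] := posnP j; first by rewrite j0 b0 mul0r mulr0; case: ifP.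
  by rewrite Ic_sin_sin// eq_sym; case: eqP => _; rewrite ?mulr1n ?mulr0n ?mulr0// mulrC.
rewrite (eq_bigr _ (fun j _ => E j)) -big_mkcond/=.
case: ifPn => kn; last first.
  by rewrite big1// => j /eqP jk; rewrite -jk ltn_ord in kn.
by rewrite (big_pred1 (Ordinal kn)).
Qed.

Definition fourier_sum al be n : R -> R :=
  trigpoly n (fun k => al k / pi) (fun k => be k / pi).

Definition sqsum al be n : R := \sum_(k < n) (al k ^+ 2 + be k ^+ 2).

Lemma sqsum_nondecreasing al be : nondecreasing_seq (sqsum al be).
Proof.
apply/nondecreasing_seqP => n; rewrite /sqsum big_ord_recr/= lerDl.
by rewrite addr_ge0// sqr_ge0.
Qed.

Lemma acoef_fourier_sum al be n k : al 0%N = 0 ->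
  acoef (fourier_sum al be n) k = if (k < n)%N then al k else 0.
Proof.
by move=> a0; rewrite acoef_trigpoly ?a0 ?mul0r// mulrCA divff ?mulr1 ?pi_neq0.
Qed.

Lemma bcoef_fourier_sum al be n k : be 0%N = 0 ->
  bcoef (fourier_sum al be n) k = if (k < n)%N then be k else 0.
Proof.
by move=> b0; rewrite bcoef_trigpoly ?b0 ?mul0r// mulrCA divff ?mulr1 ?pi_neq0.
Qed.

Lemma L2_fourier_sum al be n : L2 (fourier_sum al be n).
Proof. exact: L2_trigpoly. Qed.

Lemma Ic_mul_fourier_sum f al be n : L1 f ->
  Ic (fun x => f x * fourier_sum al be n x) =
  (\sum_(k < n) (al k * acoef f k + be k * bcoef f k)) / pi.
Proof.
move=> f1; rewrite Ic_mul_trigpoly// mulr_suml; apply: eq_bigr => k _.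
by ring.
Qed.

Lemma Ic_fourier_sum_mul al be m n : al 0%N = 0 -> be 0%N = 0 -> (m <= n)%N ->
  Ic (fun x => fourier_sum al be n x * fourier_sum al be m x) = sqsum al be m / pi.
Proof.
move=> a0 b0 mn; rewrite Ic_mul_fourier_sum; last exact/L2_L1/L2_fourier_sum.
congr (_ / _); apply: eq_bigr => k _.
by rewrite acoef_fourier_sum// bcoef_fourier_sum// (leq_trans (ltn_ord k) mn) !expr2.
Qed.

Lemma Ic_fourier_sum_sqr al be n : al 0%N = 0 -> be 0%N = 0 ->
  Ic (fun x => fourier_sum al be n x ^+ 2) = sqsum al be n / pi.
Proof.
by move=> a0 b0; rewrite -(Ic_fourier_sum_mul a0 b0 (leqnn n)); apply: eq_Ic => x.
Qed.

Lemma Ic_sqrB f g : L2 f -> L2 g -> Ic (fun x => (f x - g x) ^+ 2) =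
  Ic (fun x => f x ^+ 2) - 2 * Ic (fun x => f x * g x) + Ic (fun x => g x ^+ 2).
Proof.
move=> f2 g2; have E x : (f x - g x) ^+ 2 = f x ^+ 2 - 2 * (f x * g x) + g x ^+ 2 by ring.
rewrite (eq_Ic E) IcD ?IcB ?IcZ//; try exact: L2_mul; try exact: f2.2; try exact: g2.2.
- exact/L1Z/L2_mul.
- by apply: L1B; [exact: f2.2|exact/L1Z/L2_mul].
Qed.

Lemma Ic_fourier_sumB al be m n : al 0%N = 0 -> be 0%N = 0 -> (m <= n)%N ->
  Ic (fun x => (fourier_sum al be n x - fourier_sum al be m x) ^+ 2) =
  (sqsum al be n - sqsum al be m) / pi.
Proof.
move=> a0 b0 mn; rewrite Ic_sqrB; [|exact: L2_fourier_sum|exact: L2_fourier_sum].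
rewrite Ic_fourier_sum_mul//.
by rewrite !Ic_fourier_sum_sqr//; ring.
Qed.

Lemma bessel f n : L2 f -> acoef f 0 = 0 ->
  sqsum (acoef f) (bcoef f) n <= pi * Ic (fun x => f x ^+ 2).
Proof.
move=> f2 a0; set s := fourier_sum (acoef f) (bcoef f) n.
have := Ic_ge0 (fun x => sqr_ge0 (f x - s x)).
rewrite Ic_sqrB//; last exact: L2_fourier_sum.
rewrite Ic_mul_fourier_sum; last exact: L2_L1.
have -> : Ic (fun x => s x ^+ 2) = sqsum (acoef f) (bcoef f) n / pi.
  by rewrite Ic_fourier_sum_sqr// bcoef0.
have -> : \sum_(k < n) (acoef f k * acoef f k + bcoef f k * bcoef f k) =
  sqsum (acoef f) (bcoef f) n by apply: eq_bigr => k _; rewrite !expr2.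
set S := sqsum _ _ _; set I := Ic _; move=> h.
have {h} : S / pi <= I by lra.
by rewrite ler_pdivrMr ?pi_gt0// mulrC.
Qed.

(** Convergence of the partial sums in mean square is not pointwise. A subsequence [t] whose
    increments have summable L^1 norms converges almost everywhere and is dominated by the
    integrable function [G]; the coefficients pass to the limit by dominated convergence, the norm
    bound by Fatou's lemma. *)
Lemma riesz_fischer al be : al 0%N = 0 -> be 0%N = 0 -> cvgn (sqsum al be) ->
  exists f, [/\ L2 f, periodic f T, acoef f =1 al, bcoef f =1 be &
    pi * Ic (fun x => f x ^+ 2) <= limn (sqsum al be)].
Proof.
move=> a0 b0 cE; pose E := limn (sqsum al be).
have EE n : sqsum al be n <= E.
  exact: nondecreasing_cvgn_le (sqsum_nondecreasing al be) cE n.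
pose q i : R := 2^-1 ^+ i.
have q0 i : 0 < q i by rewrite exprn_gt0// invr_gt0.
have qS i : q i.+1 = q i / 2 by rewrite /q exprS mulrC.
(* The square matches [Ic_norm_amgm]: a squared norm of order [q i ^+ 2], with [q i] as parameter,
   yields an L^1 norm of order [q i]. The clause [i < n] makes every frequency enter the subsequence
   eventually. *)
have /choice[N0 N0P] : forall i : nat, exists n, (i < n)%N /\ E - sqsum al be n <= q i ^+ 2.
  move=> i; have q2 : 0 < q i ^+ 2 by rewrite exprn_gt0.
  have /cvgrPdist_le/(_ _ q2)[n _ /(_ (maxn n i.+1) (leq_maxl _ _))] := cE.
  by rewrite ger0_norm ?subr_ge0//; exists (maxn n i.+1); rewrite leq_maxr.
have HN i := (N0P i).2.
(* The shift makes [t 0] the empty sum, so that [t n] is exactly the sum of its increments. *)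
pose N i := if i is j.+1 then N0 j else 0%N.
pose t i := fourier_sum al be (N i).
pose d i x := t i.+1 x - t i x.
have t0 x : t 0%N x = 0 by rewrite /t /fourier_sum /trigpoly big_ord0.
have tE n x : t n x = \sum_(i < n) d i x.
  elim: n => [|n IH]; first by rewrite big_ord0.
  by rewrite big_ord_recr/= -IH /d; ring.
have d2 i : L2 (d i) by apply: L2B; exact: L2_fourier_sum.
have dq i : Ic (fun x => d i.+1 x ^+ 2) <= q i ^+ 2 / pi.
  have H m n e : E - sqsum al be m <= e -> E - sqsum al be n <= e ->
      Ic (fun x => (fourier_sum al be n x - fourier_sum al be m x) ^+ 2) <= e / pi.
    wlog mn : m n / (m <= n)%N => [hw hm hn|hm hn].
      have [mn|/ltnW nm] := leqP m n; first exact: hw.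
      rewrite (_ : (fun x => _) = fun x => (fourier_sum al be m x - fourier_sum al be n x) ^+ 2).
        exact: hw.
      by apply/funext => x; ring.
    rewrite Ic_fourier_sumB// ler_pM2r ?invr_gt0 ?pi_gt0//.
    by have := EE n; lra.
  apply: H; first exact: HN.
  by apply: (le_trans (HN i.+1)); rewrite qS; have := q0 i; nra.
pose I i := Ic (fun x => `|d i x|).
have Iq i : I i.+1 <= (pi + pi^-1) * q i.
  apply: (le_trans (Ic_norm_amgm (q0 i) (d2 _))).
  rewrite [leRHS](_ : _ = q i * pi + pi^-1 * q i); last ring.
  rewrite lerD2l.
  apply: (@le_trans _ _ ((q i ^+ 2 / pi) / (2 * q i))).
    by rewrite ler_pM2r// invr_gt0 mulr_gt0.
  move: (q0 i) (@pi_gt0 R); move: (q i) (pi : R) => z w z0 w0.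
  rewrite (_ : _ / _ = w^-1 * z / 2); last by field; rewrite !gt_eqF.
  by have : 0 < w^-1 * z by [rewrite mulr_gt0// invr_gt0]; lra.
have K0 : 0 <= (pi : R) + pi^-1.
  by apply: ltW; apply: ltr_wpDl; rewrite ?invr_gt0 ?pi_ge0 ?pi_gt0.
pose C := I 0%N + 2 * (pi + pi^-1).
have I0 i : 0 <= I i by apply: Ic_ge0.
have sumI n : \sum_(i < n) I i <= C.
  case: n => [|n]; first by rewrite big_ord0 addr_ge0// mulr_ge0.
  suff : \sum_(i < n.+1) I i <= I 0%N + (pi + pi^-1) * (2 - 2 * q n).
    move=> /le_trans; apply; rewrite /C lerD2l mulrC ler_wpM2r//.
    by have := q0 n; lra.
  elim: n => [|n IH].
    by rewrite big_ord_recr/= big_ord0 /q expr0; lra.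
  rewrite big_ord_recr/= (le_trans (lerD IH (Iq n)))//.
  rewrite (_ : q n = 2 * q n.+1); last by rewrite qS; field.
  by rewrite le_eqVlt; apply/orP; left; apply/eqP; ring.
pose G x : \bar R := (\sum_(0 <= i <oo) (`|d i x|)%:E)%E.
have md i : measurable_fun setT (fun x => `|d i x|).
  by apply: measurableT_comp => //; exact: L2_measurable.
have G0 x : (0 <= G x)%E by apply: nneseries_ge0.
have mG : measurable_fun setT G.
  apply: ge0_emeasurable_sum => // i _.
  by apply/measurable_EFinP; exact: md.
have iG : circ.-integrable setT G.
  apply/integrableP; split=> //.
  under eq_integral do rewrite gee0_abs//.
  rewrite integral_nneseries//; last by move=> i; apply/measurable_EFinP; exact: md.
  apply: (@le_lt_trans _ _ C%:E); last by rewrite ltry.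
  apply: lime_le; first by apply: is_cvg_nneseries => i _ _; exact: integral_ge0.
  have Ii i : (\int[circ]_x `|d i x|%:E = (I i)%:E)%E.
    by rewrite /I (EFin_Ic (L1_norm (L2_L1 (d2 i)))).
  by apply: nearW => n; rewrite (eq_bigr _ (fun i _ => Ii i)) big_mkord sumEFin lee_fin.
have dG n x : ((\sum_(i < n) `|d i x|)%R%:E <= G x)%E.
  rewrite -sumEFin; by rewrite -(big_mkord xpredT (fun i => `|d i x|%:E)); exact: nneseries_lim_ge.
have tG n x : (`|t n x|%:E <= G x)%E.
  by rewrite (le_trans _ (dG n x))// lee_fin tE ler_norm_sum.
(* An upper limit is defined at every point, which makes [f] measurable and exactly periodic, not
   merely up to a null set. *)
pose f x := fine (limn_esup (fun n => (t n x)%:E)).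
have mt n : measurable_fun setT (t n) by apply: L2_measurable; exact: L2_fourier_sum.
have mf : measurable_fun setT f.
  apply: measurableT_comp => //; apply: measurable_fun_limn_esup => n.
  exact/measurable_EFinP.
have tf : {ae circ, forall x, t^~ x @ \oo --> f x}.
  have := integrable_ae measurableT iG; apply: ae_circ_impl => x /(_ Logic.I) Gx.
  have cd : cvgn (series (d^~ x)).
    apply: normed_cvg; apply: nondecreasing_is_cvgn.
      by apply/nondecreasing_seqP => n; rewrite /normed_series_of/= seriesSr/= lerDl.
    exists (fine (G x)) => _ [n _ <-]; rewrite /normed_series_of/series/= big_mkord.
    by rewrite -lee_fin fineK.
  have tS : t^~ x = series (d^~ x).
    by apply/funext => n; rewrite tE /series/= big_mkord.
  suff -> : f x = limn (t^~ x) by rewrite tS.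
  have ct : cvgn (t^~ x) by rewrite tS.
  rewrite /f is_cvg_limn_esupE; first by rewrite EFin_lim.
  by apply/cvg_ex; exists (limn (t^~ x))%:E; apply: cvg_EFin => //; exact: nearW.
have mom (p : R -> R) : continuous p -> (forall x, `|p x| <= 1) ->
    (fun n => Ic (fun x => t n x * p x)) @ \oo --> Ic (fun x => f x * p x).
  move=> cp p1.
  have mp := continuous_measurable cp.
  have := @Ic_dct _ (fun n x => t n x * p x) (fun x => f x * p x) G.
  case=> //.
  - by move=> n; exact: measurable_funM.
  - exact: measurable_funM.
  - apply: ae_circ_impl tf => x tx; apply: cvgM => //; exact: cvg_cst.
  - move=> n x; rewrite (le_trans _ (tG n x))// lee_fin normrM ler_piMr//.
have fT : periodic f T.
  move=> x; rewrite /f; congr (fine (limn_esup _)); apply/funext => n.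
  by rewrite /t /fourier_sum trigpoly_periodic.
have tcoef (u : nat -> R) k : \forall n \near \oo, (if (k < N n)%N then u k else 0) = u k.
  exists k.+1 => // -[|n] //= kn; rewrite ifT//.
  by rewrite (leq_trans kn)// (N0P n).1.
have fa : acoef f =1 al.
  move=> k; have := mom _ (@continuous_cosM _ k%:R) (fun x => cos_max _).
  under eq_fun do rewrite -/(acoef _ k) acoef_fourier_sum//.
  by move=> lim; apply/esym/(cvg_unique _ _ lim) => //; apply: cvg_near_cst; exact: tcoef.
have fb : bcoef f =1 be.
  move=> k; have := mom _ (@continuous_sinM _ k%:R) (fun x => sin_max _).
  under eq_fun do rewrite -/(bcoef _ k) bcoef_fourier_sum//.
  by move=> lim; apply/esym/(cvg_unique _ _ lim) => //; apply: cvg_near_cst; exact: tcoef.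
suff bound : (\int[circ]_x `|(f x ^+ 2)%:E| <= (E / pi)%:E)%E.
  have f2 : L1 (fun x => f x ^+ 2).
    apply/integrableP; split; first by apply/measurable_EFinP; exact: measurable_funX.
    by apply: (le_lt_trans bound); rewrite ltry.
  exists f; split=> //; rewrite mulrC -ler_pdivlMr ?pi_gt0// -lee_fin EFin_Ic//.
  apply: le_trans bound; rewrite le_eqVlt; apply/orP; left; apply/eqP.
  by apply: eq_integral => x _; rewrite gee0_abs// lee_fin sqr_ge0.
have mt2 n : measurable_fun setT (fun x => (t n x ^+ 2)%:E).
  by apply/measurable_EFinP; exact: measurable_funX.
have := @fatou _ _ _ circ setT measurableT (fun n x => (t n x ^+ 2)%:E) mt2 _.
have -> : (\int[circ]_x `|(f x ^+ 2)%:E| =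
    \int[circ]_x limn_einf (fun n => (t n x ^+ 2)%:E))%E.
  apply: ae_eq_integral => //.
  - by apply: measurableT_comp => //; apply/measurable_EFinP; exact: measurable_funX.
  - rewrite (_ : (fun x => _) = fun x => - limn_esup (fun n => - (t n x ^+ 2)%:E))%E.
      apply: measurableT_comp => //; apply: measurable_fun_limn_esup => n.
      by apply: measurableT_comp => //; exact: mt2.
    apply/funext => x; rewrite -limn_einfN; congr limn_einf.
    by apply/funext => n /=; rewrite opprK.
  - apply: ae_circ_impl tf => x tx _; rewrite gee0_abs ?lee_fin ?sqr_ge0//.
    have c2 : (fun n => (t n x ^+ 2)%:E) @ \oo --> (f x ^+ 2)%:E.
      apply: cvg_EFin; first exact: nearW.
      by under eq_fun do rewrite expr2; rewrite expr2; exact: cvgM.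
    by rewrite is_cvg_limn_einfE; [apply/esym/cvg_lim|apply/cvg_ex; exists (f x ^+ 2)%:E].
move=> /(_ (fun n x _ => _))/le_trans; apply => //.
  by move=> n x; rewrite lee_fin sqr_ge0.
apply: (@le_trans _ _ (limn_esup (fun n => \int[circ]_x (t n x ^+ 2)%:E)%E)).
  exact: limn_einf_sup.
rewrite limn_esup_lim; apply: lime_le; first exact: is_cvg_esups.
apply: nearW => n; apply: ge_ereal_sup => _ [m _ <-].
rewrite -EFin_Ic; last exact: (L2_fourier_sum _ _ _).2.
by rewrite lee_fin Ic_fourier_sum_sqr// ler_pM2r ?invr_gt0 ?pi_gt0.
Qed.

Lemma ae_eq_L2 f g : L2 f -> L2 g -> acoef f =1 acoef g -> bcoef f =1 bcoef g ->
  {ae circ, forall x, f x = g x}.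
Proof.
move=> f2 g2 fga fgb; have f1 := L2_L1 f2; have g1 := L2_L1 g2.
have cE (p : R -> R) : continuous p -> (forall x, `|p x| <= 1) ->
    Ic (fun x => (f x - g x) * p x) = Ic (fun x => f x * p x) - Ic (fun x => g x * p x).
  move=> cp p1; have mp := continuous_measurable cp.
  rewrite -IcB; [|exact: L1_mul_bounded p1|exact: L1_mul_bounded p1].
  by apply: eq_Ic => x; rewrite mulrBl.
have := @circ_ae0 _ (fun x => f x - g x) (L1B f1 g1) _ _.
move=> h; apply: ae_circ_impl (h _ _) => [x /eqP|k|k]; first by rewrite subr_eq0 => /eqP.
  by rewrite /acoef cE -/(acoef _ _) ?fga ?subrr//; [exact: continuous_cosM|move=> x; exact: cos_max].
by rewrite /bcoef cE -/(bcoef _ _) ?fgb ?subrr//; [exact: continuous_sinM|move=> x; exact: sin_max].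
Qed.

(** Bessel's inequality is one half. For the other, [riesz_fischer] produces a function with the
    same coefficients whose squared norm is at most the limit; by uniqueness it equals [f] almost
    everywhere. *)
Lemma parseval f : L2 f -> acoef f 0 = 0 ->
  sqsum (acoef f) (bcoef f) @ \oo --> pi * Ic (fun x => f x ^+ 2).
Proof.
move=> f2 a0; have b0 := bcoef0 f.
have nd := sqsum_nondecreasing (acoef f) (bcoef f).
have cE : cvgn (sqsum (acoef f) (bcoef f)).
  apply: nondecreasing_is_cvgn => //.
  by exists (pi * Ic (fun x => f x ^+ 2)) => _ [n _ <-]; exact: bessel.
have [g [g2 gT ga gb gE]] := riesz_fischer a0 b0 cE.
suff -> : pi * Ic (fun x => f x ^+ 2) = limn (sqsum (acoef f) (bcoef f)) by [].
apply/eqP; rewrite eq_le; apply/andP; split; last first.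
  by apply: limr_le => //; apply: nearW => n; exact: bessel.
rewrite (_ : Ic (fun x => f x ^+ 2) = Ic (fun x => g x ^+ 2))//.
rewrite /Ic /Rintegral; congr fine; apply: ae_eq_integral => //.
- by apply/measurable_EFinP; exact: measurable_funX (L2_measurable f2).
- by apply/measurable_EFinP; exact: measurable_funX (L2_measurable g2).
- apply: ae_circ_impl (ae_eq_L2 f2 g2 _ _) => [x -> //|k|k]; first by rewrite ga.
  by rewrite gb.
Qed.

End RieszFischer.

(** * The Gagliardo form of the energy *)

Section Gagliardo.
Context {R : realType}.
Implicit Types (f g : R -> R) (x y h : R).
Local Notation T := ((pi : R) *+ 2).

Lemma is_derive_shift (c x : R) : is_derive x (1 : R) (fun y : R => y + c) 1.
Proof. by have := is_deriveD (is_derive_id x (1 : R)) (is_derive_cst c x 1); rewrite addr0. Qed.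

Lemma ge0_integral_shift (f : R -> \bar R) (c : R) : measurable_fun setT f ->
  (forall x, 0 <= f x)%E -> (forall x, f (x + T) = f x) ->
  (\int[circ]_x f (x + c)%R = \int[circ]_x f x)%E.
Proof.
move=> mf f0 fT.
rewrite -(@ge0_integral_subst _ (fun x => x + c) (fun=> 1) (is_derive_shift c) _ _ _ f)//.
- by apply: eq_integral => x _; rewrite mule1.
- exact: cst_continuous.
- by move=> x; rewrite addrAC.
Qed.

Lemma measurable_shift (c : R) : measurable_fun setT (fun x : R => x + c).
Proof. by apply: measurable_funD => //; exact: measurable_cst. Qed.

Lemma Ic_shift f (c : R) : periodic f T -> L1 f ->
  L1 (fun x => f (x + c)) /\ Ic (fun x => f (x + c)) = Ic f.
Proof.
move=> fT f1; have mf := L1_measurable f1.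
have mfc : measurable_fun setT (fun x => f (x + c)).
  by apply: measurableT_comp => //; exact: measurable_shift.
have mE : measurable_fun setT (EFin \o f) by exact/measurable_EFinP.
split.
  apply/integrableP; split; first exact/measurable_EFinP.
  have := @ge0_integral_shift (fun x => `|f x|%:E) c.
  move=> /= ->//.
  - by move/integrableP : f1 => [].
  - by apply/measurable_EFinP; exact: measurableT_comp.
  - by move=> x; rewrite fT.
rewrite /Ic /Rintegral; congr fine; rewrite integralE [RHS]integralE; congr (_ - _)%E.
  rewrite (funepos_comp (EFin \o f) (fun x => x + c)).
  apply: (@ge0_integral_shift ((EFin \o f)^\+)%E c) => [|//|x].
    exact: (measurable_funepos mE).
  by rewrite !funeposE/= fT.
rewrite (funeneg_comp (EFin \o f) (fun x => x + c)).
apply: (@ge0_integral_shift ((EFin \o f)^\-)%E c) => [|//|x].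
  exact: (measurable_funeneg mE).
by rewrite !funenegE/= fT.
Qed.

Lemma cosM_periodic (k : nat) : periodic (fun x : R => cos (k%:R * x)) T.
Proof.
move=> x; rewrite (_ : k%:R * (x + T) = (k : int)%:~R * T + k%:R * x); first exact: cosDz.
by rewrite -[(k : int)%:~R]pmulrn; ring.
Qed.

Lemma sinM_periodic (k : nat) : periodic (fun x : R => sin (k%:R * x)) T.
Proof.
move=> x; rewrite (_ : k%:R * (x + T) = (k : int)%:~R * T + k%:R * x); first exact: sinDz.
by rewrite -[(k : int)%:~R]pmulrn; ring.
Qed.

Lemma L2_shift f (c : R) : periodic f T -> L2 f -> L2 (fun x => f (x + c)).
Proof.
move=> fT [mf f2]; split; first by apply: measurableT_comp => //; exact: measurable_shift.
by apply: (Ic_shift c _ f2).1 => x; rewrite fT.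
Qed.

Lemma acoef_shift f (c : R) k : periodic f T -> L1 f ->
  acoef (fun x => f (x + c)) k = cos (k%:R * c) * acoef f k + sin (k%:R * c) * bcoef f k.
Proof.
move=> fT f1; pose g x := cos (k%:R * c) * (f x * cos (k%:R * x)) + sin (k%:R * c) * (f x * sin (k%:R * x)).
have g1 : L1 g by apply: L1D; apply: L1Z; [exact: L1_mul_cos|exact: L1_mul_sin].
have gT : periodic g T by move=> x; rewrite /g fT cosM_periodic sinM_periodic.
rewrite /acoef -IcZ; last exact: L1_mul_cos.
rewrite /bcoef -IcZ; last exact: L1_mul_sin.
rewrite -IcD; [|exact/L1Z/L1_mul_cos|exact/L1Z/L1_mul_sin].
rewrite -/(Ic g) -(Ic_shift c gT g1).2; apply: eq_Ic => x; rewrite /g.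
rewrite (_ : k%:R * x = k%:R * (x + c) - k%:R * c); last by ring.
by rewrite cosB; ring.
Qed.

Lemma bcoef_shift f (c : R) k : periodic f T -> L1 f ->
  bcoef (fun x => f (x + c)) k = cos (k%:R * c) * bcoef f k - sin (k%:R * c) * acoef f k.
Proof.
move=> fT f1; pose g x := cos (k%:R * c) * (f x * sin (k%:R * x)) - sin (k%:R * c) * (f x * cos (k%:R * x)).
have g1 : L1 g by apply: L1B; apply: L1Z; [exact: L1_mul_sin|exact: L1_mul_cos].
have gT : periodic g T by move=> x; rewrite /g fT cosM_periodic sinM_periodic.
rewrite /bcoef -IcZ; last exact: L1_mul_sin.
rewrite /acoef -IcZ; last exact: L1_mul_cos.
rewrite -IcB; [|exact/L1Z/L1_mul_sin|exact/L1Z/L1_mul_cos].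
rewrite -/(Ic g) -(Ic_shift c gT g1).2; apply: eq_Ic => x; rewrite /g.
rewrite (_ : k%:R * x = k%:R * (x + c) - k%:R * c); last by ring.
by rewrite sinB; ring.
Qed.

Lemma acoefB f g k : L1 f -> L1 g -> acoef (fun x => f x - g x) k = acoef f k - acoef g k.
Proof.
move=> f1 g1; rewrite /acoef -IcB; [|exact: L1_mul_cos|exact: L1_mul_cos].
by apply: eq_Ic => x; rewrite mulrBl.
Qed.

Lemma bcoefB f g k : L1 f -> L1 g -> bcoef (fun x => f x - g x) k = bcoef f k - bcoef g k.
Proof.
move=> f1 g1; rewrite /bcoef -IcB; [|exact: L1_mul_sin|exact: L1_mul_sin].
by apply: eq_Ic => x; rewrite mulrBl.
Qed.

Definition coef2 f k : R := acoef f k ^+ 2 + bcoef f k ^+ 2.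

Lemma coef2_ge0 f k : 0 <= coef2 f k.
Proof. by rewrite addr_ge0// sqr_ge0. Qed.

Lemma eparseval f : L2 f -> acoef f 0 = 0 ->
  (\int[circ]_x (f x ^+ 2)%:E = \sum_(k <oo) (coef2 f k / pi)%:E)%E.
Proof.
move=> f2 f0; rewrite -EFin_Ic; last exact: f2.2.
apply/esym/cvg_lim => //; have := parseval f2 f0.
rewrite (_ : (fun n => _) = (fun n => (sqsum (acoef f) (bcoef f) n / pi)%:E)); last first.
  apply/funext => n; rewrite big_mkord sumEFin /sqsum mulr_suml; congr EFin.
move=> h; apply: cvg_EFin; first exact: nearW.
rewrite (_ : Ic _ = (pi * Ic (fun x => f x ^+ 2)) / pi); last by rewrite [RHS]mulrAC divff ?mul1r ?pi_neq0.
exact: cvgM h (cvg_cst _).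
Qed.

(** An increment has mean zero whatever the mean of [f], so Parseval's identity applies. A
    translation rotates the pair of coefficients at frequency [k] by the angle [k h], and the
    squared chord of that angle is [2 (1 - cos (k h))]. *)
Lemma integral_increment f (h : R) : L2 f -> periodic f T ->
  (\int[circ]_x ((f (x + h)%R - f x) ^+ 2)%:E =
   \sum_(k <oo) (2 * (1 - cos (k%:R * h)) * (coef2 f k / pi))%:E)%E.
Proof.
move=> f2 fT; have fh2 := L2_shift h fT f2.
have [f1 fh1] := (L2_L1 f2, L2_L1 fh2).
have aE k : acoef (fun x => f (x + h) - f x) k =
    cos (k%:R * h) * acoef f k + sin (k%:R * h) * bcoef f k - acoef f k.
  by rewrite acoefB// acoef_shift.
have bE k : bcoef (fun x => f (x + h) - f x) k =
    cos (k%:R * h) * bcoef f k - sin (k%:R * h) * acoef f k - bcoef f k.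
  by rewrite bcoefB// bcoef_shift.
rewrite (@eparseval (fun x => f (x + h) - f x)); [|exact: L2B|].
  apply: eq_eseriesr => k _; congr EFin; rewrite mulrA; congr (_ / _).
  rewrite /coef2 aE bE; have := cos2Dsin2 (k%:R * h).
  set c := cos _; set s := sin _ => cs.
  have -> : (c * acoef f k + s * bcoef f k - acoef f k) ^+ 2 +
    (c * bcoef f k - s * acoef f k - bcoef f k) ^+ 2 =
    (c ^+ 2 + s ^+ 2 + 1 - 2 * c) * (acoef f k ^+ 2 + bcoef f k ^+ 2) by ring.
  by rewrite cs; ring.
by rewrite aE bcoef0 mul0r cos0; ring.
Qed.

(* [1 / (4 sin^2 (h / 2))], with value [0] at the multiples of 2 pi. *)
Definition kern (h : R) : R := (2 * (1 - cos h))^-1.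

Lemma kern_ge0 h : 0 <= kern h.
Proof. by rewrite invr_ge0 mulr_ge0// subr_ge0 cos_le1. Qed.

(* [x^-1] (with the convention [0^-1 = 0]) is the limit of the continuous
   functions [x / (x^2 + 1/n)]. *)
Lemma measurable_inv : measurable_fun setT (fun x : R => x^-1).
Proof.
pose u n x : R := x / (x ^+ 2 + n.+1%:R^-1).
have d0 n x : 0 < x ^+ 2 + n.+1%:R^-1 by rewrite ltr_wpDl ?sqr_ge0// invr_gt0.
apply: (@measurable_fun_cvg _ _ _ setT u).
  move=> n; apply: continuous_measurable => x.
  apply: cvgM; first exact: cvg_id.
  apply: cvgV; first by rewrite gt_eqF.
  by apply: cvgD; [exact: exprn_continuous|exact: cvg_cst].
move=> x _; have [->|x0] := eqVneq x 0.
  rewrite (_ : u^~ 0 = fun=> 0); first by rewrite invr0; exact: cvg_cst.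
  by apply/funext => n; rewrite /u mul0r.
rewrite (_ : x^-1 = x / (x ^+ 2 + 0)); last by rewrite addr0 expr2 invfM mulrA divff ?mul1r.
apply: cvgM; first exact: cvg_cst.
apply: cvgV; first by rewrite addr0 expf_neq0.
by apply: cvgD; [exact: cvg_cst|exact: cvg_harmonic].
Qed.

Lemma measurable_kern : measurable_fun setT kern.
Proof.
apply: (measurableT_comp (f := fun x : R => x^-1)); first exact: measurable_inv.
apply: measurable_funM; first exact: measurable_cst.
apply: measurable_funB; first exact: measurable_cst.
exact: continuous_measurable (@continuous_cos R).
Qed.

Lemma kernN h : kern (- h) = kern h.
Proof. by rewrite /kern cosN. Qed.

Lemma kern_periodic : periodic kern T.
Proof. by move=> h; rewrite /kern cosD2pi. Qed.

Lemma cos_lt1 h : 0 < h < T -> cos h < 1.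
Proof.
have H x : 0 < x -> x <= pi -> cos x < 1.
  move=> x0 xpi; rewrite -cos0 ltr_cos// in_itv/=; first by rewrite lexx pi_ge0.
  by rewrite ltW.
move=> /andP[h0 hT]; have [hpi|hpi] := leP h pi; first exact: H.
rewrite -cosN -(cosDz 1) mul1r; apply: H; first by rewrite subr_gt0.
by rewrite mulr2n lerBlDr lerD2l ltW.
Qed.

Lemma kern_fejer k h : cos h < 1 ->
  2 * (1 - cos (k%:R * h)) * kern h = fejer_kernel k h.
Proof.
move=> h1; rewrite -fejer_kernelE /kern; field.
by rewrite subr_eq0 eq_sym lt_eqF.
Qed.

Lemma Ic_fejer_kernel0 k : Ic (@fejer_kernel R k) = k%:R * T.
Proof.
rewrite -(Ic_fejer_kernel k 0); apply: eq_Ic => y; apply: eq_bigr => j _.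
by rewrite sub0r mulrN cosN.
Qed.

Lemma ae_circ_itv (P : R -> Prop) : (forall h, 0 < h < T -> P h) ->
  {ae circ, forall h, P h}.
Proof.
move=> H; exists (~` `]0, T[%classic); split.
- exact: (measurableC (measurable_itv _)).
- exact: circ_endpoints.
- by move=> h nh; rewrite /= in_itv/= => /H.
Qed.

(** The values lie in [\bar R]: finiteness replaces membership in H^(1/2), and Tonelli applies
    without an integrability condition. For such [f] this is [2 pi] times the half Dirichlet energy,
    see [gagliardo_frac_laplacian]. *)
Definition gagliardo f : \bar R :=
  (\int[circ]_x \int[circ]_y ((f x - f y) ^+ 2 * kern (x - y))%:E)%E.

(* Parseval's identity for [f (. + h) - f] gives the weights [2 (1 - cos (k h))] in
   front of [coef2 f k]; times [kern h] they form a Fejer kernel, of integral [2 pi k]. *)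
Lemma gagliardoE f : L2 f -> periodic f T ->
  gagliardo f = (\sum_(k <oo) (2 * k%:R * coef2 f k)%:E)%E.
Proof.
move=> f2 fT; have mf := L2_measurable f2.
have mF2 : measurable_fun setT (fun z : measurableTypeR R * measurableTypeR R =>
    (((f (z.1 + z.2)%R - f z.1) ^+ 2 * kern z.2)%:E)).
  apply/measurable_EFinP; apply: measurable_funM.
    apply: measurable_funX; apply: measurable_funB.
      apply: measurableT_comp => //.
      exact: measurable_funD measurable_fst measurable_snd.
    exact: measurableT_comp mf measurable_fst.
  exact: measurableT_comp measurable_kern measurable_snd.
have F0 (z : measurableTypeR R * measurableTypeR R) :
    (0 <= ((f (z.1 + z.2)%R - f z.1) ^+ 2 * kern z.2)%:E)%E.
  by rewrite lee_fin mulr_ge0 ?sqr_ge0 ?kern_ge0.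
have Fub : (\int[circ]_x \int[circ]_h ((f (x + h)%R - f x) ^+ 2 * kern h)%:E =
            \int[circ]_h \int[circ]_x ((f (x + h)%R - f x) ^+ 2 * kern h)%:E)%E.
  exact: (@fubini_tonelli _ _ _ _ _ circ circ _ mF2 F0).
have mG := @measurable_fun_fubini_tonelli_G _ _ _ _ _ circ _ mF2 F0.
clear mF2 F0.
transitivity (\int[circ]_x \int[circ]_h ((f (x + h)%R - f x) ^+ 2 * kern h)%:E)%E.
  apply: eq_integral => x _.
  pose G y := ((f x - f y) ^+ 2 * kern (x - y))%:E.
  (* For fixed [x], invariance under translation replaces [y] by [x + h], so that the kernel depends
     on [h] alone. *)
  rewrite -(@ge0_integral_shift G x); last 3 first.
  - apply/measurable_EFinP; apply: measurable_funM.
      by apply: measurable_funX; apply: measurable_funB => //; exact: measurable_cst.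
    apply: measurableT_comp; first exact: measurable_kern.
    by apply: measurable_funB => //; exact: measurable_cst.
  - by move=> y; rewrite lee_fin mulr_ge0 ?sqr_ge0 ?kern_ge0.
  - move=> y; rewrite /G fT; congr (_ * _)%:E; rewrite -kern_periodic.
    by congr kern; ring.
  apply: eq_integral => h _; rewrite /G; congr EFin.
  by rewrite opprD addrCA subrr addr0 kernN (addrC h) -sqrrN opprB.
rewrite Fub {Fub}; have mfh h : measurable_fun setT (fun x => ((f (x + h) - f x) ^+ 2)%:E).
  apply/measurable_EFinP; apply: measurable_funX; apply: measurable_funB => //.
  by apply: measurableT_comp => //; exact: measurable_shift.
transitivity (\int[circ]_h \sum_(k <oo) (coef2 f k / pi * fejer_kernel k h)%:E)%E.
  apply: ae_eq_integral => //.
  - apply: ge0_emeasurable_sum => [k h _|k _].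
      by rewrite lee_fin mulr_ge0 ?fejer_kernel_ge0// divr_ge0 ?coef2_ge0 ?pi_ge0.
    apply/measurable_EFinP; apply: measurable_funM; first exact: measurable_cst.
    exact: continuous_measurable (@fejer_kernel_continuous R k).
  (* At the multiples of [2 pi], [kern] has its default value 0 while the Fejer kernel of order [k]
     takes the value [k^2]; the integrands agree only off these points. *)
  apply: ae_circ_itv => h hT _.
  transitivity (\int[circ]_x ((kern h)%:E * ((f (x + h) - f x) ^+ 2)%:E))%E.
    by apply: eq_integral => x _; rewrite -EFinM mulrC.
  rewrite ge0_integralZl//; last 3 first.
  - exact: mfh.
  - by move=> x _; rewrite lee_fin sqr_ge0.
  - by rewrite lee_fin kern_ge0.
  rewrite integral_increment// -nneseriesZl//.
    apply: eq_eseriesr => k _; rewrite -EFinM; congr EFin.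
    by rewrite -(kern_fejer k (cos_lt1 hT)); ring.
  move=> k _; rewrite lee_fin mulr_ge0// ?divr_ge0 ?coef2_ge0 ?pi_ge0//.
rewrite integral_nneseries//; last 2 first.
- move=> k; apply/measurable_EFinP; apply: measurable_funM; first exact: measurable_cst.
  exact: continuous_measurable (@fejer_kernel_continuous R k).
- by move=> k h _; rewrite lee_fin mulr_ge0 ?fejer_kernel_ge0// divr_ge0 ?coef2_ge0 ?pi_ge0.
apply: eq_eseriesr => k _.
have k1 : L1 (@fejer_kernel R k) by apply: continuous_L1; exact: fejer_kernel_continuous.
rewrite -EFin_Ic; last exact: L1Z.
rewrite IcZ// Ic_fejer_kernel0; congr EFin.
by move: (@pi_neq0 R); move: (pi : R) => p p0; field.
Qed.

End Gagliardo.

(** * Inner variations of the Gagliardo energy *)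

Section Estimates.
Context {R : realType}.
Implicit Types (x y h a t : R).
Local Notation T := ((pi : R) *+ 2).

Lemma sin_le_norm a : `|sin a| <= `|a|.
Proof.
wlog a0 : a / 0 <= a => [H|].
  have [/H//|/ltW a0] := leP 0 a.
  by rewrite -normrN -sinN -(normrN a) H// oppr_ge0.
have [c _] := MVT_segment a0 (fun x _ => is_derive_sin x) (continuous_subspaceT (@continuous_sin R)).
by rewrite sin0 !subr0 => ->; rewrite normrM ler_piMl// cos_max.
Qed.

Lemma cos_ge_sqr a : 1 - cos a <= a ^+ 2.
Proof.
wlog a0 : a / 0 <= a => [H|].
  have [/H//|/ltW a0] := leP 0 a.
  by rewrite -cosN -sqrrN H// oppr_ge0.
have [c] := MVT_segment a0 (fun x _ => is_derive_cos x) (continuous_subspaceT (@continuous_cos R)).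
rewrite in_itv/= cos0 subr0 => /andP[c0 ca] E.
have := sin_le_norm c; rewrite (ger0_norm c0) => /(le_trans (ler_norm _)) sc.
nra.
Qed.

Lemma sin_sub_le_sqr a : `|sin a - a| <= a ^+ 2.
Proof.
wlog a0 : a / 0 <= a => [H|].
  have [/H//|/ltW a0] := leP 0 a.
  by rewrite -normrN opprB addrC -sinN -sqrrN -[X in _ + X]opprK opprK -{2}[a]opprK H// oppr_ge0.
have [c] := MVT_segment a0 (fun x _ => is_derive_sin x) (continuous_subspaceT (@continuous_sin R)).
rewrite in_itv/= sin0 !subr0 => /andP[c0 ca] ->.
have cc : 1 - cos c <= c.
  have [z _] := MVT_segment c0 (fun x _ => is_derive_cos x) (continuous_subspaceT (@continuous_cos R)).
  by rewrite cos0 subr0 => E; have := sin_geN1 z; have := sin_le1 z; nra.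
rewrite -{2}[a]mul1r -mulrBl normrM (ger0_norm a0) expr2 ler_wpM2r//.
by rewrite ler0_norm ?subr_le0 ?cos_le1// opprB; lra.
Qed.

(** With [b = h / 4], [1 - cos h = 2 (sin (2 b))^2]. The mean value theorem gives
    [b cos b <= sin b], hence [sin (2 b) = 2 cos b sin b >= 2 b (cos b)^2 >= b], the last step
    because [cos (2 b) >= 0]. The constant 8 comes from [2 b^2 = h^2 / 8]. *)
Lemma sqr_le_cos h : `|h| <= pi -> h ^+ 2 <= 8 * (1 - cos h).
Proof.
wlog h0 : h / 0 <= h => [H|].
  have [/H//|/ltW h0] := leP 0 h.
  by rewrite -normrN -sqrrN -cosN => /H; apply; rewrite oppr_ge0.
rewrite ger0_norm// => hpi; pose b := h / 2 / 2.
have b0 : 0 <= b by rewrite !divr_ge0.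
have hb : h = 4 * b by rewrite /b; field.
have cosb x : 0 <= x -> x <= pi / 2 -> 0 <= cos x.
  by move=> x0 xpi; apply: cos_ge0_pihalf; rewrite xpi andbT (le_trans _ x0)// oppr_le0 divr_ge0 ?pi_ge0.
have b2 : 2 * b <= pi / 2 by move: hpi; rewrite hb; lra.
have sb : b * cos b <= sin b.
  have [z] := MVT_segment b0 (fun x _ => is_derive_sin x) (continuous_subspaceT (@continuous_sin R)).
  rewrite in_itv/= sin0 !subr0 => /andP[z0 zb] ->; rewrite mulrC ler_wpM2r//.
  by rewrite leNgt ltr_cos ?in_itv/= ?z0 ?b0 -?leNgt//=; have := @pi_ge0 R; lra.
have cb : 0 <= cos b by apply: cosb => //; have := @pi_ge0 R; lra.
have c2 : 0 <= cos (2 * b) by apply: cosb => //; rewrite mulr_ge0.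
have s2 : b <= sin (2 * b).
  have E : cos (2 * b) = 2 * cos b ^+ 2 - 1.
    by rewrite mulr_natl cos_mulr2n mulr_natl.
  rewrite E in c2; rewrite mulr_natl sin_mulr2n -mulr_natl.
  have : cos b * (b * cos b) <= cos b * sin b by rewrite ler_wpM2l.
  by nra.
have -> : cos h = 1 - 2 * sin (2 * b) ^+ 2.
  rewrite hb (_ : 4 * b = (2 * b) *+ 2); last by rewrite -mulr_natl; ring.
  by rewrite cos_mulr2n cos2sin2 -mulr_natl; ring.
rewrite {1}hb; nra.
Qed.

Lemma reduce_mod_period x y : exists z : int, `|x - (y + z%:~R * T)| <= pi.
Proof.
have T0 := @period_gt0 R.
pose z := Num.floor ((x - y) / T + 2^-1).
have z1 : z%:~R <= (x - y) / T + 2^-1 by exact: floor_le.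
have z2 : (x - y) / T + 2^-1 < (z + 1)%:~R by exact: floorD1_gt.
exists z; rewrite intrD in z2.
have e : x - y = (x - y) / T * T by rewrite divfK// gt_eqF.
move: z1 z2 e; move: (_ / _) (z%:~R) => q w z1 z2 e.
have -> : x - (y + w * T) = (q - w) * T by rewrite mulrBl -e; ring.
rewrite normrM (gtr0_norm T0) -ler_pdivlMr//.
have -> : pi / T = 2^-1.
  by move: (@pi_neq0 R); move: (pi : R) => p p0; field.
by rewrite ler_norml; apply/andP; split; lra.
Qed.

Lemma periodicz (X : R -> R) : periodic X T -> forall (z : int) x, X (x + z%:~R * T) = X x.
Proof.
move=> XT z x; have := @periodic_shiftz _ (EFin \o X) _ z x.
by move=> H; apply: EFin_inj; apply: H => y; rewrite /= XT.
Qed.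

(** A Lipschitz bound in the chord distance: once [y] is moved to its representative nearest to [x],
    the mean value theorem combines with [sqr_le_cos]. This bound is what tames the singularity of
    the kernel. *)
Lemma sqr_increment_le (X p : R -> R) (M : R) x y : (forall x, is_derive x (1 : R) X (p x)) ->
  periodic X T -> (forall x, `|p x| <= M) ->
  (X x - X y) ^+ 2 <= 8 * M ^+ 2 * (1 - cos (x - y)).
Proof.
move=> dX XT pM; have [z xz] := reduce_mod_period x y.
rewrite -(periodicz XT z y) (_ : cos (x - y) = cos (x - (y + z%:~R * T))); last first.
  by rewrite -(cosDz (- z)) mulrNz; congr cos; ring.
move: xz; move: (y + z%:~R * T) => {y z}y xy; pose u := x - y.
have cX : continuous X := is_derive_continuous dX.
have H v w : v <= w -> (X w - X v) ^+ 2 <= M ^+ 2 * (w - v) ^+ 2.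
  move=> vw; have [c _ ->] := MVT_segment vw (fun x _ => dX x) (continuous_subspaceT cX).
  rewrite exprMn ler_wpM2r ?sqr_ge0// -(real_normK (num_real (p c))).
  by apply: lerXn2r; rewrite ?nnegrE// (le_trans _ (pM c)).
apply: (@le_trans _ _ (M ^+ 2 * u ^+ 2)).
  have [xy'|/ltW xy'] := leP y x; first exact: H.
  by rewrite -sqrrN opprB /u -[X in _ * X]sqrrN opprB H.
have := sqr_le_cos xy; have := sqr_ge0 M; rewrite -/u; nra.
Qed.

(* For [phi x = x + t * X x] and [p = X'], the coefficient of [t] in
   [(1 - cos (phi x - phi y)) / (1 - cos (x - y)) / (phi' x * phi' y)]. *)
Definition rho (X p : R -> R) x y : R :=
  sin (x - y) * (X x - X y) / (1 - cos (x - y)) - p x - p y.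

Lemma rhoB (X p Y q : R -> R) x y :
  rho X p x y - rho Y q x y = rho (fun x => X x - Y x) (fun x => p x - q x) x y.
Proof. by rewrite /rho; ring. Qed.

(** Since [sin^2 <= 2 (1 - cos)] and [(X x - X y)^2 <= 8 M^2 (1 - cos)], the quotient is at most
    [4 M]; the two derivatives add [2 M]. *)
Lemma rho_le (X p : R -> R) (M : R) x y : (forall x, is_derive x (1 : R) X (p x)) ->
  periodic X T -> (forall x, `|p x| <= M) -> cos (x - y) < 1 ->
  `|rho X p x y| <= 6 * M.
Proof.
move=> dX XT pM c1; have M0 : 0 <= M by rewrite (le_trans _ (pM 0)).
have d2 := sqr_increment_le x y dX XT pM.
have cs := cos2Dsin2 (x - y); have cN := cos_geN1 (x - y).
suff : `|sin (x - y) * (X x - X y) / (1 - cos (x - y))| <= 4 * M.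
  have := pM x; have := pM y; rewrite /rho !ler_norml.
  by move=> /andP[? ?] /andP[? ?] /andP[? ?]; apply/andP; split; lra.
move: c1 d2 cs cN; set s := sin _; set c := cos _; set d := X x - X y.
move=> c1 d2 cs cN; have u0 : 0 < 1 - c by rewrite subr_gt0.
rewrite normrM normfV (gtr0_norm u0) ler_pdivrMr//.
rewrite -(@ler_pXn2r _ 2) ?nnegrE ?mulr_ge0 ?(ltW u0)//.
rewrite real_normK ?num_real// exprMn.
have s2 : s ^+ 2 = (1 - c) * (1 + c) by rewrite -[LHS](addKr (c ^+ 2)) cs; ring.
rewrite s2.
have -> : (4 * M * (1 - c)) ^+ 2 = (1 - c) * 2 * (8 * M ^+ 2 * (1 - c)) by ring.
by apply: ler_pM; [nra|exact: sqr_ge0|nra|exact: d2].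
Qed.

(** The Taylor remainders of sine and cosine are quadratic in [t * (X x - X y)], and the squared
    increment absorbs the denominator; hence the error is uniform up to the diagonal. *)
Lemma ratio_expansion x y t (X p : R -> R) (L : R) : cos (x - y) < 1 ->
  (X x - X y) ^+ 2 <= L * (1 - cos (x - y)) ->
  `|(1 - cos (x + t * X x - (y + t * X y))) / (1 - cos (x - y)) -
    (1 + t * (rho X p x y + p x + p y))| <= 2 * L * t ^+ 2.
Proof.
have -> : rho X p x y + p x + p y = sin (x - y) * (X x - X y) / (1 - cos (x - y)).
  by rewrite /rho; ring.
set d := X x - X y => c1 d2.
have -> : x + t * X x - (y + t * X y) = x - y + t * d by rewrite /d; ring.
move: c1 d2; set h := x - y; rewrite cosD => c1 d2; have u0 : 0 < 1 - cos h by rewrite subr_gt0.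
have u1 := gt_eqF u0.
have -> : (1 - (cos h * cos (t * d) - sin h * sin (t * d))) / (1 - cos h) -
    (1 + t * (sin h * d / (1 - cos h))) =
    (cos h * (1 - cos (t * d)) + sin h * (sin (t * d) - t * d)) / (1 - cos h).
  by field; rewrite u1.
rewrite normrM normfV (gtr0_norm u0) ler_pdivrMr//.
have := sin_sub_le_sqr (t * d); have := cos_ge_sqr (t * d); rewrite exprMn.
have := cos_max h; have := sin_max h; have := cos_le1 (t * d).
rewrite -subr_ge0; move: (1 - cos (t * d)) (sin (t * d) - _) => A B A0 s1 c1' AB BB.
apply: (@le_trans _ _ (2 * (t ^+ 2 * d ^+ 2))).
  rewrite (le_trans (ler_normD _ _))// !normrM (ger0_norm A0).
  have : `|cos h| * A <= A by rewrite ler_piMl.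
  have : `|sin h| * `|B| <= `|B| by rewrite ler_piMl.
  lra.
have := sqr_ge0 t; nra.
Qed.

(** [Phi] is taken at the moved points and the error is relative to the Jacobian, because both are
    to be pulled back by the same change of variables. In the constant, [16 M^2] comes from
    [ratio_expansion], [2 C1 M] from moving the arguments of [Phi], [M^2] and [3 C0 M] from the
    cross terms of the product; the outer factor 2 reflects that the Jacobian is at least
    [1 / 2]. *)
Lemma deformation_estimate x y t (X p : R -> R) (Phi : R -> R -> R) (M C0 C1 eta : R) :
  (forall x, is_derive x (1 : R) X (p x)) -> periodic X T ->
  (forall x, `|X x| <= M) -> (forall x, `|p x| <= M) ->
  (forall x y, `|Phi x y| <= C0) ->
  (forall x y x' y', `|Phi x y - Phi x' y'| <= C1 * (`|x - x'| + `|y - y'|)) ->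
  `|rho X p x y - Phi x y| <= eta -> cos (x - y) < 1 -> `|t| * M <= 4^-1 ->
  `|(1 - cos (x + t * X x - (y + t * X y))) / (1 - cos (x - y)) -
    (1 + t * Phi (x + t * X x) (y + t * X y)) * ((1 + t * p x) * (1 + t * p y))| <=
  (2 * eta * `|t| + 2 * (16 * M ^+ 2 + 2 * C1 * M + M ^+ 2 + 3 * C0 * M) * t ^+ 2) *
    ((1 + t * p x) * (1 + t * p y)).
Proof.
move=> dX XT XM pM PC PL re c1 tM.
have d2 := sqr_increment_le x y dX XT pM.
have := ratio_expansion t p c1 d2.
have QP := PL x y (x + t * X x) (y + t * X y).
rewrite !opprD !addNKr !normrN !normrM in QP.
set A := (1 - _) / _; set r := rho X p x y in re *.
have := PC (x + t * X x) (y + t * X y); set P := Phi (x + _) _ in QP *; set Q := Phi x y in QP *.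
have M0 : 0 <= M by rewrite (le_trans _ (XM 0)).
have C10 : 0 <= C1.
  have := PL 0 0 1 0; rewrite subrr normr0 addr0 sub0r normrN1 mulr1.
  exact: le_trans.
have C00 : 0 <= C0 by rewrite (le_trans _ (PC 0 0)).
have tM0 : 0 <= `|t| * M by rewrite mulr_ge0.
have tp z : `|t * p z| <= `|t| * M by rewrite normrM ler_wpM2l.
have tX z : `|t| * `|X z| <= `|t| * M by rewrite ler_wpM2l.
rewrite -(real_normK (num_real t)).
move=> PC0 E1; set u := t * p x; set v := t * p y.
have [ux vy] := (tp x, tp y); rewrite -/u -/v in ux vy.
have e2 : `|t * (r - P)| <= `|t| * eta + 2 * C1 * M * `|t| ^+ 2.
  rewrite normrM -[r - P](subrKA Q) (_ : _ + 2 * C1 * M * _ = `|t| * (eta + C1 * (`|t| * M + `|t| * M))); last by ring.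
  rewrite ler_wpM2l// (le_trans (ler_normD _ _))// lerD// (le_trans QP)//.
  by rewrite ler_wpM2l// lerD.
have e3 : `|u * v| <= M ^+ 2 * `|t| ^+ 2.
  by rewrite normrM -exprMn mulrC expr2 (mulrC M); apply: ler_pM.
have e4 : `|t * P * (u + v)| <= 2 * C0 * M * `|t| ^+ 2.
  rewrite (normrM (t * P)) (normrM t P) (_ : 2 * C0 * M * _ = `|t| * C0 * (`|t| * M + `|t| * M)); last by ring.
  by rewrite ler_pM ?mulr_ge0 ?ler_wpM2l// (le_trans (ler_normD _ _))// lerD.
have e5 : `|t * P * (u * v)| <= C0 * M * `|t| ^+ 2.
  rewrite (normrM (t * P)) (normrM t P) (normrM u v) (_ : C0 * M * _ = `|t| * C0 * (`|t| * M * 1)); last by ring.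
  rewrite ler_pM ?mulr_ge0 ?ler_wpM2l// ler_pM//.
  by rewrite (le_trans vy)// (le_trans tM)// invf_le1// ler1n.
pose S := eta * `|t| + (16 * M ^+ 2 + 2 * C1 * M + M ^+ 2 + 3 * C0 * M) * `|t| ^+ 2.
have S1 : `|A - (1 + t * P) * ((1 + u) * (1 + v))| <= S.
  have -> : A - (1 + t * P) * ((1 + u) * (1 + v)) =
    (A - (1 + t * (r + p x + p y))) + t * (r - P) - u * v - t * P * (u + v) - t * P * (u * v).
    by rewrite /u /v; ring.
  rewrite (_ : S = 2 * (8 * M ^+ 2) * `|t| ^+ 2 +
    (`|t| * eta + 2 * C1 * M * `|t| ^+ 2) + M ^+ 2 * `|t| ^+ 2 + 2 * C0 * M * `|t| ^+ 2 +
    C0 * M * `|t| ^+ 2); last by rewrite /S; ring.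
  do 4 (apply: (le_trans (ler_normD _ _)); rewrite ?normrN; apply: lerD => //).
have W2 : 2^-1 <= (1 + u) * (1 + v).
  move: (le_trans ux tM) (le_trans vy tM); rewrite !ler_norml => /andP[u1 _] /andP[v1 _].
  nra.
have S0 : 0 <= S by exact: le_trans (normr_ge0 _) S1.
apply: (le_trans S1); rewrite (_ : 2 * eta * `|t| + _ = S * 2); last by rewrite /S; ring.
by rewrite -mulrA ler_peMr// -ler_pdivrMl// mulr1.
Qed.

End Estimates.

(** * Approximation by Fejer means in C^1 *)

Section C1Approximation.
Context {R : realType}.
Implicit Types (x y h t : R) (f : R -> R).
Local Notation T := ((pi : R) *+ 2).

Lemma cos_le_one_sub x : `|x| <= pi -> x ^+ 2 / 8 <= 1 - cos x.
Proof. by move=> /sqr_le_cos h; rewrite ler_pdivrMr// mulrC. Qed.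

Lemma periodic_continuous_bounded f : continuous f -> periodic f T ->
  exists M, forall x, `|f x| <= M.
Proof.
move=> cf fT; have [M [_ HM]] : bounded_set (f @` `[-T, T]%classic).
  apply: compact_bounded; apply: continuous_compact; last exact: segment_compact.
  exact: continuous_subspaceT.
exists (M + 1) => x; have [z xz] := reduce_mod_period 0 x.
rewrite -(periodicz fT z x); apply: (HM (M + 1)); first by rewrite ltrDl.
exists (x + z%:~R * T) => //=; rewrite in_itv/=.
move: xz; rewrite sub0r normrN ler_norml => /andP[h1 h2].
have p0 := @pi_ge0 R; rewrite mulr2n.
by apply/andP; split; [apply: le_trans h1|apply: (le_trans h2)]; lra.
Qed.

(** Only [x] is confined to the segment; [y] may leave it, so that the ends of a period call for no
    separate treatment. *)
Lemma continuous_uniform f (a b : R) : continuous f -> forall e, 0 < e ->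
  exists2 d, 0 < d & forall x y, a <= x <= b -> `|y - x| < d -> `|f y - f x| < e.
Proof.
move=> cf e e0.
pose P (d x : R) := forall y, `|y - x| < d -> `|f y - f x| < e.
have : \forall d \near (0 : R)^'+, `[a, b]%classic `<=` P d.
  apply: (compact_near_coveringP _).1; first exact: segment_compact.
  move=> x _; have e2 : 0 < e / 2 by rewrite divr_gt0.
  have /cvgrPdist_lt/(_ _ e2) := cf x.
  case=> r /= r0 rP; have r2 : 0 < r / 2 by rewrite divr_gt0.
  exists (ball x (r / 2), [set d | 0 < d < r / 2]) => /=.
    split; first exact: nbhsx_ballx.
    exists (r / 2) => //= d; rewrite /= sub0r normrN => dr d0.
    by rewrite d0/= (le_lt_trans (ler_norm _)).
  move=> [z d] /= [xz /andP[d0 dr]] y yz.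
  have hz : `|f x - f z| < e / 2.
    by apply: rP; apply: lt_le_trans xz _; lra.
  have hy : `|f x - f y| < e / 2.
    apply: rP; rewrite /= /ball_/= -(subrKA z) (le_lt_trans (ler_normD _ _))//.
    by rewrite [ltRHS](splitr r) ltrD// distrC (lt_trans yz).
  rewrite -(subrKA (f x)) (le_lt_trans (ler_normD _ _))// [ltRHS](splitr e).
  by rewrite ltrD// distrC.
case=> r /= r0 rP; exists (r / 2); first by rewrite divr_gt0.
move=> x y xab; apply: (rP (r / 2)) => //=; last by rewrite divr_gt0.
by rewrite /= sub0r normrN gtr0_norm ?divr_gt0//; lra.
Qed.

(** Within distance [d], uniform continuity gives [e]. Farther apart, with [y] the representative
    nearest to [x], [1 - cos (x - y) >= d^2 / 8], and the chosen [c] makes the second term exceed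
    the trivial bound [2 M]. *)
Lemma continuous_circle_regular f : continuous f -> periodic f T -> circle_regular f.
Proof.
move=> cf fT e e0; have [M fM] := periodic_continuous_bounded cf fT.
have [d d0 fd] := continuous_uniform (- pi) pi cf e0.
have M0 : 0 <= M by rewrite (le_trans _ (fM 0)).
have d2 : 0 < d ^+ 2 / 8 by rewrite divr_gt0 ?exprn_gt0.
exists (2 * M / (d ^+ 2 / 8)); first by rewrite divr_ge0 ?mulr_ge0// ltW.
move=> x y; have [z xz] := reduce_mod_period 0 x; rewrite sub0r normrN in xz.
rewrite -(periodicz fT z x) (_ : cos _ = cos (x + z%:~R * T - (y + z%:~R * T))); last first.
  by congr cos; ring.
rewrite -[in f y](periodicz fT z y).
move: (x + _) (y + _) xz => {}x {}y xpi.
have [k yk] := reduce_mod_period x y.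
rewrite -(periodicz fT k y) (_ : cos _ = cos (x - (y + k%:~R * T))); last first.
  by rewrite -[RHS](cosDz k); congr cos; ring.
move: (y + _) yk => {}y yk.
have u0 : 0 <= 1 - cos (x - y) by rewrite subr_ge0 cos_le1.
have [yd|yd] := ltP `|y - x| d.
  rewrite (le_trans (ltW (fd x y _ yd)))//; first by rewrite -ler_norml.
  by rewrite lerDl mulr_ge0// divr_ge0 ?mulr_ge0// ltW.
apply: (@le_trans _ _ (2 * M)).
  by rewrite (le_trans (ler_normB _ _))// mulr_natl mulr2n lerD.
rewrite (@le_trans _ _ (2 * M / (d ^+ 2 / 8) * (1 - cos (x - y))))//; last by rewrite lerDr ltW.
rewrite -mulrA ler_peMr ?mulr_ge0// ler_pdivlMl// mulr1.
rewrite (le_trans _ (cos_le_one_sub yk))// ler_pM2r ?invr_gt0//.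
by rewrite -(real_normK (num_real (x - y))) distrC lerXn2r// ?nnegrE// ltW.
Qed.

Lemma acoef_derive (X p : R -> R) k : (forall x, is_derive x (1 : R) X (p x)) ->
  continuous p -> periodic X T -> acoef p k = k%:R * bcoef X k.
Proof.
move=> dX cp XT; have cX := is_derive_continuous dX.
have dF x : is_derive x (1 : R) (X * (fun x => cos (k%:R * x)))
    (p x * cos (k%:R * x) - k%:R * (X x * sin (k%:R * x))).
  apply: is_derive_eq (is_deriveM (dX x) (is_derive_cosM k%:R x)) _.
  by rewrite /GRing.scale/=; ring.
have L1p : L1 (fun x => p x * cos (k%:R * x)) by apply: L1_mul_cos; exact: continuous_L1.
have L1X : L1 (fun x => X x * sin (k%:R * x)) by apply: L1_mul_sin; exact: continuous_L1.
have cF : continuous (fun x => p x * cos (k%:R * x) - k%:R * (X x * sin (k%:R * x))).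
  move=> x; apply: cvgB; first by apply: cvgM; [exact: cp|exact: continuous_cosM].
  apply: cvgM; first exact: cvg_cst.
  by apply: cvgM; [exact: cX|exact: continuous_sinM].
have := derive_Ic dF cF; rewrite IcB//; last exact: L1Z.
rewrite IcZ// -/(acoef p k) -/(bcoef X k) => E; apply/eqP; rewrite -subr_eq0 E.
rewrite -[X in X == _]/(X T * cos (k%:R * T) - X 0 * cos (k%:R * 0)).
have -> : X T = X 0 by rewrite -[T]add0r XT.
have -> : cos (k%:R * T) = cos (k%:R * 0) by rewrite -[T]add0r; exact: (cosM_periodic k 0).
by rewrite subrr.
Qed.

Lemma bcoef_derive (X p : R -> R) k : (forall x, is_derive x (1 : R) X (p x)) ->
  continuous p -> periodic X T -> bcoef p k = - (k%:R * acoef X k).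
Proof.
move=> dX cp XT; have cX := is_derive_continuous dX.
have dF x : is_derive x (1 : R) (X * (fun x => sin (k%:R * x)))
    (p x * sin (k%:R * x) + k%:R * (X x * cos (k%:R * x))).
  apply: is_derive_eq (is_deriveM (dX x) (is_derive_sinM k%:R x)) _.
  by rewrite /GRing.scale/=; ring.
have L1p : L1 (fun x => p x * sin (k%:R * x)) by apply: L1_mul_sin; exact: continuous_L1.
have L1X : L1 (fun x => X x * cos (k%:R * x)) by apply: L1_mul_cos; exact: continuous_L1.
have cF : continuous (fun x => p x * sin (k%:R * x) + k%:R * (X x * cos (k%:R * x))).
  move=> x; apply: cvgD; first by apply: cvgM; [exact: cp|exact: continuous_sinM].
  apply: cvgM; first exact: cvg_cst.
  by apply: cvgM; [exact: cX|exact: continuous_cosM].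
have := derive_Ic dF cF; rewrite IcD//; last exact: L1Z.
rewrite IcZ// -/(acoef X k) -/(bcoef p k) => E; apply/eqP; rewrite -subr_eq0 opprK E.
rewrite -[X in X == _]/(X T * sin (k%:R * T) - X 0 * sin (k%:R * 0)).
have -> : X T = X 0 by rewrite -[T]add0r XT.
have -> : sin (k%:R * T) = sin (k%:R * 0) by rewrite -[T]add0r; exact: (sinM_periodic k 0).
by rewrite subrr.
Qed.

(** Differentiation and Fejer means both act frequency by frequency on the coefficients, hence
    commute. *)
Lemma is_derive_fejer (X p : R -> R) n x : (forall x, is_derive x (1 : R) X (p x)) ->
  continuous p -> periodic X T -> is_derive x (1 : R) (fejer n X) (fejer n p x).
Proof.
move=> dX cp XT; have cX := is_derive_continuous dX.
have -> : fejer n X = trigpoly n (fun j => (n%:R * T)^-1 * fejer_weight n j * acoef X j)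
    (fun j => (n%:R * T)^-1 * fejer_weight n j * bcoef X j).
  by apply/funext => y; rewrite fejerE//; exact: continuous_L1.
rewrite fejerE; last exact: continuous_L1.
apply: is_derive_eq (is_derive_trigpoly _ _ _ _) _.
apply: eq_bigr => j _; rewrite (acoef_derive _ dX)// (bcoef_derive _ dX)//.
by ring.
Qed.

End C1Approximation.

(** * The Gagliardo energy under a change of variables *)

Section Deformation.
Context {R : realType}.
Implicit Types (x y h t : R) (f u : R -> R).
Local Notation T := ((pi : R) *+ 2).
Local Notation Rm := (measurableTypeR R).

Lemma ge0_integral_subst2 (phi w : R -> R) (H : R -> R -> \bar R) :
  (forall x : R, is_derive x (1 : R) phi (w x)) -> continuous w ->
  (forall x, 0 < w x) -> (forall x, phi (x + T) = phi x + T) ->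
  measurable_fun setT (fun z : Rm * Rm => H z.1 z.2) ->
  (forall x y, 0 <= H x y)%E ->
  (forall x y, H (x + T) y = H x y) -> (forall x y, H x (y + T) = H x y) ->
  (\int[circ]_x \int[circ]_y (H (phi x) (phi y) * (w x * w y)%:E) =
   \int[circ]_x \int[circ]_y H x y)%E.
Proof.
move=> dphi cw w0 phiT mH H0 HT1 HT2.
have mw := continuous_measurable cw.
have mphi := continuous_measurable (is_derive_continuous dphi).
have mHx x : measurable_fun setT (fun y : Rm => H x y).
  exact: (measurableT_comp mH (pair1_measurable (x : Rm))).
have mF : measurable_fun setT (fun x : Rm => \int[circ]_y H x y)%E.
  have := @measurable_fun_fubini_tonelli_F _ _ _ _ _ circ _ mH.
  by apply=> -[x y]; exact: H0.
rewrite -[RHS](@ge0_integral_subst _ phi w dphi cw w0 phiT (fun x => \int[circ]_y H x y)%E)//.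
- apply: eq_integral => x _.
  rewrite -[X in (X * _)%E](@ge0_integral_subst _ phi w dphi cw w0 phiT)//.
  rewrite -ge0_integralZr//.
  + by apply: eq_integral => y _; rewrite -muleA -EFinM (mulrC (w x)).
  + apply: emeasurable_funM; last by apply/measurable_EFinP; exact: mw.
    exact: (measurableT_comp (mHx (phi x)) mphi).
  + by move=> y _; rewrite mule_ge0// lee_fin ltW.
  + by rewrite lee_fin ltW.
  exact: mHx.
- by move=> x; apply: integral_ge0 => y _.
- by move=> x; apply: eq_integral => y _; rewrite HT1.
Qed.

Definition energy_density u x y : R := (u x - u y) ^+ 2 * kern (x - y).

Lemma energy_density_ge0 u x y : 0 <= energy_density u x y.
Proof. by rewrite mulr_ge0 ?sqr_ge0 ?kern_ge0. Qed.

Lemma gagliardo_ge0 u : (0 <= gagliardo u)%E.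
Proof.
apply: integral_ge0 => x _; apply: integral_ge0 => y _.
by rewrite lee_fin energy_density_ge0.
Qed.

Lemma measurable_energy_density u : measurable_fun setT u ->
  measurable_fun setT (fun z : Rm * Rm => energy_density u z.1 z.2).
Proof.
move=> mu; apply: measurable_funM.
  apply: measurable_funX; apply: measurable_funB.
    exact: measurableT_comp mu measurable_fst.
  exact: measurableT_comp mu measurable_snd.
apply: measurableT_comp measurable_kern _.
exact: measurable_funB measurable_fst measurable_snd.
Qed.

Lemma cos_eq1 h : cos h = 1 -> exists z : int, h = z%:~R * T.
Proof.
move=> h1; have [z zh] := reduce_mod_period 0 h; exists (- z).
have c1 : cos (h + z%:~R * T) = 1 by rewrite addrC cosDz.
move: zh; rewrite sub0r => /sqr_le_cos; rewrite cosN c1 subrr mulr0 sqrrN => h0.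
have : h + z%:~R * T = 0 by apply/eqP; rewrite -sqrf_eq0 eq_le h0 sqr_ge0.
by move=> /eqP; rewrite addr_eq0 => /eqP ->; rewrite mulrNz mulNr.
Qed.

Lemma cos_lt1P h : cos h < 1 \/ exists z : int, h = z%:~R * T.
Proof.
have := cos_le1 h; rewrite le_eqVlt => /orP[/eqP h1|]; last by left.
by right; exact: cos_eq1.
Qed.

Lemma energy_density_diag u (z : int) x y : periodic u T -> x - y = z%:~R * T ->
  energy_density u x y = 0.
Proof.
move=> uT xy; rewrite /energy_density -(periodicz uT z y) (_ : y + _ = x).
  by rewrite subrr expr0n mul0r.
by rewrite -xy addrC subrK.
Qed.

Lemma energy_density_comp u (X : R -> R) t x y : periodic u T -> periodic X T ->
  cos (x - y) < 1 ->
  energy_density (fun x => u (x + t * X x)) x y =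
  energy_density u (x + t * X x) (y + t * X y) *
    ((1 - cos (x + t * X x - (y + t * X y))) / (1 - cos (x - y))).
Proof.
move=> uT XT c1; have [c2|[z xy]] := cos_lt1P (x + t * X x - (y + t * X y)).
  rewrite /energy_density /kern; field.
  by rewrite !subr_eq0 ![1 == _]eq_sym !lt_eqF.
(* If the moved points coincide modulo [2 pi], [kern] is at its default value; both sides vanish
   because the increment of [u] does. *)
rewrite (energy_density_diag uT xy) mul0r /energy_density.
rewrite (_ : x + t * X x = y + t * X y + z%:~R * T); last by rewrite -xy; ring.
by rewrite periodicz// subrr expr0n mul0r.
Qed.

Lemma le_iterated_integral (F G : R -> R -> \bar R) :
  measurable_fun setT (fun z : Rm * Rm => F z.1 z.2) ->
  measurable_fun setT (fun z : Rm * Rm => G z.1 z.2) ->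
  (forall x y, 0 <= F x y)%E -> (forall x y, F x y <= G x y)%E ->
  (\int[circ]_x \int[circ]_y F x y <= \int[circ]_x \int[circ]_y G x y)%E.
Proof.
move=> mF mG F0 FG; have G0 x y : (0 <= G x y)%E by exact: le_trans (F0 x y) (FG x y).
have mFx x : measurable_fun setT (fun y : Rm => F x y).
  exact: (measurableT_comp mF (pair1_measurable (x : Rm))).
have mGx x : measurable_fun setT (fun y : Rm => G x y).
  exact: (measurableT_comp mG (pair1_measurable (x : Rm))).
apply: ge0_le_integral => //.
- by move=> x _; apply: integral_ge0.
- apply: (@measurable_fun_fubini_tonelli_F _ _ _ _ _ circ _ mF) => -[x y]; exact: F0.
- apply: (@measurable_fun_fubini_tonelli_F _ _ _ _ _ circ _ mG) => -[x y]; exact: G0.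
- by move=> x _; apply: ge0_le_integral.
Qed.

Definition circ2 : {measure set (Rm * Rm)%type -> \bar R} := (@circ R \x @circ R)%E.

Lemma iterated_integral (F : R -> R -> \bar R) :
  measurable_fun setT (fun z : Rm * Rm => F z.1 z.2) -> (forall x y, 0 <= F x y)%E ->
  (\int[circ]_x \int[circ]_y F x y = \int[circ2]_z F z.1 z.2)%E.
Proof.
move=> mF F0; apply/esym/(@fubini_tonelli1 _ _ _ _ _ circ circ _ mF).
by move=> [x y]; exact: F0.
Qed.

Lemma integrable_energy_density u : measurable_fun setT u -> (gagliardo u < +oo)%E ->
  circ2.-integrable setT (fun z => (energy_density u z.1 z.2)%:E).
Proof.
move=> mu uoo; have mW : measurable_fun setT (fun z : Rm * Rm => (energy_density u z.1 z.2)%:E).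
  by apply/measurable_EFinP; exact: measurable_energy_density.
apply/integrableP; split=> //.
under eq_integral do rewrite gee0_abs ?lee_fin ?energy_density_ge0//.
rewrite -(@iterated_integral (fun x y => (energy_density u x y)%:E))//.
by move=> x y; rewrite lee_fin energy_density_ge0.
Qed.

Definition energy_pairing u (Phi : R -> R -> R) : R :=
  \int[circ2]_z (energy_density u z.1 z.2 * Phi z.1 z.2).

(** The smallness condition keeps [1 + t * Phi + e] nonnegative. Tonelli then leads from iterated
    integrals, where variables are changed, to the product measure, where signed terms can be
    separated by linearity. *)
Lemma iterated_perturbed u (Phi : R -> R -> R) (C0 t e : R) : measurable_fun setT u ->
  (gagliardo u < +oo)%E -> measurable_fun setT (fun z : Rm * Rm => Phi z.1 z.2) ->
  (forall x y, `|Phi x y| <= C0) -> `|t| * C0 + `|e| <= 1 ->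
  (\int[circ]_x \int[circ]_y (energy_density u x y * (1 + t * Phi x y + e))%:E =
   (fine (gagliardo u) * (1 + e) + t * energy_pairing u Phi)%:E)%E.
Proof.
move=> mu uoo mPhi PC te; have iW := integrable_energy_density mu uoo.
have mW := measurable_energy_density mu.
have mQ : measurable_fun setT (fun z : Rm * Rm => 1 + t * Phi z.1 z.2 + e).
  by apply: measurable_funD => //; apply: measurable_funD => //; exact: measurable_funM.
have iWP : circ2.-integrable setT (EFin \o (fun z : Rm * Rm => energy_density u z.1 z.2 * Phi z.1 z.2)).
  apply: (le_integrable _ _ _ (integrableZl measurableT C0 iW)) => //.
    by apply/measurable_EFinP; exact: measurable_funM.
  move=> z _ /=; have W0 := energy_density_ge0 u z.1 z.2.
  rewrite lee_fin [leLHS]normrM [leRHS]normrM (ger0_norm W0) mulrC.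
  by rewrite ler_wpM2r// (le_trans (PC _ _))// ler_norm.
have iWr : circ2.-integrable setT (EFin \o (fun z : Rm * Rm => energy_density u z.1 z.2)) by [].
rewrite (@iterated_integral (fun x y => (energy_density u x y * (1 + t * Phi x y + e))%:E)); last 2 first.
- by apply/measurable_EFinP; exact: measurable_funM.
- move=> x y; rewrite lee_fin mulr_ge0 ?energy_density_ge0//.
  have : `|t * Phi x y| <= `|t| * C0 by rewrite normrM ler_wpM2l.
  move: te; have := ler_norm (- e); rewrite normrN ler_norml => h1 h2 /andP[h3 h4]; lra.
rewrite (eq_integral (fun z => (EFin \o (fun z : Rm * Rm => (1 + e) * energy_density u z.1 z.2 +
   t * (energy_density u z.1 z.2 * Phi z.1 z.2))) z)); last first.
  by move=> z _ /=; congr EFin; ring.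
have iA : circ2.-integrable setT (EFin \o (fun z : Rm * Rm => (1 + e) * energy_density u z.1 z.2)).
  by apply: eq_integrable (integrableZl measurableT (1 + e) iWr).
have iB : circ2.-integrable setT (EFin \o (fun z : Rm * Rm => t * (energy_density u z.1 z.2 * Phi z.1 z.2))).
  by apply: eq_integrable (integrableZl measurableT t iWP).
have gE : gagliardo u = (\int[circ2]_z (energy_density u z.1 z.2)%:E)%E.
  apply: (@iterated_integral (fun x y => (energy_density u x y)%:E)).
    exact/measurable_EFinP.
  by move=> x y; rewrite lee_fin energy_density_ge0.
rewrite -[LHS]fineK; last exact: (integrable_fin_num measurableT (integrableD measurableT iA iB)).
congr EFin; rewrite -/(Rintegral _ _ _) RintegralD// !RintegralZl// gE mulrC.
by rewrite /energy_pairing.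
Qed.

(* Both variables are changed to [x + t * X x]. [rho X p] need not be continuous at the
   diagonal, so it is evaluated only up to [eta], through a regular kernel [Phi]. *)
Lemma gagliardo_deformation u (X p : R -> R) (Phi : R -> R -> R) (M C0 C1 eta t : R) :
  L2 u -> periodic u T -> (gagliardo u < +oo)%E ->
  (forall x, is_derive x (1 : R) X (p x)) -> continuous p -> periodic X T ->
  (forall x, `|X x| <= M) -> (forall x, `|p x| <= M) ->
  measurable_fun setT (fun z : Rm * Rm => Phi z.1 z.2) ->
  (forall x y, Phi (x + T) y = Phi x y) -> (forall x y, Phi x (y + T) = Phi x y) ->
  (forall x y, `|Phi x y| <= C0) ->
  (forall x y x' y', `|Phi x y - Phi x' y'| <= C1 * (`|x - x'| + `|y - y'|)) ->
  (forall x y, cos (x - y) < 1 -> `|rho X p x y - Phi x y| <= eta) -> `|t| * M <= 4^-1 ->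
  let e := 2 * eta * `|t| + 2 * (16 * M ^+ 2 + 2 * C1 * M + M ^+ 2 + 3 * C0 * M) * t ^+ 2 in
  `|t| * C0 + e <= 1 ->
  (gagliardo (fun x => u (x + t * X x)%R) < +oo)%E /\
  `|fine (gagliardo (fun x => u (x + t * X x))) - (fine (gagliardo u) + t * energy_pairing u Phi)|
    <= e * fine (gagliardo u).
Proof.
move=> u2 uT uoo dX cp XT XM pM mPhi PT1 PT2 PC PL re tM e te1.
have mu := L2_measurable u2.
pose phi x := x + t * X x; pose w x := 1 + t * p x.
have dphi x : is_derive x (1 : R) phi (w x).
  by have := is_deriveD (is_derive_id x (1 : R)) (is_deriveZ t (dX x)).
have cw : continuous w.
  move=> x; apply: cvgD; first exact: cvg_cst.
  by apply: cvgM; [exact: cvg_cst|exact: cp].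
have tp x : `|t * p x| <= 4^-1 by rewrite normrM (le_trans _ tM)// ler_wpM2l.
have w0 x : 0 < w x by have := tp x; rewrite /w ler_norml => /andP[h _]; lra.
have phiT x : phi (x + T) = phi x + T by rewrite /phi XT; ring.
have mphi := continuous_measurable (is_derive_continuous dphi).
have mw := continuous_measurable cw.
have mX := continuous_measurable (is_derive_continuous dX).
pose ut x := u (x + t * X x).
have mut : measurable_fun setT ut by exact: (measurableT_comp mu mphi).
have utT : periodic ut T by move=> x; rewrite /ut -/(phi _) phiT uT.
have W0 := energy_density_ge0 u.
have e0 : 0 <= e.
  have M0 : 0 <= M by rewrite (le_trans _ (XM 0)).
  have C10 : 0 <= C1.
    have := PL 0 0 1 0; rewrite subrr normr0 addr0 sub0r normrN1 mulr1.
    exact: le_trans.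
  have C00 : 0 <= C0 by rewrite (le_trans _ (PC 0 0)).
  (* The bound by [eta] is assumed off the diagonal only; the antipodal pair [(pi, 0)] lies
     there. *)
  have eta0 : 0 <= eta.
    by rewrite (le_trans _ (re pi 0 _))// subr0 cospi; lra.
  rewrite /e; apply: addr_ge0; first by apply: mulr_ge0 => //; apply: mulr_ge0.
  apply: mulr_ge0; last exact: sqr_ge0.
  apply: mulr_ge0 => //; do 3?[apply: addr_ge0; last by rewrite ?sqr_ge0// !mulr_ge0].
  by rewrite mulr_ge0// sqr_ge0.
(* Used for [s = e] and [s = - e]: the deformed density lies between these two functions at the
   moved points, times the Jacobian, and the integrals of both are explicit. *)
pose H s x y : R := energy_density u x y * (1 + t * Phi x y + s).
have H0 s x y : `|s| <= e -> 0 <= H s x y.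
  move=> se; rewrite mulr_ge0//.
  have : `|t * Phi x y| <= `|t| * C0 by rewrite normrM ler_wpM2l.
  move: se te1; rewrite !ler_norml => /andP[h1 h2] h3 /andP[h4 h5]; lra.
have mH s : measurable_fun setT (fun z : Rm * Rm => H s z.1 z.2).
  apply: measurable_funM; first exact: measurable_energy_density.
  by apply: measurable_funD => //; apply: measurable_funD => //; exact: measurable_funM.
have HI s : `|s| <= e -> (\int[circ]_x \int[circ]_y (H s (phi x) (phi y) * (w x * w y))%:E =
    (fine (gagliardo u) * (1 + s) + t * energy_pairing u Phi)%:E)%E.
  move=> se; have ts : `|t| * C0 + `|s| <= 1 by rewrite (le_trans _ te1)// lerD2l.
  rewrite -(iterated_perturbed mu uoo mPhi PC ts).
  rewrite -(@ge0_integral_subst2 phi w (fun x y => (H s x y)%:E) dphi cw w0 phiT)//.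
  - exact/measurable_EFinP.
  - by move=> x y; rewrite lee_fin H0.
  - move=> x y; rewrite /H PT1 /energy_density uT; congr (_ * _ * _)%:E.
    by rewrite -(kern_periodic (x - y)); congr kern; ring.
  - move=> x y; rewrite /H PT2 /energy_density uT; congr (_ * _ * _)%:E.
    by rewrite -kern_periodic; congr kern; ring.
have mHphi s : measurable_fun setT (fun z : Rm * Rm => (H s (phi z.1) (phi z.2) * (w z.1 * w z.2))%:E).
  apply/measurable_EFinP; apply: measurable_funM.
    apply: (measurableT_comp (mH s) (g := fun z : Rm * Rm => (phi z.1, phi z.2))).
    apply: measurable_fun_pair; first exact: measurableT_comp mphi measurable_fst.
    exact: measurableT_comp mphi measurable_snd.
  apply: measurable_funM; first exact: measurableT_comp mw measurable_fst.
  exact: measurableT_comp mw measurable_snd.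
have mut2 : measurable_fun setT (fun z : Rm * Rm => (energy_density ut z.1 z.2)%:E).
  by apply/measurable_EFinP; exact: measurable_energy_density.
have pointwise x y : `|energy_density ut x y -
    energy_density u (phi x) (phi y) * ((1 + t * Phi (phi x) (phi y)) * (w x * w y))| <=
    energy_density u (phi x) (phi y) * (e * (w x * w y)).
  have [c1|[z xy]] := cos_lt1P (x - y); last first.
    rewrite (energy_density_diag utT xy) (energy_density_diag uT (z := z)).
      by rewrite !mul0r subr0 normr0.
    rewrite /phi (_ : x = y + z%:~R * T); last by rewrite -xy; ring.
    by rewrite periodicz//; ring.
  rewrite energy_density_comp// -mulrBr normrM (ger0_norm (W0 _ _)) ler_wpM2l//.
  exact: (deformation_estimate dX XT XM pM PC PL (re _ _ c1) c1 tM).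
have ub : (gagliardo ut <= (fine (gagliardo u) * (1 + e) + t * energy_pairing u Phi)%:E)%E.
  rewrite -HI; last by rewrite ger0_norm.
  apply: (@le_iterated_integral (fun x y => (energy_density ut x y)%:E)
    (fun x y => (H e (phi x) (phi y) * (w x * w y))%:E)) => //.
    by move=> x y; rewrite lee_fin energy_density_ge0.
  move=> x y; rewrite lee_fin; have := pointwise x y; rewrite ler_norml => /andP[_].
  rewrite /H lerBlDr => /le_trans; apply; rewrite le_eqVlt; apply/orP; left; apply/eqP; ring.
have lb : ((fine (gagliardo u) * (1 - e) + t * energy_pairing u Phi)%:E <= gagliardo ut)%E.
  rewrite -HI; last by rewrite normrN ger0_norm.
  apply: (@le_iterated_integral (fun x y => (H (- e) (phi x) (phi y) * (w x * w y))%:E)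
    (fun x y => (energy_density ut x y)%:E)) => //.
    move=> x y; rewrite lee_fin mulr_ge0//; last by rewrite mulr_ge0// ltW.
    by apply: H0; rewrite normrN ger0_norm.
  move=> x y; rewrite lee_fin; have := pointwise x y; rewrite ler_norml => /andP[h _].
  move: h; rewrite lerBrDr; apply: le_trans.
  by rewrite /H le_eqVlt; apply/orP; left; apply/eqP; ring.
have utoo : (gagliardo ut < +oo)%E by apply: (le_lt_trans ub); rewrite ltry.
split=> //; have [g Eg] : exists g, gagliardo ut = g%:E.
  by exists (fine (gagliardo ut)); rewrite fineK// ge0_fin_numE// gagliardo_ge0.
move: ub lb; rewrite Eg; rewrite lee_fin => ub; rewrite lee_fin => lb.
rewrite (_ : fine g%:E = g)//.
rewrite ler_distl; apply/andP; split.
  by apply: le_trans lb; rewrite le_eqVlt; apply/orP; left; apply/eqP; ring.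
by apply: (le_trans ub); rewrite le_eqVlt; apply/orP; left; apply/eqP; ring.
Qed.

End Deformation.

(** * The first variation in terms of Fourier coefficients *)

Section TrigonometricIdentity.

(* The closed form of the convolution of [s z^s] and [s w^s], cleared of denominators. *)
Lemma conv_sum_identity (A : comNzRingType) (z w : A) n :
  (z - w) ^+ 3 * (\sum_(s < n) (s * (n - s))%:R * (z ^+ s * w ^+ (n - s))) =
  z * w * (n%:R * (z ^+ n + w ^+ n) * (z - w) - (z + w) * (z ^+ n - w ^+ n)).
Proof.
(* When [k] increases, the weight [s * (k - s)] of [S] increases by [s]; so the recursion for [S]
   involves the first moment [E], whose own closed form is [EE]. *)
pose E k := \sum_(s < k) s%:R * (z ^+ s * w ^+ (k - s)).
pose S k := \sum_(s < k) (s * (k - s))%:R * (z ^+ s * w ^+ (k - s)).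
have ES k : E k.+1 = w * (E k + k%:R * z ^+ k).
  rewrite /E big_ord_recr/= subSnn expr1 mulrDr mulr_sumr; congr (_ + _); last by ring.
  by apply: eq_bigr => s _; rewrite subSn 1?ltnW// [w ^+ _.+1]exprS; ring.
have SS k : S k.+1 = w * (S k + E k + k%:R * z ^+ k).
  rewrite /S /E big_ord_recr/= subSnn expr1 muln1 -big_split/= mulrDr mulr_sumr.
  congr (_ + _); last by ring.
  apply: eq_bigr => s _; rewrite subSn 1?ltnW// [w ^+ _.+1]exprS mulnS natrD; ring.
have EE k : (z - w) ^+ 2 * E k =
    (k%:R - 1) * z ^+ k.+1 * w - k%:R * z ^+ k * w ^+ 2 + z * w ^+ k.+1.
  elim: k => [|k IH]; first by rewrite /E big_ord0; ring.
  rewrite ES (_ : _ * _ = w * ((z - w) ^+ 2 * E k) + w * (z - w) ^+ 2 * (k%:R * z ^+ k)); last by ring.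
  by rewrite IH -natr1 !exprS; ring.
rewrite -/(S n); elim: n => [|n IH]; first by rewrite /S big_ord0; ring.
rewrite SS (_ : _ * _ = w * ((z - w) ^+ 3 * S n) + w * (z - w) * ((z - w) ^+ 2 * E n) +
  w * (z - w) ^+ 3 * (n%:R * z ^+ n)); last by ring.
by rewrite IH EE -natr1 !exprS; ring.
Qed.

Context {R : realType}.
Implicit Types (x y h t : R) (f u : R -> R).
Local Notation T := ((pi : R) *+ 2).
Local Notation Rm := (measurableTypeR R).
Local Notation C := (complex R).

Definition cis x : C := Complex (cos x) (sin x).

Lemma complex_mulE (a b c d : R) :
  Complex a b * Complex c d = Complex (a * c - b * d) (a * d + b * c) :> C.
Proof. by []. Qed.

Lemma complex_addE (a b c d : R) : Complex a b + Complex c d = Complex (a + c) (b + d) :> C.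
Proof. by []. Qed.

Lemma complex_oppE (a b : R) : - Complex a b = Complex (- a) (- b) :> C.
Proof. by []. Qed.

Lemma complex_natE n : n%:R = Complex n%:R 0 :> C.
Proof.
by elim: n => // n IH; rewrite -!natr1 IH (_ : 1 = Complex 1 0)// complex_addE addr0.
Qed.

Lemma complex_oneE : 1 = Complex 1 0 :> C. Proof. by []. Qed.

Let complexE := (complex_natE, complex_oneE, complex_mulE, complex_addE, complex_oppE).

Lemma cisD x y : cis (x + y) = cis x * cis y.
Proof. by rewrite /cis cosD sinD complex_mulE; congr Complex; ring. Qed.

Lemma cisX x n : cis x ^+ n = cis (n%:R * x).
Proof.
elim: n => [|n IH]; first by rewrite mul0r /cis cos0 sin0.
by rewrite exprS IH -cisD; congr cis; rewrite -[n.+1]add1n natrD; ring.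
Qed.

Lemma cisN x : cis x * cis (- x) = 1.
Proof. by rewrite -cisD subrr /cis cos0 sin0. Qed.

Lemma complex_sum (I : Type) (r : seq I) (P : pred I) (F : I -> C) :
  \sum_(i <- r | P i) F i = Complex (\sum_(i <- r | P i) complex.Re (F i)) (\sum_(i <- r | P i) complex.Im (F i)).
Proof.
elim/big_rec3 : _ => [//|i a b c _ ->].
by case: (F i) => p q /=.
Qed.

(** For the complex field [e^(i n x)] the right-hand side is [- i (1 - cos (x - y))] times [rho]. It
    results from [conv_sum_identity] multiplied by conjugates:
    [(z - w) (z' - w') = 2 (1 - cos (x - y))], [(z - w)^2 z' w'] is its opposite, and
    [(z + w) (z' - w') = - 2 i sin (x - y)]. *)
Lemma rho_complex x y n :
  (Complex (2 * (1 - cos (x - y)) ^+ 2) 0) *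
    (\sum_(s < n) (s * (n - s))%:R * cis (s%:R * x + (n - s)%:R * y)) =
  - (n%:R * Complex (1 - cos (x - y)) 0 * (cis (n%:R * x) + cis (n%:R * y)) +
     Complex 0 (sin (x - y)) * (cis (n%:R * x) - cis (n%:R * y))).
Proof.
set c := 1 - cos (x - y); set z := cis x; set w := cis y.
have zz : z * cis (- x) = 1 by exact: cisN.
have ww : w * cis (- y) = 1 by exact: cisN.
have E := conv_sum_identity z w n.
rewrite (eq_bigr (fun s : 'I_n => (s * (n - s))%:R * (z ^+ s * w ^+ (n - s)))); last first.
  by move=> s _; rewrite !cisX -cisD.
rewrite -!cisX -/z -/w; set S := \sum_(_ < _) _.
have c2 : (z - w) * (cis (- x) - cis (- y)) = 2 * Complex c 0.
  rewrite mulrBl !mulrBr zz ww -!cisD /cis.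
  by rewrite -(opprB x y) cosN sinN /c !complexE; congr Complex; ring.
have s2 : (z + w) * (cis (- x) - cis (- y)) = - 2 * Complex 0 (sin (x - y)).
  rewrite mulrDl !mulrBr zz ww -!cisD /cis.
  by rewrite -(opprB x y) cosN sinN !complexE; congr Complex; ring.
move: (cis (- x)) (cis (- y)) zz ww c2 s2 => z' w' zz ww c2 s2.
rewrite (_ : Complex (2 * c ^+ 2) 0 = 2 * Complex c 0 ^+ 2); last first.
  by rewrite !expr2 !complexE; congr Complex; ring.
apply: (@mulfI _ 2); first by rewrite pnatr_eq0.
rewrite mulNr in s2.
have q : (z - w) ^+ 2 * (z' * w') = - (2 * Complex c 0).
  rewrite -c2 (_ : _ * _ = (z * z') * (z * w') + (w * w') * (w * z') - 2 * (z * z') * (w * w')); last by ring.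
  by rewrite zz ww mulrBl !mulrBr zz ww; ring.
transitivity (- ((z - w) ^+ 2 * (z' * w')) * ((z - w) * (z' - w')) * S).
  by rewrite q c2; ring.
rewrite (_ : _ * S = - (z' * w' * (z' - w')) * ((z - w) ^+ 3 * S)); last by ring.
rewrite E; transitivity (- ((z * z') * (w * w') * (n%:R * (z ^+ n + w ^+ n) * ((z - w) * (z' - w')) -
  (z + w) * (z' - w') * (z ^+ n - w ^+ n)))); first by ring.
by rewrite zz ww c2 s2; ring.
Qed.

Definition conv_cos n x y := \sum_(s < n) (s * (n - s))%:R * cos (s%:R * x + (n - s)%:R * y).
Definition conv_sin n x y := \sum_(s < n) (s * (n - s))%:R * sin (s%:R * x + (n - s)%:R * y).

Lemma rho_real x y n : cos (x - y) < 1 ->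
  2 * (1 - cos (x - y)) ^+ 2 * conv_cos n x y =
    - (n%:R * (1 - cos (x - y)) * (cos (n%:R * x) + cos (n%:R * y)) -
       sin (x - y) * (sin (n%:R * x) - sin (n%:R * y))) /\
  2 * (1 - cos (x - y)) ^+ 2 * conv_sin n x y =
    - (n%:R * (1 - cos (x - y)) * (sin (n%:R * x) + sin (n%:R * y)) +
       sin (x - y) * (cos (n%:R * x) - cos (n%:R * y))).
Proof.
move=> c1; have := rho_complex x y n.
rewrite (eq_bigr (fun s : 'I_n => Complex ((s * (n - s))%:R * cos (s%:R * x + (n - s)%:R * y))
  ((s * (n - s))%:R * sin (s%:R * x + (n - s)%:R * y)))); last first.
  by move=> s _; rewrite complex_natE /cis complex_mulE; congr Complex; ring.
rewrite complex_sum/= -/(conv_cos n x y) -/(conv_sin n x y) /cis !complexE => -[e1 e2].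
by split; [move: e1|move: e2]; rewrite !(mul0r, mulr0, subr0, add0r, addr0) => ->; ring.
Qed.

Lemma rho_cosM n x y : cos (x - y) < 1 ->
  rho (fun x => cos (n%:R * x)) (fun x => - (n%:R * sin (n%:R * x))) x y =
  - (2 * (1 - cos (x - y)) * conv_sin n x y).
Proof.
move=> c1; have c0 : 1 - cos (x - y) != 0 by rewrite subr_eq0 eq_sym lt_eqF.
have [_ e] := rho_real n c1; rewrite /rho; apply: (mulfI c0).
rewrite mulrN (_ : _ * (2 * _ * _) = 2 * (1 - cos (x - y)) ^+ 2 * conv_sin n x y); last by ring.
by rewrite e; field.
Qed.

Lemma rho_sinM n x y : cos (x - y) < 1 ->
  rho (fun x => sin (n%:R * x)) (fun x => n%:R * cos (n%:R * x)) x y =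
  2 * (1 - cos (x - y)) * conv_cos n x y.
Proof.
move=> c1; have c0 : 1 - cos (x - y) != 0 by rewrite subr_eq0 eq_sym lt_eqF.
have [e _] := rho_real n c1; rewrite /rho; apply: (mulfI c0).
rewrite (_ : _ * (2 * _ * _) = 2 * (1 - cos (x - y)) ^+ 2 * conv_cos n x y); last by ring.
by rewrite e; field.
Qed.

Definition conv_poly n (a b : nat -> R) x y :=
  \sum_(j < n) (b j * conv_cos j x y - a j * conv_sin j x y).

Lemma rho_trigpoly n (a b : nat -> R) x y : cos (x - y) < 1 ->
  rho (trigpoly n a b) (trigpoly n (fun j => j%:R * b j) (fun j => - (j%:R * a j))) x y =
  2 * (1 - cos (x - y)) * conv_poly n a b x y.
Proof.
move=> c1; have c0 : 1 - cos (x - y) != 0 by rewrite subr_eq0 eq_sym lt_eqF.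
elim: n => [|n IH].
  by rewrite /rho /conv_poly /trigpoly !big_ord0 !(subr0, mulr0, mul0r).
rewrite /conv_poly big_ord_recr/= -/(conv_poly n a b x y) mulrDr -{}IH /rho !trigpolyS.
have := rho_cosM n c1; have := rho_sinM n c1; rewrite /rho => ec es.
rewrite (_ : 2 * (1 - cos (x - y)) * (b n * _ - a n * _) =
  b n * (2 * (1 - cos (x - y)) * conv_cos n x y) +
  a n * - (2 * (1 - cos (x - y)) * conv_sin n x y)); last by ring.
by rewrite -ec -es; field.
Qed.

End TrigonometricIdentity.

(** * Pairing the energy density with trigonometric polynomials *)

Section ProductIntegrals.
Context {R : realType}.
Implicit Types (x y h t : R) (f g u : R -> R).
Local Notation T := ((pi : R) *+ 2).
Local Notation Rm := (measurableTypeR R).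
Implicit Types (F G : Rm * Rm -> R).

(** Integrability and value travel together, so that an expansion into products of one-variable
    functions is integrated term by term. *)
Definition has_integral2 F v :=
  circ2.-integrable setT (EFin \o F) /\ \int[circ2]_z F z = v.

Lemma has_integral2D F G v w : has_integral2 F v -> has_integral2 G w ->
  has_integral2 (fun z => F z + G z) (v + w).
Proof.
move=> [iF vF] [iG wG]; split; first by apply: eq_integrable (integrableD measurableT iF iG).
by rewrite (RintegralD measurableT iF iG) vF wG.
Qed.

Lemma has_integral2Z c F v : has_integral2 F v -> has_integral2 (fun z => c * F z) (c * v).
Proof.
move=> [iF vF]; split; first by apply: eq_integrable (integrableZl measurableT c iF).
by rewrite RintegralZl// vF.
Qed.

Lemma has_integral2_0 : has_integral2 (fun=> 0) 0.
Proof.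
split; first exact: integrable0.
by rewrite Rintegral_cst// mul0r.
Qed.

Lemma has_integral2_sum n (F : nat -> Rm * Rm -> R) v :
  (forall i, (i < n)%N -> has_integral2 (F i) (v i)) ->
  has_integral2 (fun z => \sum_(i < n) F i z) (\sum_(i < n) v i).
Proof.
elim: n => [|n IH] h.
  rewrite big_ord0 (_ : (fun z => _) = fun=> 0); first exact: has_integral2_0.
  by apply/funext => z; rewrite big_ord0.
rewrite big_ord_recr/= (_ : (fun z => _) = fun z => \sum_(i < n) F i z + F n z).
  by apply: has_integral2D; [apply: IH => i /ltnW ni; apply: h|exact: h].
by apply/funext => z; rewrite big_ord_recr.
Qed.

Lemma has_integral2_prod f g : L1 f -> L1 g ->
  has_integral2 (fun z => f z.1 * g z.2) (Ic f * Ic g).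
Proof.
move=> f1 g1.
have mF : measurable_fun setT (fun z : Rm * Rm => (f z.1 * g z.2)%:E).
  apply/measurable_EFinP; apply: measurable_funM.
    exact: measurableT_comp (L1_measurable f1) measurable_fst.
  exact: measurableT_comp (L1_measurable g1) measurable_snd.
have iF : circ2.-integrable setT (fun z : Rm * Rm => (f z.1 * g z.2)%:E).
  apply/(@integrable12ltyP _ _ _ _ _ circ circ _ mF).
  rewrite (_ : (\int[_]_x _)%E = (\int[circ]_x (`|f x| * Ic (fun y => `|g y|))%:E)%E).
    rewrite -EFin_Ic; first by rewrite ltry.
    by apply: eq_L1 (L1Z (Ic (fun y => `|g y|)) (L1_norm f1)) => x; rewrite mulrC.
  apply: eq_integral => x _; rewrite -IcZ; last exact: L1_norm.
  rewrite EFin_Ic; last by apply: L1Z; exact: L1_norm.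
  by apply: eq_integral => y _; rewrite /= normrM.
split=> //; rewrite /Rintegral -(integral12_prod_meas1 iF).
rewrite (_ : (\int[_]_x _)%E = (\int[circ]_x (f x * Ic g)%:E)%E).
  by rewrite -EFin_Ic ?IcZr//; apply: eq_L1 (L1Z (Ic g) f1) => x; rewrite mulrC.
apply: eq_integral => x _; rewrite /fubini_F -IcZ// EFin_Ic//; exact: L1Z.
Qed.

Lemma eq_has_integral2 F G v w : has_integral2 F v -> (forall z, F z = G z) -> v = w ->
  has_integral2 G w.
Proof. by move=> FI /funext <- <-. Qed.

(** The terms with [u z.1 ^+ 2] or [u z.2 ^+ 2] leave, in the other variable, the mean of a mode of
    positive frequency, which is zero. Only the cross term survives. *)
Lemma energy_pairing_mode u s r : (0 < s)%N -> (0 < r)%N -> L2 u ->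
  has_integral2 (fun z => (u z.1 - u z.2) ^+ 2 * cos (s%:R * z.1 + r%:R * z.2))
    (- 2 * (acoef u s * acoef u r - bcoef u s * bcoef u r)) /\
  has_integral2 (fun z => (u z.1 - u z.2) ^+ 2 * sin (s%:R * z.1 + r%:R * z.2))
    (- 2 * (acoef u s * bcoef u r + bcoef u s * acoef u r)).
Proof.
move=> s0 r0 u2; have u1 := L2_L1 u2.
have L1c k : L1 (fun x => cos (k%:R * x)) by apply: continuous_L1; exact: continuous_cosM.
have L1s k : L1 (fun x => sin (k%:R * x)) by apply: continuous_L1; exact: continuous_sinM.
have uuc k : L1 (fun x => u x ^+ 2 * cos (k%:R * x)) by apply: L1_mul_cos; exact: u2.2.
have uus k : L1 (fun x => u x ^+ 2 * sin (k%:R * x)) by apply: L1_mul_sin; exact: u2.2.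
have uc k : L1 (fun x => u x * cos (k%:R * x)) by exact: L1_mul_cos.
have us k : L1 (fun x => u x * sin (k%:R * x)) by exact: L1_mul_sin.
have Ic0 k : (0 < k)%N -> Ic (fun x : R => cos (k%:R * x)) = 0.
  move=> k0; have := @Ic_cosz R k; rewrite -pmulrn.
  by case: k k0.
have Is0 k : Ic (fun x : R => sin (k%:R * x)) = 0 by exact: (@Ic_sinz R k).
split.
  have I1 := has_integral2_prod (uuc s) (L1c r).
  have I2 := has_integral2_prod (uus s) (L1s r).
  have I3 := has_integral2_prod (uc s) (uc r).
  have I4 := has_integral2_prod (us s) (us r).
  have I5 := has_integral2_prod (L1c s) (uuc r).
  have I6 := has_integral2_prod (L1s s) (uus r).
  have I12 := has_integral2D I1 (has_integral2Z (-1) I2).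
  have I34 := has_integral2D (has_integral2Z (- 2) I3) (has_integral2Z 2 I4).
  have I56 := has_integral2D I5 (has_integral2Z (-1) I6).
  apply: eq_has_integral2 (has_integral2D I12 (has_integral2D I34 I56)) _ _.
    by move=> z; rewrite cosD; ring.
  by rewrite !Ic0// !Is0 /acoef /bcoef; ring.
have I1 := has_integral2_prod (uuc s) (L1s r).
have I2 := has_integral2_prod (uus s) (L1c r).
have I3 := has_integral2_prod (uc s) (us r).
have I4 := has_integral2_prod (us s) (uc r).
have I5 := has_integral2_prod (L1c s) (uus r).
have I6 := has_integral2_prod (L1s s) (uuc r).
have I12 := has_integral2D I1 I2.
have I34 := has_integral2D (has_integral2Z (- 2) I3) (has_integral2Z (- 2) I4).
have I56 := has_integral2D I5 I6.
apply: eq_has_integral2 (has_integral2D I12 (has_integral2D I34 I56)) _ _.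
  by move=> z; rewrite sinD; ring.
by rewrite !Ic0// !Is0 /acoef /bcoef; ring.
Qed.

(* Up to the factor (2 pi)^2, real and minus the imaginary part of the k-th Fourier
   coefficient of the Hopf differential of a scalar function. *)
Definition hopf_re u k : R := \sum_(s < k) (s * (k - s))%:R *
  (acoef u s * acoef u (k - s) - bcoef u s * bcoef u (k - s)).
Definition hopf_im u k : R := \sum_(s < k) (s * (k - s))%:R *
  (acoef u s * bcoef u (k - s) + bcoef u s * acoef u (k - s)).

Lemma energy_pairing_conv u n : L2 u ->
  has_integral2 (fun z => (u z.1 - u z.2) ^+ 2 * conv_cos n z.1 z.2) (- 2 * hopf_re u n) /\
  has_integral2 (fun z => (u z.1 - u z.2) ^+ 2 * conv_sin n z.1 z.2) (- 2 * hopf_im u n).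
Proof.
move=> u2; split.
  apply: (@eq_has_integral2 (fun z => \sum_(s < n) (s * (n - s))%:R *
      ((u z.1 - u z.2) ^+ 2 * cos (s%:R * z.1 + (n - s)%:R * z.2))) _
    (\sum_(s < n) (s * (n - s))%:R *
      (- 2 * (acoef u s * acoef u (n - s) - bcoef u s * bcoef u (n - s))))).
  - apply: (@has_integral2_sum n (fun s z => (s * (n - s))%:R *
      ((u z.1 - u z.2) ^+ 2 * cos (s%:R * z.1 + (n - s)%:R * z.2)))
      (fun s => (s * (n - s))%:R *
      (- 2 * (acoef u s * acoef u (n - s) - bcoef u s * bcoef u (n - s))))).
    (* The pair of frequencies [(0, n)] is outside [energy_pairing_mode], but its weight is zero. *)
    case=> [_|s sn].
      apply: eq_has_integral2 has_integral2_0 _ _; last by rewrite mul0r.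
      by move=> z; rewrite mul0r.
    by apply: has_integral2Z; apply: (energy_pairing_mode _ _ u2).1; rewrite ?subn_gt0.
  - by move=> z; rewrite /conv_cos mulr_sumr; apply: eq_bigr => s _; ring.
  - by rewrite /hopf_re mulr_sumr; apply: eq_bigr => s _; ring.
apply: (@eq_has_integral2 (fun z => \sum_(s < n) (s * (n - s))%:R *
    ((u z.1 - u z.2) ^+ 2 * sin (s%:R * z.1 + (n - s)%:R * z.2))) _
  (\sum_(s < n) (s * (n - s))%:R *
    (- 2 * (acoef u s * bcoef u (n - s) + bcoef u s * acoef u (n - s))))).
- apply: (@has_integral2_sum n (fun s z => (s * (n - s))%:R *
    ((u z.1 - u z.2) ^+ 2 * sin (s%:R * z.1 + (n - s)%:R * z.2)))
    (fun s => (s * (n - s))%:R *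
    (- 2 * (acoef u s * bcoef u (n - s) + bcoef u s * acoef u (n - s))))).
  case=> [_|s sn].
    apply: eq_has_integral2 has_integral2_0 _ _; last by rewrite mul0r.
    by move=> z; rewrite mul0r.
  by apply: has_integral2Z; apply: (energy_pairing_mode _ _ u2).2; rewrite ?subn_gt0.
- by move=> z; rewrite /conv_sin mulr_sumr; apply: eq_bigr => s _; ring.
- by rewrite /hopf_im mulr_sumr; apply: eq_bigr => s _; ring.
Qed.

(** By [rho_trigpoly] this equals [rho] of the trigonometric polynomial off the diagonal; in
    contrast with [rho], it extends smoothly across it. *)
Definition hopf_kernel n (a b : nat -> R) x y := 2 * (1 - cos (x - y)) * conv_poly n a b x y.

Lemma energy_density_hopf_kernel u n a b x y : periodic u T ->
  energy_density u x y * hopf_kernel n a b x y = (u x - u y) ^+ 2 * conv_poly n a b x y.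
Proof.
move=> uT; have [c1|[z xy]] := cos_lt1P (x - y); last first.
  rewrite (energy_density_diag uT xy) mul0r -(periodicz uT z y) (_ : y + _ = x).
    by rewrite subrr expr0n mul0r.
  by rewrite -xy addrC subrK.
rewrite /energy_density /hopf_kernel /kern; field.
by rewrite subr_eq0 eq_sym lt_eqF.
Qed.

Lemma energy_pairing_hopf_kernel u n a b : L2 u -> periodic u T ->
  energy_pairing u (hopf_kernel n a b) =
  - 2 * \sum_(j < n) (b j * hopf_re u j - a j * hopf_im u j).
Proof.
move=> u2 uT.
apply: (@eq_has_integral2 (fun z => \sum_(j < n) (b j * ((u z.1 - u z.2) ^+ 2 * conv_cos j z.1 z.2)
   + (- a j) * ((u z.1 - u z.2) ^+ 2 * conv_sin j z.1 z.2))) _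
   (\sum_(j < n) (b j * (- 2 * hopf_re u j) + (- a j) * (- 2 * hopf_im u j))) _ _ _ _).2.
- apply: (@has_integral2_sum n (fun j z => b j * ((u z.1 - u z.2) ^+ 2 * conv_cos j z.1 z.2)
   + (- a j) * ((u z.1 - u z.2) ^+ 2 * conv_sin j z.1 z.2))
   (fun j => b j * (- 2 * hopf_re u j) + (- a j) * (- 2 * hopf_im u j))).
  move=> j _; have [h1 h2] := energy_pairing_conv j u2.
  by apply: has_integral2D; exact: has_integral2Z.
- move=> z; rewrite energy_density_hopf_kernel// /conv_poly mulr_sumr.
  by apply: eq_bigr => j _; ring.
- by rewrite mulr_sumr; apply: eq_bigr => j _; ring.
Qed.

End ProductIntegrals.

(** * Bounded Lipschitz kernels on the torus *)

Section RegularKernels.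
Context {R : realType}.
Implicit Types (x y h t : R) (F G : R -> R -> R).
Local Notation T := ((pi : R) *+ 2).
Local Notation Rm := (measurableTypeR R).

(** The regularity that [gagliardo_deformation] asks of [Phi], in a form stable under sums and
    products, so that trigonometric polynomials inherit it from single modes. *)
Definition regular_kernel F :=
  [/\ measurable_fun setT (fun z : Rm * Rm => F z.1 z.2),
      (forall x y, F (x + T) y = F x y), (forall x y, F x (y + T) = F x y),
      (exists C0, forall x y, `|F x y| <= C0) &
      (exists C1, forall x y x' y', `|F x y - F x' y'| <= C1 * (`|x - x'| + `|y - y'|))].

Lemma regular_kernelD F G : regular_kernel F -> regular_kernel G ->
  regular_kernel (fun x y => F x y + G x y).
Proof.
move=> [mF F1 F2 [M FM] [L FL]] [mG G1 G2 [N GN] [K GK]]; split.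
- exact: measurable_funD.
- by move=> x y; rewrite F1 G1.
- by move=> x y; rewrite F2 G2.
- by exists (M + N) => x y; rewrite (le_trans (ler_normD _ _))// lerD.
- exists (L + K) => x y x' y'; rewrite opprD addrACA (le_trans (ler_normD _ _))//.
  by rewrite mulrDl lerD.
Qed.

Lemma regular_kernelM F G : regular_kernel F -> regular_kernel G ->
  regular_kernel (fun x y => F x y * G x y).
Proof.
move=> [mF F1 F2 [M FM] [L FL]] [mG G1 G2 [N GN] [K GK]]; split.
- exact: measurable_funM.
- by move=> x y; rewrite F1 G1.
- by move=> x y; rewrite F2 G2.
- by exists (M * N) => x y; rewrite normrM ler_pM.
- exists (M * K + N * L) => x y x' y'.
  rewrite (_ : _ - _ = F x y * (G x y - G x' y') + G x' y' * (F x y - F x' y')); last by ring.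
  rewrite (le_trans (ler_normD _ _))// mulrDl -!mulrA.
  by rewrite lerD// normrM ler_pM.
Qed.

Lemma regular_kernel_cst c : regular_kernel (fun _ _ => c).
Proof.
split=> //; first by exists `|c|.
by exists 0 => x y x' y'; rewrite subrr normr0 mul0r.
Qed.

Lemma regular_kernel_sum n (F : nat -> R -> R -> R) : (forall i, regular_kernel (F i)) ->
  regular_kernel (fun x y => \sum_(i < n) F i x y).
Proof.
move=> FF; elim: n => [|n IH].
  rewrite (_ : (fun x y => _) = fun _ _ => 0); first exact: regular_kernel_cst.
  by apply/funext => x; apply/funext => y; rewrite big_ord0.
rewrite (_ : (fun x y => _) = fun x y => \sum_(i < n) F i x y + F n x y).
  exact: regular_kernelD.
by apply/funext => x; apply/funext => y; rewrite big_ord_recr.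
Qed.

Lemma cos_lipschitz x y : `|cos x - cos y| <= `|x - y|.
Proof.
pose p := (x + y) / 2; pose q := (x - y) / 2.
have -> : x = p + q by rewrite /p /q; field.
have -> : y = p - q by rewrite /p /q; field.
clearbody p q.
rewrite (_ : p + q - (p - q) = 2 * q); last by ring.
rewrite cosB cosD (_ : _ - _ = - 2 * sin p * sin q); last by ring.
rewrite !normrM normrN [`|2|]ger0_norm// -mulrA ler_wpM2l// -[leRHS]mul1r.
by rewrite ler_pM// ?sin_le_norm// ler_norml sin_geN1 sin_le1.
Qed.

(** Signed frequencies cover [cos (x - y)], and the phase [c = - pi / 2] covers sine. *)
Lemma regular_kernel_cos (s r : int) c : regular_kernel (fun x y => cos (s%:~R * x + r%:~R * y + c)).
Proof.
split.
- apply: measurableT_comp (continuous_measurable (@continuous_cos R)) _.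
  apply: measurable_funD => //; apply: measurable_funD; exact: measurable_funM.
- move=> x y; rewrite -[RHS](cosDz s); congr cos; ring.
- move=> x y; rewrite -[RHS](cosDz r); congr cos; ring.
- by exists 1 => x y; rewrite ler_norml cos_geN1 cos_le1.
- exists (`|s%:~R| + `|r%:~R|) => x y x' y'; rewrite (le_trans (cos_lipschitz _ _))//.
  rewrite (_ : _ - _ = s%:~R * (x - x') + r%:~R * (y - y')); last by ring.
  rewrite (le_trans (ler_normD _ _))// !normrM mulrDr !mulrDl.
  by rewrite lerD// ?lerDl ?lerDr mulr_ge0.
Qed.

Lemma regular_hopf_kernel n a b : regular_kernel (hopf_kernel n a b).
Proof.
have rc s r : regular_kernel (fun x y => cos (s%:R * x + r%:R * y)).
  have := regular_kernel_cos (Posz s) (Posz r) 0.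
  by congr regular_kernel; apply/funext => x; apply/funext => y; rewrite addr0.
have rs s r : regular_kernel (fun x y => sin (s%:R * x + r%:R * y)).
  have := regular_kernel_cos (Posz s) (Posz r) (- (pi / 2)).
  by congr regular_kernel; apply/funext => x; apply/funext => y; rewrite cosBpihalf.
apply: (@regular_kernelM (fun x y => 2 * (1 - cos (x - y))) (conv_poly n a b)).
  apply: regular_kernelM; first exact: regular_kernel_cst.
  apply: regular_kernelD; first exact: regular_kernel_cst.
  have := regular_kernelM (regular_kernel_cst (-1)) (regular_kernel_cos 1 (-1) 0).
  by congr regular_kernel; apply/funext => x; apply/funext => y; rewrite mulN1r mul1r mulN1r addr0.
apply: (@regular_kernel_sum n (fun j x y => b j * conv_cos j x y - a j * conv_sin j x y)) => j.
apply: regular_kernelD.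
  apply: regular_kernelM; first exact: regular_kernel_cst.
  apply: (@regular_kernel_sum j (fun s x y => (s * (j - s))%:R * cos (s%:R * x + (j - s)%:R * y))) => s.
  by apply: regular_kernelM => //; exact: regular_kernel_cst.
under eq_fun do under eq_fun do rewrite -mulNr.
apply: regular_kernelM; first exact: regular_kernel_cst.
apply: (@regular_kernel_sum j (fun s x y => (s * (j - s))%:R * sin (s%:R * x + (j - s)%:R * y))) => s.
by apply: regular_kernelM => //; exact: regular_kernel_cst.
Qed.

End RegularKernels.

(** * Differentiating the energy along a vector field *)

Section EnergyDerivative.
Context {R : realType}.
Implicit Types (x y h t : R) (f u : R -> R).
Local Notation T := ((pi : R) *+ 2).
Local Notation Rm := (measurableTypeR R).

Lemma is_derive0_linear_approx (F : R -> R) D :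
  (forall e, 0 < e -> \forall t \near (0 : R), `|F t - (F 0 + t * D)| <= e * `|t|) ->
  is_derive (0 : R) (1 : R) F D.
Proof.
move=> FD.
have cF : (fun h => h^-1 *: ((F \o shift 0) (h *: (1 : R)) - F 0)) @ (0 : R)^' --> D.
  apply/cvgrPdist_le => e e0.
  near=> t; have t0 : t != 0 by near: t; exact: nbhs_dnbhs_neq.
  rewrite /= addr0 /GRing.scale/= mulr1.
  rewrite (_ : _ - _ = - (t^-1 * (F t - (F 0 + t * D)))); last by field.
  rewrite normrN normrM normfV ler_pdivrMl ?normr_gt0// [leRHS]mulrC.
  by near: t; apply: nbhs_dnbhs; exact: FD.
have dF : derivable F 0 1 by apply/cvg_ex; exists D.
by apply: DeriveDef => //; apply/cvg_lim.
Unshelve. all: by end_near.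
Qed.

(** The part of the error that is quadratic in [t] is absorbed, for small [t], by the gap between
    [eta] and [eta']. *)
Lemma near_deformation u (X p : R -> R) (Phi : R -> R -> R) (eta eta' : R) :
  L2 u -> periodic u T -> (gagliardo u < +oo)%E ->
  (forall x, is_derive x (1 : R) X (p x)) -> continuous p -> periodic X T -> periodic p T ->
  regular_kernel Phi -> (forall x y, cos (x - y) < 1 -> `|rho X p x y - Phi x y| <= eta) ->
  eta < eta' ->
  \forall t \near (0 : R), (gagliardo (fun x => u (x + t * X x)%R) < +oo)%E /\
   `|fine (gagliardo (fun x => u (x + t * X x))) - (fine (gagliardo u) + t * energy_pairing u Phi)|
    <= 2 * eta' * `|t| * fine (gagliardo u).
Proof.
move=> u2 uT uoo dX cp XT pT [mPhi P1 P2 [C0 PC] [C1 PL]] re ee.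
have [M1 XM] := periodic_continuous_bounded (is_derive_continuous dX) XT.
have [M2 pM] := periodic_continuous_bounded cp pT.
pose M := Num.max M1 M2.
have {}XM x : `|X x| <= M by rewrite le_max XM.
have {}pM x : `|p x| <= M by rewrite le_max pM orbT.
have M0 : 0 <= M by rewrite (le_trans _ (XM 0)).
have C10 : 0 <= C1.
  have := PL 0 0 1 0; rewrite subrr normr0 addr0 sub0r normrN1 mulr1.
  exact: le_trans.
have C00 : 0 <= C0 by rewrite (le_trans _ (PC 0 0)).
have eta0 : 0 <= eta.
  by rewrite (le_trans _ (re pi 0 _))// subr0 cospi; lra.
set K := 2 * (16 * M ^+ 2 + 2 * C1 * M + M ^+ 2 + 3 * C0 * M).
have K0 : 0 <= K.
  apply: mulr_ge0 => //; do 3?[apply: addr_ge0; last by rewrite ?sqr_ge0// !mulr_ge0].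
  by rewrite mulr_ge0// sqr_ge0.
(* One bound on [t] by the inverse of this sum meets both smallness conditions of
   [gagliardo_deformation], given [t ^+ 2 <= |t|]. *)
have S0 : 0 < 4 * M + C0 + 2 * eta + K + 1 by lra.
near=> t.
have t1 : `|t| * (4 * M + C0 + 2 * eta + K + 1) <= 1.
  rewrite -ler_pdivlMr// ltW//.
  by near: t; apply: (@nbhs0_lt R R); rewrite div1r invr_gt0.
have t2 : `|t| * (K + 1) <= 2 * (eta' - eta).
  rewrite -ler_pdivlMr ?ltr_wpDl// ltW//.
  by near: t; apply: (@nbhs0_lt R R); rewrite divr_gt0 ?ltr_wpDl// mulr_gt0// subr_gt0.
have t3 : `|t| <= 1 by near: t; apply: (@nbhs0_le R R).
have tt : t ^+ 2 <= `|t| by rewrite -(real_normK (num_real t)) expr2 ler_piMr.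
have tM : `|t| * M <= 4^-1.
  have := normr_ge0 t; clearbody K; nra.
have te : `|t| * C0 + (2 * eta * `|t| + K * t ^+ 2) <= 1.
  have h1 : K * t ^+ 2 <= K * `|t| by rewrite ler_wpM2l.
  have h2 : 0 <= `|t| * M by rewrite mulr_ge0.
  by have h3 := normr_ge0 t; clearbody K; lra.
have [g1 g2] := gagliardo_deformation u2 uT uoo dX cp XT XM pM mPhi P1 P2 PC PL re tM te.
split=> //; apply: (le_trans g2); rewrite ler_wpM2r//.
  exact/fine_ge0/gagliardo_ge0.
rewrite -/K (@le_trans _ _ (2 * eta * `|t| + `|t| * (K * `|t|)))//.
  by rewrite lerD2l -(real_normK (num_real t)) expr2 mulrCA.
have : `|t| * (K * `|t|) <= `|t| * (2 * (eta' - eta)).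
  rewrite ler_wpM2l// mulrC (le_trans _ t2)// mulrDr mulr1 lerDl//.
by clearbody K; lra.
Unshelve. all: by end_near.
Qed.

Context {m : nat}.
Implicit Types (v : 'I_m -> R -> R).

Definition gagliardo_sum v (X : R -> R) t : R :=
  \sum_(j < m) fine (gagliardo (fun x => v j (x + t * X x))).

(** The pairing with [Phi] is to equal [D] exactly for every [eta], so that no limit of pairings is
    taken. This covers fields for which [Phi] represents [rho] off the diagonal, and fields
    approximated by such ones with vanishing first variation. Finiteness near 0 is recorded to
    justify [half_energyE] later. *)
Lemma is_derive_gagliardo_sum v (X p : R -> R) D :
  (forall j, [/\ L2 (v j), periodic (v j) T & (gagliardo (v j) < +oo)%E]) ->
  (forall x, is_derive x (1 : R) X (p x)) -> continuous p -> periodic X T -> periodic p T ->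
  (forall eta, 0 < eta -> exists Phi, [/\ regular_kernel Phi,
    forall x y, cos (x - y) < 1 -> `|rho X p x y - Phi x y| <= eta &
    \sum_(j < m) energy_pairing (v j) Phi = D]) ->
  is_derive (0 : R) (1 : R) (gagliardo_sum v X) D /\
  \forall t \near (0 : R), forall j, (gagliardo (fun x => v j (x + t * X x)%R) < +oo)%E.
Proof.
move=> vP dX cp XT pT HPhi.
have v0 j : (fun x => v j (x + 0 * X x)) = v j by apply/funext => x; rewrite mul0r addr0.
have G0 j : 0 <= fine (gagliardo (v j)) by exact/fine_ge0/gagliardo_ge0.
split; last first.
  have [Phi [rPhi Pe _]] := HPhi 1 ltr01.
  suff H j : \forall t \near (0 : R), (gagliardo (fun x => v j (x + t * X x)%R) < +oo)%E.
    exact: (filter_forall _ H).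
  have [v2 vT voo] := vP j; have one2 : (1 : R) < 2 by rewrite ltr1n.
  have := near_deformation v2 vT voo dX cp XT pT rPhi Pe one2.
  by apply: filterS => t [].
apply: is_derive0_linear_approx => e e0.
pose S := \sum_(j < m) fine (gagliardo (v j)).
have S0 : 0 <= S by exact: sumr_ge0.
(* With [eta' = 2 * eta], the errors add up to [4 * eta * S * |t|], which is at most [e * |t|]; the
   added 1 covers [S = 0]. *)
pose eta := e / (4 * (S + 1)).
have S1 : 0 < S + 1 by rewrite ltr_wpDl.
have eta0 : 0 < eta by rewrite divr_gt0// mulr_gt0.
have [Phi [rPhi Pe <-]] := HPhi eta eta0.
have Hj j : \forall t \near (0 : R),
   `|fine (gagliardo (fun x => v j (x + t * X x))) - (fine (gagliardo (v j)) + t * energy_pairing (v j) Phi)|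
    <= 2 * (2 * eta) * `|t| * fine (gagliardo (v j)).
  have [v2 vT voo] := vP j; have ee : eta < 2 * eta by rewrite ltr_pMl// ltr1n.
  have := near_deformation v2 vT voo dX cp XT pT rPhi Pe ee.
  by apply: filterS => t [].
near=> t.
have Ht : forall j,
   `|fine (gagliardo (fun x => v j (x + t * X x))) - (fine (gagliardo (v j)) + t * energy_pairing (v j) Phi)|
    <= 2 * (2 * eta) * `|t| * fine (gagliardo (v j)).
  by near: t; exact: filter_forall.
rewrite (_ : gagliardo_sum v X 0 = S); last by apply: eq_bigr => j _; rewrite v0.
rewrite (_ : _ - _ = \sum_(j < m) (fine (gagliardo (fun x => v j (x + t * X x))) -
  (fine (gagliardo (v j)) + t * energy_pairing (v j) Phi))); last first.
  by rewrite sumrB big_split mulr_sumr.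
apply: le_trans (ler_norm_sum _ _ _) _.
apply: le_trans (ler_sum _ (fun j _ => Ht j)) _; rewrite -mulr_sumr -/S mulrAC ler_wpM2r//.
rewrite (_ : _ * S = e * (S / (S + 1))); last by rewrite /eta; field; rewrite gt_eqF.
by rewrite ler_piMr ?(ltW e0)// ler_pdivrMr// mul1r lerDl.
Unshelve. all: by end_near.
Qed.

Lemma is_derive_gagliardo_sum_trigpoly v n a b :
  (forall j, [/\ L2 (v j), periodic (v j) T & (gagliardo (v j) < +oo)%E]) ->
  is_derive (0 : R) (1 : R) (gagliardo_sum v (trigpoly n a b))
    (- 2 * \sum_(i < n) (b i * (\sum_(j < m) hopf_re (v j) i) -
                        a i * (\sum_(j < m) hopf_im (v j) i))) /\
  \forall t \near (0 : R), forall j, (gagliardo (fun x => v j (x + t * trigpoly n a b x)%R) < +oo)%E.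
Proof.
move=> vP; apply: (is_derive_gagliardo_sum vP (is_derive_trigpoly n a b)).
- exact: trigpoly_continuous.
- exact: trigpoly_periodic.
- exact: trigpoly_periodic.
move=> eta eta0; exists (hopf_kernel n a b); split; first exact: regular_hopf_kernel.
  by move=> x y c1; rewrite rho_trigpoly// subrr normr0 ltW.
rewrite (eq_bigr (fun j => - 2 * \sum_(i < n) (b i * hopf_re (v j) i - a i * hopf_im (v j) i))).
  rewrite -mulr_sumr exchange_big/=; congr (_ * _); apply: eq_bigr => i _.
  by rewrite sumrB !mulr_sumr.
by move=> j _; have [v2 vT _] := vP j; exact: energy_pairing_hopf_kernel.
Qed.

(* [X] is approximated in C^1 by its Fejer means, for which the first variation vanishes;
   [rho_le] controls the error by the uniform distance between the derivatives. *)
Lemma is_derive_gagliardo_sum0 v (X p : R -> R) :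
  (forall j, [/\ L2 (v j), periodic (v j) T & (gagliardo (v j) < +oo)%E]) ->
  (forall x, is_derive x (1 : R) X (p x)) -> continuous p -> periodic X T -> periodic p T ->
  (forall k, \sum_(j < m) hopf_re (v j) k = 0) -> (forall k, \sum_(j < m) hopf_im (v j) k = 0) ->
  is_derive (0 : R) (1 : R) (gagliardo_sum v X) 0 /\
  \forall t \near (0 : R), forall j, (gagliardo (fun x => v j (x + t * X x)%R) < +oo)%E.
Proof.
move=> vP dX cp XT pT re0 im0; apply: (is_derive_gagliardo_sum vP dX cp XT pT) => //.
move=> eta eta0.
(* The divisor is the constant of [rho_le], applied to [X] minus its Fejer mean. *)
have eta6 : 0 < eta / 6 by rewrite divr_gt0.
have L1p := continuous_L1 cp.
have L1X := continuous_L1 (is_derive_continuous dX).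
have [N HN] := cvg_fejer L1p (continuous_circle_regular cp pT) eta6.
have {}HN := HN N.+1 (leqnSn N) isT.
pose a j := (N.+1%:R * T)^-1 * fejer_weight N.+1 j * acoef X j.
pose b j := (N.+1%:R * T)^-1 * fejer_weight N.+1 j * bcoef X j.
have XE : fejer N.+1 X = trigpoly N.+1 a b by apply/funext => y; rewrite fejerE.
have pE : fejer N.+1 p = trigpoly N.+1 (fun j => j%:R * b j) (fun j => - (j%:R * a j)).
  apply/funext => y; rewrite fejerE//; apply: eq_bigr => j _.
  by rewrite (acoef_derive _ dX)// (bcoef_derive _ dX)// /a /b; ring.
exists (hopf_kernel N.+1 a b); split; first exact: regular_hopf_kernel.
  move=> x y c1; rewrite -[X in _ - X]rho_trigpoly// -XE -pE rhoB.
  rewrite (_ : eta = 6 * (eta / 6)); last by field.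
  apply: (rho_le _ _ _ c1).
  - by move=> z; apply: is_deriveB (dX z) (is_derive_fejer _ _ dX cp XT).
  - by move=> z; rewrite XT XE trigpoly_periodic.
  - by move=> z; rewrite distrC.
rewrite (eq_bigr (fun j => - 2 * \sum_(i < N.+1) (b i * hopf_re (v j) i - a i * hopf_im (v j) i))).
  rewrite -mulr_sumr exchange_big/= big1 ?mulr0// => i _.
  by rewrite sumrB -!mulr_sumr re0 im0 !mulr0 subrr.
by move=> j _; have [v2 vT _] := vP j; exact: energy_pairing_hopf_kernel.
Qed.

End EnergyDerivative.

(** * Distributions on the circle *)

Section SmoothFunctions.
Context {R : realType}.
Implicit Types (x y t : R) (f g h : R -> R).
Local Notation T := ((pi : R) *+ 2).
Local Notation C := (complex R).

Lemma derivable_is_derive1 f x : derivable f x 1 -> is_derive x (1 : R) f (derive1 f x).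
Proof. by move=> /derivableP; rewrite derive1E. Qed.

Lemma is_derive1_val f x d : is_derive x (1 : R) f d -> derive1 f x = d.
Proof. by move=> df; rewrite derive1E; exact: derive_val. Qed.

Lemma derivable_continuous f : (forall x, derivable f x 1) -> continuous f.
Proof. by move=> df; apply: is_derive_continuous => x; exact/derivable_is_derive1/df. Qed.

Lemma derive1_periodic f : periodic f T -> periodic (derive1 f) T.
Proof.
move=> fT x; rewrite /derive1.
suff -> : (fun k => k^-1 *: (f (k + (x + T)) - f (x + T))) = fun k => k^-1 *: (f (k + x) - f x) by [].
by apply/funext => k; rewrite addrA !fT.
Qed.

Lemma derive1n_periodic n f : periodic f T -> periodic (derive1n n f) T.
Proof. by move=> fT; elim: n => // n IH; rewrite derive1nS; exact: derive1_periodic. Qed.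

Lemma smooth_is_derive f n x : smooth f ->
  is_derive x (1 : R) (derive1n n f) (derive1n n.+1 f x).
Proof. by move=> sf; rewrite derive1nS; exact/derivable_is_derive1/sf. Qed.

Lemma smooth_continuous f n : smooth f -> continuous (derive1n n f).
Proof. by move=> sf; apply: derivable_continuous; exact: sf. Qed.

(** An explicit sequence of candidate derivatives proves smoothness and identifies all [derive1n] at
    once. *)
Lemma smoothP f (d : nat -> R -> R) : d 0%N = f ->
  (forall n x, is_derive x (1 : R) (d n) (d n.+1 x)) -> smooth f /\ forall n, derive1n n f = d n.
Proof.
move=> d0 dd; have E n : derive1n n f = d n.
  elim: n => [|n IH]; first by rewrite derive1n0.
  by rewrite derive1nS IH; apply/funext => x; exact: is_derive1_val.
by split=> // n x; rewrite E; case: (dd n x).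
Qed.

Lemma smooth_lincomb f g h (p q : R) : smooth f -> smooth g -> smooth h ->
  smooth (fun x => p * f x + q * g x + h x) /\
  forall n, derive1n n (fun x => p * f x + q * g x + h x) =
    fun x => p * derive1n n f x + q * derive1n n g x + derive1n n h x.
Proof.
move=> sf sg sh; apply: (@smoothP _
  (fun n x => p * derive1n n f x + q * derive1n n g x + derive1n n h x)) => [//|n x].
exact: (is_deriveD (is_deriveD (is_deriveZ p (smooth_is_derive n x sf))
  (is_deriveZ q (smooth_is_derive n x sg))) (smooth_is_derive n x sh)).
Qed.

Lemma smooth_wave (k c s : R) :
  smooth (fun x => c * cos (k * x) + s * sin (k * x)) /\
  derive1n 2 (fun x => c * cos (k * x) + s * sin (k * x)) =
    fun x => - k ^+ 2 * (c * cos (k * x) + s * sin (k * x)).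
Proof.
pose cs := fix cs n : R * R := if n is n.+1 then (k * (cs n).2, - k * (cs n).1) else (c, s).
have [||sm E] := @smoothP (fun x => c * cos (k * x) + s * sin (k * x))
  (fun n x => (cs n).1 * cos (k * x) + (cs n).2 * sin (k * x)).
- by [].
- move=> n x /=.
  have := is_deriveD (is_deriveZ (cs n).1 (is_derive_cosM k x)) (is_deriveZ (cs n).2 (is_derive_sinM k x)) => H.
  by apply: (is_derive_eq H); rewrite /GRing.scale/=; ring.
by split=> //; rewrite E; apply/funext => x /=; ring.
Qed.

Lemma test_function_expi (k : int) : test_function (expi k : R -> C).
Proof.
have [sc _] := smooth_wave k%:~R 1 0; have [ss _] := smooth_wave k%:~R 0 1.
split.
- by move=> x; congr Complex; rewrite mulrDr addrC ?cosDz ?sinDz.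
- by congr smooth: sc; apply/funext => x /=; rewrite mul1r mul0r addr0.
- by congr smooth: ss; apply/funext => x /=; rewrite mul1r mul0r add0r.
Qed.

Lemma complex_eta (z : C) : Complex (complex.Re z) (complex.Im z) = z.
Proof. by case: z. Qed.

Lemma test_function_lincomb (a : C) (phi psi : R -> C) :
  test_function phi -> test_function psi -> test_function (fun x => a * phi x + psi x) /\
  forall n x, cderive n (fun x => a * phi x + psi x) x = a * cderive n phi x + cderive n psi x.
Proof.
move=> [phiT re1 im1] [psiT re2 im2].
have [sr Er] := smooth_lincomb (complex.Re a) (- complex.Im a) re1 im1 re2.
have [si Ei] := smooth_lincomb (complex.Im a) (complex.Re a) re1 im1 im2.
have reE : (fun x => complex.Re (a * phi x + psi x)) = fun x => complex.Re a * complex.Re (phi x) +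
    (- complex.Im a) * complex.Im (phi x) + complex.Re (psi x).
  apply/funext => x; case: (a) => p q; case: (phi x) => r s; case: (psi x) => r' s'.
  by rewrite complex_mulE complex_addE/=; ring.
have imE : (fun x => complex.Im (a * phi x + psi x)) = fun x => complex.Im a * complex.Re (phi x) +
    complex.Re a * complex.Im (phi x) + complex.Im (psi x).
  apply/funext => x; case: (a) => p q; case: (phi x) => r s; case: (psi x) => r' s'.
  by rewrite complex_mulE complex_addE/=; ring.
split; first split.
- by move=> x; rewrite phiT psiT.
- by rewrite reE; exact: sr.
- by rewrite imE; exact: si.
move=> n x; rewrite /cderive reE imE Er Ei -[in RHS](complex_eta a).
by rewrite complex_mulE complex_addE; congr Complex; ring.
Qed.

Lemma test_function0 : test_function ((fun=> 0) : R -> C).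
Proof.
have [s0 _] := smooth_wave 0 0 0.
have {}s0 : smooth (fun=> 0 : R) by congr smooth: s0; apply/funext => x /=; rewrite !mul0r addr0.
by split; [move=> x|exact: s0|exact: s0].
Qed.

Lemma normc_le_norm (a b : R) : Normc.normc (Complex a b) <= `|a| + `|b|.
Proof.
rewrite -[leRHS]ger0_norm ?addr_ge0// -sqrtr_sqr ler_wsqrtr//.
rewrite -(real_normK (num_real a)) -(real_normK (num_real b)) sqrrD addrAC lerDl.
by rewrite mulrn_wge0// mulr_ge0.
Qed.

Lemma norm_Re_le (z : C) : `|complex.Re z| <= Normc.normc z.
Proof. by case: z => a b /=; rewrite -sqrtr_sqr ler_wsqrtr// lerDl sqr_ge0. Qed.

Lemma norm_Im_le (z : C) : `|complex.Im z| <= Normc.normc z.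
Proof. by case: z => a b /=; rewrite -sqrtr_sqr ler_wsqrtr// lerDr sqr_ge0. Qed.

Lemma normc_sqr (a b : R) : Normc.normc (Complex a b) ^+ 2 = a ^+ 2 + b ^+ 2.
Proof. by rewrite /= sqr_sqrtr// addr_ge0// sqr_ge0. Qed.

End SmoothFunctions.

Section Distributions.
Context {R : realType}.
Implicit Types (x y h t : R) (f g A B : R -> R).
Local Notation T := ((pi : R) *+ 2).
Local Notation C := (complex R).

Definition L1c (F : R -> C) := L1 (fun x => complex.Re (F x)) /\ L1 (fun x => complex.Im (F x)).

Lemma circle_cintE F : L1c F ->
  circle_cint F = Complex (Ic (fun x => complex.Re (F x))) (Ic (fun x => complex.Im (F x))).
Proof. by move=> [F1 F2]; congr Complex; apply: circle_intE; exact: L1_measurable. Qed.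

Lemma circle_cint_lincomb (a : C) (F G : R -> C) : L1c F -> L1c G ->
  circle_cint (fun x => a * F x + G x) = a * circle_cint F + circle_cint G.
Proof.
move=> [F1 F2] [G1 G2]; case: a => p q.
have reE : (fun x => complex.Re (Complex p q * F x + G x)) =
   fun x => p * complex.Re (F x) - q * complex.Im (F x) + complex.Re (G x).
  by apply/funext => x; case: (F x) => r s; case: (G x).
have imE : (fun x => complex.Im (Complex p q * F x + G x)) =
   fun x => p * complex.Im (F x) + q * complex.Re (F x) + complex.Im (G x).
  by apply/funext => x; case: (F x) => r s; case: (G x).
have Lr : L1 (fun x => p * complex.Re (F x) - q * complex.Im (F x)) by apply: L1B; exact: L1Z.
have Li : L1 (fun x => p * complex.Im (F x) + q * complex.Re (F x)) by apply: L1D; exact: L1Z.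
rewrite [LHS]circle_cintE; last by rewrite /L1c reE imE; split; exact: L1D.
rewrite reE imE (IcD Lr G1) (IcD Li G2) (IcB (L1Z p F1) (L1Z q F2)) (IcD (L1Z p F2) (L1Z q F1)).
rewrite !IcZ//.
by rewrite !circle_cintE// complex_mulE complex_addE.
Qed.

Lemma normc_circle_cint (F : R -> C) G : L1c F -> L1 G -> (forall x, Normc.normc (F x) <= G x) ->
  Normc.normc (circle_cint F) <= 2 * Ic G.
Proof.
move=> F1 G1 FG; rewrite circle_cintE// (le_trans (normc_le_norm _ _))// mulr_natl mulr2n.
case: F1 => Fr Fi; apply: lerD; apply: (le_trans (le_norm_Ic _)) => //.
  by apply: le_Ic => // [|x]; [exact: L1_norm|rewrite (le_trans (norm_Re_le _))].
by apply: le_Ic => // [|x]; [exact: L1_norm|rewrite (le_trans (norm_Im_le _))].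
Qed.

Lemma L1c_mul_cderive n (F : R -> C) (phi : R -> C) : L1c F -> test_function phi ->
  L1c (fun x => F x * cderive n phi x).
Proof.
move=> [F1 F2] [phiT re im].
have reT : periodic (fun y => complex.Re (phi y)) T by move=> x; rewrite phiT.
have imT : periodic (fun y => complex.Im (phi y)) T by move=> x; rewrite phiT.
have LL H f : L1 H -> smooth f -> periodic f T -> L1 (fun x => H x * derive1n n f x).
  move=> H1 sf fT; have cf := smooth_continuous (n := n) sf.
  have [M fM] := periodic_continuous_bounded cf (derive1n_periodic n fT).
  exact: L1_mul_bounded H1 (continuous_measurable cf) fM.
split.
  apply: eq_L1 (L1B (LL _ _ F1 re reT) (LL _ _ F2 im imT)) => x.
  by case: (F x).
apply: eq_L1 (L1D (LL _ _ F1 im imT) (LL _ _ F2 re reT)) => x.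
by case: (F x).
Qed.

(** Up to the sign [(-1)^n], the [n]-th distributional derivative of [F]. The case [n = 0] gives
    regular distributions, the case [n = 2] the Hopf differential. *)
Definition derived_functional n (F : R -> C) : @functional R :=
  fun phi => circle_cint (fun x => F x * cderive n phi x).

Lemma derived_functional_distribution n (F : R -> C) : L1c F ->
  is_distribution (derived_functional n F).
Proof.
move=> F1; split.
  move=> a phi psi tphi tpsi; have [tt dE] := test_function_lincomb a tphi tpsi.
  rewrite /derived_functional -circle_cint_lincomb; [|exact: L1c_mul_cderive..].
  by congr circle_cint; apply/funext => x; rewrite dE; ring.
pose G x := `|complex.Re (F x)| + `|complex.Im (F x)|.
have G1 : L1 G by case: F1 => Fr Fi; apply: L1D; exact: L1_norm.
exists n, (2 * Ic G) => phi M tphi phiM.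
rewrite -mulrA -IcZr//; apply: normc_circle_cint; first exact: L1c_mul_cderive.
  by apply: eq_L1 (L1Z M G1) => x; rewrite mulrC.
move=> x; rewrite Normc.normcM ler_pM ?sqrtr_ge0//.
- by case: (F x) => a b; rewrite sqrtr_ge0.
- by rewrite -[F x]complex_eta normc_le_norm.
- exact: phiM.
Qed.

Lemma regular_derived (F : R -> C) : regular_distribution F = derived_functional 0 F.
Proof.
apply/funext => phi; congr circle_cint; apply/funext => x.
by rewrite /cderive !derive1n0 complex_eta.
Qed.

Lemma cderive2_expi k x : cderive 2 (expi k : R -> C) x = real_complex R (- k%:~R ^+ 2) * expi k x.
Proof.
have [_ Ec] := smooth_wave (k%:~R : R) 1 0; have [_ Es] := smooth_wave (k%:~R : R) 0 1.
rewrite /cderive.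
have -> : (fun y => complex.Re (expi k y)) = fun y : R => 1 * cos (k%:~R * y) + 0 * sin (k%:~R * y).
  by apply/funext => y /=; rewrite mul1r mul0r addr0.
have -> : (fun y => complex.Im (expi k y)) = fun y : R => 0 * cos (k%:~R * y) + 1 * sin (k%:~R * y).
  by apply/funext => y /=; rewrite mul1r mul0r add0r.
by rewrite Ec Es complex_mulE; congr Complex; ring.
Qed.

Lemma fourier_derived2 (F : R -> C) k : L1c F ->
  fourier (derived_functional 2 F) k = real_complex R (- k%:~R ^+ 2) * fourier (regular_distribution F) k.
Proof.
move=> F1; rewrite regular_derived /fourier mulrCA; congr (_ * _).
have L := L1c_mul_cderive 0 F1 (test_function_expi (- k)).
have L0 : L1c (fun=> 0 : C) by split; exact: L1_cst.
rewrite /derived_functional -[RHS]addr0 (_ : 0 = circle_cint (fun=> 0 : C)); last first.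
  by rewrite circle_cintE// !Ic_cst mul0r.
rewrite -circle_cint_lincomb//; congr circle_cint; apply/funext => x.
rewrite cderive2_expi /cderive !derive1n0 complex_eta.
by rewrite mulrNz sqrrN addr0 mulrCA.
Qed.

Lemma fourier_real f (k : int) : L1 f ->
  fourier (regular_distribution (fun x => real_complex R (f x))) k =
  Complex (T^-1 * Ic (fun x => f x * cos (k%:~R * x))) (- (T^-1 * Ic (fun x => f x * sin (k%:~R * x)))).
Proof.
move=> f1; have f1c : L1c (fun x => real_complex R (f x)) by split=> //; exact: L1_cst.
have L := L1c_mul_cderive 0 f1c (test_function_expi (- k)).
rewrite regular_derived /fourier /derived_functional circle_cintE// complex_mulE.
rewrite !mul0r subr0 addr0; congr Complex; first congr (_ * _).
  by apply: eq_Ic => x; rewrite /cderive !derive1n0/= mul0r subr0 mulrNz mulNr cosN.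
rewrite -mulrN; congr (_ * _).
rewrite -[RHS]mulN1r -IcZ; last first.
  have cs : continuous (fun x : R => sin (k%:~R * x)) by exact: continuous_sinM.
  apply: (@L1_mul_bounded _ _ _ 1 f1 (continuous_measurable cs)) => x.
  by rewrite ler_norml sin_geN1 sin_le1.
by apply: eq_Ic => x; rewrite /cderive !derive1n0/= mul0r addr0 mulrNz mulNr sinN mulN1r mulrN.
Qed.

End Distributions.

(** * The half Dirichlet energy in Gagliardo form *)

Section HalfEnergy.
Context {R : realType}.
Implicit Types (x y t : R) (f g : R -> R).
Local Notation T := ((pi : R) *+ 2).
Local Notation C := (complex R).

Lemma fourier_nat f (k : nat) : L1 f ->
  fourier (regular_distribution (fun x => real_complex R (f x))) (Posz k) =
  Complex (T^-1 * acoef f k) (- (T^-1 * bcoef f k)).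
Proof. by move=> f1; rewrite fourier_real. Qed.

Lemma fourier_negz f (k : nat) : L1 f ->
  fourier (regular_distribution (fun x => real_complex R (f x))) (- Posz k) =
  Complex (T^-1 * acoef f k) (T^-1 * bcoef f k).
Proof.
move=> f1; rewrite fourier_real//; congr Complex.
  by congr (_ * _); apply: eq_Ic => x; rewrite mulrNz mulNr cosN.
rewrite -mulrN; congr (_ * _); rewrite -mulN1r -IcZ.
  by apply: eq_Ic => x; rewrite mulN1r mulrNz mulNr sinN mulrN opprK.
apply: (@L1_mul_bounded _ _ _ 1 f1 (continuous_measurable (@continuous_sinM R _))) => x.
by rewrite ler_norml sin_geN1 sin_le1.
Qed.

Lemma normc_fourier f (k : int) : L1 f ->
  Normc.normc (fourier (regular_distribution (fun x => real_complex R (f x))) k) ^+ 2 =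
  T ^- 2 * coef2 f `|k|%N.
Proof.
move=> f1; have [n [->|->]] : exists n : nat, k = Posz n \/ k = - Posz n.
- by exists `|k|%N; case: k => n; [left|right].
- by rewrite fourier_nat// normc_sqr /coef2/= -exprVn; move: T^-1 => p; ring.
- by rewrite fourier_negz// normc_sqr abszN/= /coef2 -exprVn; move: T^-1 => p; ring.
Qed.

Lemma esum_range_Posz (a : int -> \bar R) : (forall k, (0 <= a k)%E) ->
  (\esum_(k in range Posz) a k = \sum_(k <oo) a (Posz k))%E.
Proof.
move=> a0; rewrite nneseries_esumT; last by move=> n; exact: a0.
rewrite (@reindex_esum _ _ _ setT (range Posz) Posz)//; split=> //.
by move=> i j _ _ [].
Qed.

Lemma le_esum_Posz (a : int -> \bar R) : (forall k, (0 <= a k)%E) ->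
  (\sum_(k <oo) a (Posz k) <= \esum_(k in [set: int]) a k)%E.
Proof.
move=> a0; rewrite -esum_range_Posz// esum_mkcond; apply: le_esum => k _.
by case: ifP.
Qed.

Lemma esum_Posz (a : int -> \bar R) : (forall k, (0 <= a k)%E) -> (forall n, a (Negz n) = 0%E) ->
  (\esum_(k in [set: int]) a k = \sum_(k <oo) a (Posz k))%E.
Proof.
move=> a0 an; rewrite -esum_range_Posz// [RHS]esum_mkcond; apply: eq_esum => k _.
case: ifP => // /negP; case: k => // n kn; exfalso; apply: kn.
by rewrite inE; exists n.
Qed.

Context {m : nat}.
Implicit Types (u : R -> 'rV[R]_m).

Lemma circle_L2_component u j : circle_L2 u ->
  L2 (fun x => u x 0 j) /\ periodic (fun x => u x 0 j) T.
Proof.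
move=> [uT uL]; have [mu iu] := uL j; split; last by move=> x; rewrite uT.
split=> //; apply/integrable_circP => //.
apply/measurable_EFinP; exact: measurable_funX.
Qed.

Lemma circle_L2_of_components u : periodic u T -> (forall j, L2 (fun x => u x 0 j)) -> circle_L2 u.
Proof.
move=> uT uL; split=> // j; have [mu iu] := uL j; split=> //.
apply/integrable_circP => //.
apply/measurable_EFinP; exact: measurable_funX.
Qed.

(** The weight [k] in [gagliardoE] is at most [sqrt (1 + k^2)], and the frequencies [k >= 0] are
    part of the sum over all integers. The factor [2 * T ^+ 2] combines the 2 of [gagliardoE] with
    the normalisation of [fourier]. *)
Lemma H_half_gagliardo u j : H_half u -> (gagliardo (fun x => u x 0%R j) < +oo)%E.
Proof.
move=> [u2 uH]; have [_ Hs] := uH j; have [f2 fT] := circle_L2_component j u2.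
rewrite gagliardoE//; have f1 := L2_L1 f2.
set a := (fun k : int => _) in Hs.
have a0 k : (0 <= a k)%E by rewrite lee_fin mulr_ge0 ?powR_ge0// exprn_ge0// -[X in Normc.normc X]complex_eta sqrtr_ge0.
apply: (@le_lt_trans _ _ (\sum_(k <oo) ((2 * T ^+ 2)%:E * a (Posz k)))%E).
  apply: lee_nneseries => [k _ _|k _].
    by rewrite lee_fin mulr_ge0 ?coef2_ge0.
  rewrite /a /component normc_fourier// -EFinM lee_fin.
  rewrite (_ : 2 * T ^+ 2 * _ = 2 * (1 + k%:~R ^+ 2) `^ (1 / 2) * coef2 (fun x => u x 0 j) k); last first.
    have T0 : T != 0 by rewrite gt_eqF// period_gt0.
    by move: T T0 (coef2 _ _) (powR _ _) => p p0 c w; field.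
  rewrite ler_wpM2r ?coef2_ge0// ler_wpM2l// div1r powR12_sqrt; last by rewrite addr_ge0// sqr_ge0.
  rewrite -[leLHS]ger0_norm// -sqrtr_sqr ler_wsqrtr// lerDr//.
rewrite nneseriesZl; last by move=> k _; exact: a0.
have K0 : 0 <= 2 * T ^+ 2 by rewrite mulr_ge0// sqr_ge0.
rewrite lte_mul_pinfty//.
by apply: le_lt_trans Hs; exact: le_esum_Posz.
Qed.

Lemma gagliardo_partial_sum f n : L2 f -> periodic f T -> (gagliardo f < +oo)%E ->
  \sum_(k < n) k%:R * coef2 f k <= fine (gagliardo f) / 2.
Proof.
move=> f2 fT foo; have g0 := gagliardo_ge0 f.
rewrite ler_pdivlMr// -lee_fin fineK; last by rewrite ge0_fin_numE.
rewrite gagliardoE//; apply: le_trans (nneseries_lim_ge n _); last first.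
  by move=> k _ _; rewrite lee_fin mulr_ge0// coef2_ge0.
rewrite big_mkord sumEFin lee_fin mulr_suml le_eqVlt; apply/orP; left; apply/eqP.
by apply: eq_bigr => k _; ring.
Qed.

Lemma powR_half_order (k : nat) : `|(Posz k)%:~R| `^ (2 * (1 / 4)) = Num.sqrt k%:R :> R.
Proof.
by rewrite (_ : 2 * (1 / 4) = 2^-1); [rewrite powR12_sqrt// ger0_norm|field].
Qed.

Lemma is_frac_laplacian_coef f g k : L1 f -> L1 g ->
  is_frac_laplacian (1 / 4) (regular_distribution (fun x => real_complex R (f x)))
    (regular_distribution (fun x => real_complex R (g x))) ->
  acoef g k = Num.sqrt k%:R * acoef f k /\ bcoef g k = Num.sqrt k%:R * bcoef f k.
Proof.
move=> f1 g1 [_ /(_ (Posz k))]; rewrite !fourier_nat// powR_half_order complex_mulE.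
rewrite !mul0r subr0 addr0 mulrN => -[/eqP e1 /eqP e2].
have T0 : T^-1 != 0 by rewrite invr_neq0// gt_eqF// period_gt0.
move: e1 e2; rewrite eqr_opp ![Num.sqrt _ * (_ * _)]mulrCA => /eqP/(mulfI T0) -> /eqP/(mulfI T0) ->.
by [].
Qed.

(** Finiteness of the Gagliardo form makes the coefficients multiplied by [sqrt k] square summable,
    so that [riesz_fischer] applies. Hence [xget] does not fall back on its default in
    [frac_laplacian]. *)
Lemma exists_frac_laplacian f : L2 f -> periodic f T -> (gagliardo f < +oo)%E ->
  exists g, [/\ L2 g, periodic g T &
    is_frac_laplacian (1 / 4) (regular_distribution (fun x => real_complex R (f x)))
    (regular_distribution (fun x => real_complex R (g x)))].
Proof.
move=> f2 fT foo; pose al k := Num.sqrt k%:R * acoef f k; pose be k := Num.sqrt k%:R * bcoef f k.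
have cv : cvgn (sqsum al be).
  apply: nondecreasing_is_cvgn; first exact: sqsum_nondecreasing.
  exists (fine (gagliardo f) / 2) => _ [n _ <-].
  apply: le_trans (gagliardo_partial_sum n f2 fT foo).
  rewrite /sqsum le_eqVlt; apply/orP; left; apply/eqP; apply: eq_bigr => k _.
  by rewrite /al /be !exprMn sqr_sqrtr// -mulrDr.
have [||g [g2 gT ga gb _]] := riesz_fischer _ _ cv.
- by rewrite /al sqrtr0 mul0r.
- by rewrite /be sqrtr0 mul0r.
have f1 := L2_L1 f2; have g1 := L2_L1 g2.
exists g; split=> //; split.
  rewrite regular_derived; apply: derived_functional_distribution.
  by split=> //; exact: L1_cst.
move=> k; have [n [->|->]] : exists n : nat, k = Posz n \/ k = - Posz n.
- by exists `|k|%N; case: k => n; [left|right].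
- rewrite !fourier_nat// powR_half_order ga gb complex_mulE /al /be.
  by congr Complex; ring.
- rewrite mulrNz normrN !fourier_negz// powR_half_order ga gb complex_mulE /al /be.
  by congr Complex; ring.
Qed.

Lemma gagliardo_frac_laplacian f g : L2 f -> periodic f T -> L2 g ->
  (forall k, acoef g k = Num.sqrt k%:R * acoef f k /\ bcoef g k = Num.sqrt k%:R * bcoef f k) ->
  gagliardo f = (T * Ic (fun x => g x ^+ 2))%:E.
Proof.
move=> f2 fT g2 gk; rewrite gagliardoE// EFinM EFin_Ic; last exact: g2.2.
rewrite eparseval//; last by rewrite (gk 0%N).1 sqrtr0 mul0r.
rewrite -nneseriesZl; last first.
  by move=> k _; rewrite lee_fin divr_ge0 ?coef2_ge0// pi_ge0.
apply: eq_eseriesr => k _; rewrite -EFinM; congr EFin.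
rewrite [coef2 g k]/coef2 (gk k).1 (gk k).2 !exprMn sqr_sqrtr// -mulrDr -/(coef2 f k).
by rewrite mulr2n; have := @pi_neq0 R; move: (pi : R) => p p0; field.
Qed.

(** Whichever representative [xget] selects, its Fourier coefficients are prescribed, and by
    Parseval they determine its norm. *)
Lemma half_energyE u : circle_L2 u -> (forall j, (gagliardo (fun x => u x 0%R j) < +oo)%E) ->
  half_energy u = T^-1 * \sum_(j < m) fine (gagliardo (fun x => u x 0 j)).
Proof.
move=> u2 uoo.
have [g gP] : exists g : 'I_m -> R -> R, forall j, [/\ L2 (g j), periodic (g j) T &
    is_frac_laplacian (1 / 4) (component u j)
    (regular_distribution (fun x => real_complex R (g j x)))].
  have [|g gP] := @choice _ _ (fun j g => [/\ L2 g, periodic g T &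
    is_frac_laplacian (1 / 4) (component u j)
    (regular_distribution (fun x => real_complex R (g x)))]); last by exists g.
  by move=> j; have [f2 fT] := circle_L2_component j u2; exact: exists_frac_laplacian.
rewrite /half_energy; set G := frac_laplacian _ _.
have [G2 GP] : circle_L2 G /\ forall j, is_frac_laplacian (1 / 4) (component u j) (component G j).
  apply: (@xgetPex _ (fun=> 0) [set g | circle_L2 g /\
    forall j, is_frac_laplacian (1 / 4) (component u j) (component g j)]).
  exists (fun x => \row_j g j x).
  have E j : (fun x => (\row_i g i x) 0 j) = g j by apply/funext => x; rewrite mxE.
  split; last first.
    move=> j; rewrite [X in is_frac_laplacian _ _ X](_ : _ =
      regular_distribution (fun x => real_complex R (g j x))); first by case: (gP j).
    by congr regular_distribution; apply/funext => x; rewrite mxE.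
  apply: circle_L2_of_components; last by move=> j; rewrite E; case: (gP j).
  by move=> x; apply/rowP => j; rewrite !mxE; case: (gP j) => _ ->.
have L j := circle_L2_component j G2.
rewrite circle_intE; last first.
  by apply: measurable_sum => j; apply: measurable_funX; exact: L2_measurable (L j).1.
rewrite Ic_sum; last by move=> j; exact: (L j).1.2.
rewrite mulr_sumr; apply: eq_bigr => j _; have [f2 fT] := circle_L2_component j u2.
rewrite (gagliardo_frac_laplacian f2 fT (L j).1) /=; last first.
  by move=> k; apply: is_frac_laplacian_coef (GP j); [exact: L2_L1|exact: L2_L1 (L j).1].
by rewrite mulKf// gt_eqF// period_gt0.
Qed.

(** The Jacobian [w] is at least [1 / 2], so [f (phi x) ^+ 2] is at most twice the integrand that
    the substitution formula evaluates. *)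
Lemma L2_deformation f (X p : R -> R) t (M : R) : L2 f -> periodic f T ->
  (forall x, is_derive x (1 : R) X (p x)) -> continuous p -> periodic X T ->
  (forall x, `|p x| <= M) -> `|t| * M <= 2^-1 ->
  L2 (fun x => f (x + t * X x)) /\ periodic (fun x => f (x + t * X x)) T.
Proof.
move=> f2 fT dX cp XT pM tM; have mf := L2_measurable f2.
pose phi x := x + t * X x; pose w x := 1 + t * p x.
have dphi x : is_derive x (1 : R) phi (w x).
  by have := is_deriveD (is_derive_id x (1 : R)) (is_deriveZ t (dX x)).
have cw : continuous w.
  move=> x; apply: cvgD; first exact: cvg_cst.
  by apply: cvgM; [exact: cvg_cst|exact: cp].
have w2 x : 2^-1 <= w x.
  have : `|t * p x| <= 2^-1 by rewrite normrM (le_trans _ tM)// ler_wpM2l.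
  by rewrite ler_norml /w => /andP[h _]; lra.
have w0 x : 0 < w x by rewrite (lt_le_trans _ (w2 x)).
have phiT x : phi (x + T) = phi x + T by rewrite /phi XT; ring.
have mphi := continuous_measurable (is_derive_continuous dphi).
have mg : measurable_fun setT (f \o phi) by exact: (measurableT_comp mf mphi).
have mw := continuous_measurable cw.
split; last by move=> x; rewrite -/(phi _) phiT fT.
split=> //; apply/integrableP; split.
  by apply/measurable_EFinP; exact: measurable_funX.
have mf2 : measurable_fun setT (fun x => (f x ^+ 2)%:E).
  by apply/measurable_EFinP; exact: measurable_funX.
have I : (\int[circ]_x ((f (phi x) ^+ 2)%:E * (w x)%:E) = \int[circ]_x (f x ^+ 2)%:E)%E.
  apply: (@ge0_integral_subst _ phi w dphi cw w0 phiT (fun x => (f x ^+ 2)%:E)) => //.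
  - by move=> x; rewrite lee_fin sqr_ge0.
  - by move=> x; rewrite fT.
have I1 : (\int[circ]_x (f x ^+ 2)%:E < +oo)%E by rewrite -EFin_Ic ?ltry//; exact: f2.2.
apply: (@le_lt_trans _ _ (\int[circ]_x (2%:E * ((f (phi x) ^+ 2)%:E * (w x)%:E)))%E).
  apply: ge0_le_integral => //.
  - apply: measurableT_comp => //; apply/measurable_EFinP; exact: measurable_funX.
  - apply/measurable_EFinP; apply: measurable_funM => //; apply: measurable_funM => //.
    exact: measurable_funX.
  move=> x _; rewrite /= ger0_norm ?sqr_ge0// lee_fin mulrCA ler_peMr ?sqr_ge0//.
  by have := w2 x; lra.
rewrite ge0_integralZl//.
- by rewrite I lte_mul_pinfty// lee_fin.
- apply/measurable_EFinP; apply: measurable_funM => //; exact: measurable_funX.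
- by move=> x _; rewrite -EFinM lee_fin mulr_ge0 ?sqr_ge0// ltW.
Qed.

End HalfEnergy.

(** * Stationarity in terms of Fourier coefficients *)

Section Stationary.
Context {R : realType} {m : nat}.
Implicit Types (x y t : R) (f g : R -> R) (u : R -> 'rV[R]_m).
Local Notation T := ((pi : R) *+ 2).
Local Notation C := (complex R).

Lemma hopf_coefE u k : (forall j, L1 (fun x => u x 0 j)) ->
  hopf_coef u (Posz k) = real_complex R (T ^- 2) *
    Complex (\sum_(j < m) hopf_re (fun x => u x 0 j) k)
            (- \sum_(j < m) hopf_im (fun x => u x 0 j) k).
Proof.
move=> u1; have T0 : T != 0 by rewrite gt_eqF// period_gt0.
pose a j := acoef (fun x => u x 0 j); pose b j := bcoef (fun x => u x 0 j).
pose A s j := (s * (k - s))%:R * (a j s * a j (k - s)%N - b j s * b j (k - s)%N).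
pose B s j := (s * (k - s))%:R * (a j s * b j (k - s)%N + b j s * a j (k - s)%N).
rewrite (_ : Complex _ _ =
    \sum_(s < k) Complex (\sum_(j < m) A s j) (- \sum_(j < m) B s j)); last first.
  by rewrite complex_sum/= sumrN; congr Complex; [|congr (- _)]; exact: exchange_big.
rewrite mulr_sumr /hopf_coef; case: ifPn => [k0|]; last first.
  rewrite ltz_nat -eqn0Ngt => /eqP k0; rewrite big1// => s _.
  by have := ltn_ord s; rewrite [X in (_ < X)%N]k0.
rewrite -(pair_big_dep xpredT (fun p q : 'I_k => [&& (0 < p)%N, (0 < q)%N & (p + q == k)%N])
  (fun p q : 'I_k => bilinear_dot (p%:R *: vfourier u (Posz p)) (q%:R *: vfourier u (Posz q))))/=.
apply: eq_bigr => s _; have [s0|s0] := posnP s.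
  rewrite s0 big_pred0// (big1 _ _ (fun j => _)) => [|j _]; last by rewrite /A mul0r.
  by rewrite big1 ?oppr0 ?mulr0// => j _; rewrite /B mul0r.
have ks : (k - s < k)%N by rewrite ltn_subrL s0 (leq_ltn_trans _ (ltn_ord s)).
rewrite (big_pred1 (Ordinal ks)); last first.
  move=> q /=; rewrite -val_eqE/=; have := ltn_ord s; have := ltn_ord q; lia.
rewrite (_ : Complex _ _ = \sum_(j < m) Complex (A s j) (- B s j)); last first.
  by rewrite complex_sum/= sumrN.
rewrite /bilinear_dot mulr_sumr; apply: eq_bigr => j _; rewrite !mxE /component !fourier_nat//.
rewrite !complex_natE !complex_mulE /A /B /a /b natrM -exprVn.
by move: T^-1 => p; congr Complex; ring.
Qed.

Lemma C1_trigpoly n (a b : nat -> R) : C1_vector_field (trigpoly n a b).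
Proof.
have dX x := is_derive_trigpoly n a b x.
have E : derive1 (trigpoly n a b) = trigpoly n (fun j => j%:R * b j) (fun j => - (j%:R * a j)).
  by apply/funext => x; exact: is_derive1_val.
split; first exact: trigpoly_periodic.
  by move=> x; have [] := dX x.
by rewrite E; exact: trigpoly_continuous.
Qed.

Lemma stationaryE u : H_half u ->
  stationary u <-> forall k, \sum_(j < m) hopf_re (fun x => u x 0 j) k = 0 /\
    \sum_(j < m) hopf_im (fun x => u x 0 j) k = 0.
Proof.
move=> uH; have u2 := uH.1; pose v (j : 'I_m) x : R := u x 0 j.
have vP j : [/\ L2 (v j), periodic (v j) T & (gagliardo (v j) < +oo)%E].
  by have [f2 fT] := circle_L2_component j u2; split=> //; exact: H_half_gagliardo.
have T0 : T != 0 by rewrite gt_eqF// period_gt0.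
(* Only for small [t] is the deformed map known to have finite energy, hence to escape the default
   value of [frac_laplacian]; a derivative at 0 depends on no other [t]. *)
have near_half (X p : R -> R) : (forall x, is_derive x (1 : R) X (p x)) -> continuous p ->
    periodic X T -> periodic p T ->
    (\forall t \near (0 : R), forall j, (gagliardo (fun x => v j (x + t * X x)%R) < +oo)%E) ->
    \forall t \near (0 : R), T^-1 * gagliardo_sum v X t = half_energy (fun x => u (x + t * X x)).
  move=> dX cp XT pT Xoo; have [M pM] := periodic_continuous_bounded cp pT.
  have M0 : 0 <= M by rewrite (le_trans _ (pM 0)).
  near=> t; have tM : `|t| * M <= 2^-1.
    apply: (@le_trans _ _ (`|t| * (M + 1))); first by rewrite ler_wpM2l// lerDl.
    rewrite -ler_pdivlMr ?ltr_wpDl// ltW//.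
    by near: t; apply: (@nbhs0_lt R R); rewrite divr_gt0 ?ltr_wpDl.
  have too : forall j, (gagliardo (fun x => v j (x + t * X x)%R) < +oo)%E by near: t.
  rewrite half_energyE// -/(gagliardo_sum v X t)//.
  apply: circle_L2_of_components.
    move=> x; rewrite XT (_ : x + T + _ = x + t * X x + T); last by ring.
    by rewrite (proj1 u2).
  by move=> j; have [f2 fT _] := vP j; exact: (L2_deformation f2 fT dX cp XT pM tM).1.
split=> [st k|uk X [XT dX cX]]; last first.
  have dXp x := derivable_is_derive1 (dX x).
  have pT := derive1_periodic XT.
  have [dG Goo] := is_derive_gagliardo_sum0 vP dXp cX XT pT (fun k => (uk k).1) (fun k => (uk k).2).
  apply: near_eq_is_derive (near_half _ _ dXp cX XT pT Goo) _.
  by apply: is_derive_eq (is_deriveZ T^-1 dG) _; rewrite scaler0.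
(* Stationarity and [is_derive_gagliardo_sum_trigpoly] give two values for one derivative. *)
have key n (a b : nat -> R) : - 2 * \sum_(i < n) (b i * (\sum_(j < m) hopf_re (v j) i) -
                        a i * (\sum_(j < m) hopf_im (v j) i)) = 0.
  set X := trigpoly n a b.
  have dX x := is_derive_trigpoly n a b x.
  have cp := @trigpoly_continuous R n (fun j => j%:R * b j) (fun j => - (j%:R * a j)).
  have XT := @trigpoly_periodic R n a b.
  have pT := @trigpoly_periodic R n (fun j => j%:R * b j) (fun j => - (j%:R * a j)).
  have [dG Goo] := is_derive_gagliardo_sum_trigpoly n a b vP.
  have C1X : C1_vector_field X := C1_trigpoly n a b.
  have d1 := near_eq_is_derive (near_half _ _ dX cp XT pT Goo) (is_deriveZ T^-1 dG).
  have := is_derive1_val (st X C1X); rewrite (is_derive1_val d1) /GRing.scale/= => /eqP.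
  by rewrite mulf_eq0 invr_eq0 (negbTE T0)/= => /eqP.
have two : - 2 != 0 :> R by rewrite oppr_eq0.
have E (c : nat -> R) : \sum_(i < k.+1) (nat_of_ord i == k)%:R * c i = c k.
  rewrite big_ord_recr/= eqxx mul1r big1 ?add0r// => i _.
  by rewrite ltn_eqF ?mul0r.
split; apply/eqP.
  (* The field [sin (k x)] isolates the real part. *)
  have := key k.+1 (fun=> 0) (fun i => (i == k)%:R).
  rewrite (eq_bigr (fun i : 'I_k.+1 => (nat_of_ord i == k)%:R * \sum_(j < m) hopf_re (v j) i)).
    rewrite (E (fun i => \sum_(j < m) hopf_re (v j) i)) => /eqP.
    by rewrite mulf_eq0 (negbTE two).
  by move=> i _; rewrite mul0r subr0.
(* The field [cos (k x)] isolates the imaginary part. *)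
have := key k.+1 (fun i => (i == k)%:R) (fun=> 0).
rewrite (eq_bigr (fun i : 'I_k.+1 => - ((nat_of_ord i == k)%:R * \sum_(j < m) hopf_im (v j) i))).
  rewrite sumrN (E (fun i => \sum_(j < m) hopf_im (v j) i)) => /eqP.
  by rewrite mulf_eq0 (negbTE two)/= oppr_eq0.
by move=> i _; rewrite mul0r sub0r.
Unshelve. all: by end_near.
Qed.

End Stationary.

(** * Growth of the coefficients and construction of the distribution *)

Section Existence.
Context {R : realType}.
Implicit Types (x y t : R) (f g : R -> R).
Local Notation T := ((pi : R) *+ 2).
Local Notation C := (complex R).

(** Telescoping against [1 / k - 1 / (k + 1)]; the term [k = 0] is zero by the convention
    [0^-1 = 0]. *)
Lemma sum_inv_sqr_le n : \sum_(k < n) (k%:R ^+ 2)^-1 <= 2 :> R.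
Proof.
suff H k : \sum_(i < k.+2) (i%:R ^+ 2)^-1 <= 2 - k.+1%:R^-1 :> R.
  case: n => [|[|n]]; [by rewrite big_ord0|by rewrite big_ord1 expr0n invr0|].
  by rewrite (le_trans (H n))// lerBlDr lerDl invr_ge0.
elim: k => [|k IH]; first by rewrite 2!big_ord_recl big_ord0/= expr0n invr0 expr1n invr1; lra.
rewrite big_ord_recr/= (le_trans (lerD IH (lexx _)))//.
have k0 : 0 < k.+1%:R :> R by rewrite ltr0n.
rewrite -[k.+2%:R]natr1; move: (k.+1%:R : R) k0 => p p0.
rewrite -subr_ge0 (_ : _ - _ = (p * (p + 1) ^+ 2)^-1).
  by rewrite invr_ge0 mulr_ge0 ?sqr_ge0// ltW.
by field; rewrite !gt_eqF// addr_gt0.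
Qed.

Lemma nneseries_le_bound (a : nat -> R) c : (forall k, 0 <= a k) ->
  (forall n, \sum_(k < n) a k <= c) -> (\sum_(k <oo) (a k)%:E <= c%:E)%E.
Proof.
move=> a0 ac; apply: lime_le; first by apply: is_cvg_nneseries => k _ _; rewrite lee_fin.
by apply: nearW => n; rewrite big_mkord sumEFin lee_fin.
Qed.

(** The elementary inequality [2 |p q| <= p^2 + q^2] produces the weights [s^2] and [r^2]; bounding
    one factor of each by [k] leaves the weights [s] and [r] of the energy. *)
Lemma conv_term_le (s r k : nat) (a b a' b' : R) : (s <= k)%N -> (r <= k)%N ->
  2 * `|(s * r)%:R * (a * a' + b * b')| <=
  k%:R * (s%:R * (a ^+ 2 + b ^+ 2) + r%:R * (a' ^+ 2 + b' ^+ 2)).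
Proof.
move=> sk rk; have h1 : s%:R * s%:R <= k%:R * s%:R :> R by rewrite ler_wpM2r// ler_nat.
have h2 : r%:R * r%:R <= k%:R * r%:R :> R by rewrite ler_wpM2r// ler_nat.
have g1 : s%:R * s%:R * (a ^+ 2 + b ^+ 2) <= k%:R * s%:R * (a ^+ 2 + b ^+ 2).
  by rewrite ler_wpM2r// addr_ge0// sqr_ge0.
have g2 : r%:R * r%:R * (a' ^+ 2 + b' ^+ 2) <= k%:R * r%:R * (a' ^+ 2 + b' ^+ 2).
  by rewrite ler_wpM2r// addr_ge0// sqr_ge0.
rewrite [leRHS]mulrDr ![in leRHS]mulrA natrM; apply: le_trans (lerD g1 g2).
move: (s%:R : R) (r%:R : R) => p q.
have e1 := sqr_ge0 (p * a - q * a'); have e2 := sqr_ge0 (p * b - q * b').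
have e3 := sqr_ge0 (p * a + q * a'); have e4 := sqr_ge0 (p * b + q * b').
rewrite -[2]ger0_norm// -normrM ler_norml; apply/andP; split; rewrite -subr_ge0.
  rewrite (_ : _ - _ = (p * a + q * a') ^+ 2 + (p * b + q * b') ^+ 2); first exact: addr_ge0.
  by ring.
rewrite (_ : _ - _ = (p * a - q * a') ^+ 2 + (p * b - q * b') ^+ 2); first exact: addr_ge0.
by ring.
Qed.

Lemma conv_sum_le (k : nat) (c : nat -> R) (d : nat -> R) S : (forall s, 0 <= c s) ->
  (forall n, \sum_(s < n) s%:R * c s <= S) ->
  (forall s, (s <= k)%N -> 2 * `|d s| <= k%:R * (s%:R * c s + (k - s)%:R * c (k - s)%N)) ->
  `|\sum_(s < k) d s| <= k%:R * S.
Proof.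
move=> c0 cS dc; rewrite -(@ler_pM2l _ 2)//.
apply: (@le_trans _ _ (\sum_(s < k) k%:R * (s%:R * c s + (k - s)%:R * c (k - s)%N))).
  apply: (@le_trans _ _ (2 * \sum_(s < k) `|d s|)); first by rewrite ler_wpM2l// ler_norm_sum.
  by rewrite mulr_sumr ler_sum// => s _; rewrite dc// ltnW.
rewrite -mulr_sumr big_split/= mulrCA ler_wpM2l// mulr_natl mulr2n; apply: lerD; first exact: cS.
(* Reversal of ['I_k] turns [k - s] into [s.+1], so the reflected sum runs over the indices 1 to
   [k], and the partial sum of length [k.+1] bounds it. *)
rewrite (reindex_inj rev_ord_inj)/= (le_trans _ (cS k.+1))// [leRHS]big_ord_recl/= mul0r add0r.
by apply: ler_sum => s _; rewrite /bump/= add1n subKn.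
Qed.

Lemma hopf_re_le f k S : (forall n, \sum_(s < n) s%:R * coef2 f s <= S) ->
  `|hopf_re f k| <= k%:R * S.
Proof.
move=> fS; apply: (@conv_sum_le _ (coef2 f)
  (fun s => (s * (k - s))%:R * (acoef f s * acoef f (k - s) - bcoef f s * bcoef f (k - s)))) => //.
  by move=> s; exact: coef2_ge0.
move=> s sk; have := @conv_term_le s (k - s) k (acoef f s) (bcoef f s) (acoef f (k - s)) (- bcoef f (k - s)) sk (leq_subr _ _).
by rewrite mulrN sqrrN.
Qed.

Lemma hopf_im_le f k S : (forall n, \sum_(s < n) s%:R * coef2 f s <= S) ->
  `|hopf_im f k| <= k%:R * S.
Proof.
move=> fS; apply: (@conv_sum_le _ (coef2 f)
  (fun s => (s * (k - s))%:R * (acoef f s * bcoef f (k - s) + bcoef f s * acoef f (k - s)))) => //.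
  by move=> s; exact: coef2_ge0.
move=> s sk; have := @conv_term_le s (k - s) k (acoef f s) (bcoef f s) (bcoef f (k - s)) (acoef f (k - s)) sk (leq_subr _ _).
by rewrite [in X in _ <= X -> _](addrC (bcoef f _ ^+ 2)).
Qed.

Lemma fourier_complex A B k : L1 A -> L1 B ->
  fourier (regular_distribution (fun x => Complex (A x) (B x))) k =
  Complex 0 1 * fourier (regular_distribution (fun x => real_complex R (B x))) k +
  fourier (regular_distribution (fun x => real_complex R (A x))) k.
Proof.
move=> A1 B1; rewrite !regular_derived /fourier /derived_functional mulrCA -mulrDr; congr (_ * _).
have L D : L1 D -> L1c (fun x => real_complex R (D x) * cderive 0 (expi (- k)) x).
  move=> D1; apply: L1c_mul_cderive; last exact: test_function_expi.
  by split=> //; exact: L1_cst.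
rewrite -circle_cint_lincomb; [|exact: L..].
congr circle_cint; apply/funext => x; case: (cderive _ _ _) => p q.
by rewrite !complex_mulE complex_addE; congr Complex; ring.
Qed.

(* The distribution is the second derivative of the L^2 function whose k-th Fourier
   coefficient is - (P k - i Q k) / k^2, for k > 0. *)
Lemma exists_distribution (P Q : nat -> R) S : P 0%N = 0 -> Q 0%N = 0 ->
  (forall k, `|P k| <= k%:R * S) -> (forall k, `|Q k| <= k%:R * S) ->
  exists D : @functional R, in_Hs (- 3%:R) D /\
    forall k : int, fourier D k = if 0 < k then Complex (P `|k|%N) (- Q `|k|%N) else 0.
Proof.
move=> P0 Q0 PS QS; have S0 : 0 <= S by have := PS 1%N; rewrite mul1r; exact: le_trans.
(* [A] receives the coefficients [- al], [- be], and [B] the coefficients [be], [- al]: [B] is the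
   conjugate function of [A], so that [A + i B] has no negative frequencies and its positive ones
   are doubled. The factor [T / 2] offsets this doubling and the [T^-1] in [fourier]. *)
pose al k := T / 2 * P k / k%:R ^+ 2; pose be k := T / 2 * Q k / k%:R ^+ 2.
have sq (X : nat -> R) k : (forall k, `|X k| <= k%:R * S) -> X k ^+ 2 <= k%:R ^+ 2 * S ^+ 2.
  by move=> XS; rewrite -(real_normK (num_real (X k))) -exprMn lerXn2r ?nnegrE ?mulr_ge0.
have PQ k : P k ^+ 2 + Q k ^+ 2 <= 2 * (k%:R ^+ 2 * S ^+ 2).
  by rewrite mulr_natl mulr2n lerD// sq.
have term k : al k ^+ 2 + be k ^+ 2 <= (T / 2) ^+ 2 * (2 * S ^+ 2) * (k%:R ^+ 2)^-1.
  have [->|k0] := posnP k; first by rewrite /al /be P0 Q0 !(mulr0, mul0r) expr0n/= invr0 mulr0 addr0.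
  have kk : 0 < k%:R :> R by rewrite ltr0n.
  rewrite (_ : al k ^+ 2 + _ = (T / 2) ^+ 2 * (P k ^+ 2 + Q k ^+ 2) * (k%:R ^+ 2)^-1 * (k%:R ^+ 2)^-1); last first.
    by rewrite /al /be; move: (T / 2) => c; field; rewrite gt_eqF.
  rewrite ler_wpM2r ?invr_ge0 ?sqr_ge0// ler_pdivrMr ?exprn_gt0// -[leRHS]mulrA.
  by rewrite ler_wpM2l ?sqr_ge0// (le_trans (PQ k))// mulrA [X in _ <= X]mulrAC.
have bd n : sqsum al be n <= (T / 2) ^+ 2 * (2 * S ^+ 2) * 2.
  apply: (@le_trans _ _ (\sum_(k < n) (T / 2) ^+ 2 * (2 * S ^+ 2) * (k%:R ^+ 2)^-1)); first exact: ler_sum.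
  by rewrite -mulr_sumr ler_wpM2l ?sum_inv_sqr_le// mulr_ge0 ?sqr_ge0// mulr_ge0 ?sqr_ge0.
have cvab : cvgn (sqsum (fun k => - al k) (fun k => - be k)).
  apply: nondecreasing_is_cvgn; first exact: sqsum_nondecreasing.
  exists ((T / 2) ^+ 2 * (2 * S ^+ 2) * 2) => _ [n _ <-]; apply: le_trans (bd n).
  by rewrite /sqsum ler_sum// => k _; rewrite !sqrrN.
have cvba : cvgn (sqsum be (fun k => - al k)).
  apply: nondecreasing_is_cvgn; first exact: sqsum_nondecreasing.
  exists ((T / 2) ^+ 2 * (2 * S ^+ 2) * 2) => _ [n _ <-]; apply: le_trans (bd n).
  by rewrite /sqsum ler_sum// => k _; rewrite sqrrN addrC.
have al0 : al 0%N = 0 by rewrite /al P0 mulr0 mul0r.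
have be0 : be 0%N = 0 by rewrite /be Q0 mulr0 mul0r.
have [||A [A2 AT Aa Ab _]] := riesz_fischer _ _ cvab; [by rewrite al0 oppr0|by rewrite be0 oppr0|].
have [||B [B2 BT Ba Bb _]] := riesz_fischer _ _ cvba; [by []|by rewrite al0 oppr0|].
have A1 := L2_L1 A2; have B1 := L2_L1 B2.
pose F x : C := Complex (A x) (B x); have F1 : L1c F by [].
have T0 : T != 0 by rewrite gt_eqF// period_gt0.
have FP (k : nat) : fourier (derived_functional 2 F) (Posz k) = Complex (P k) (- Q k).
  rewrite fourier_derived2// fourier_complex// !fourier_nat// Aa Ab Ba Bb.
  rewrite [Complex 0 1 * _]complex_mulE complex_addE complex_mulE.
  have [->|k0] := posnP k.
    by rewrite P0 Q0 !(al0, be0, oppr0, mulr0, mul0r, addr0, subr0).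
  have kk : k%:R != 0 :> R by rewrite pnatr_eq0 -lt0n.
  rewrite /al /be -[(Posz k)%:~R]/(k%:R); move: (T) T0 (k%:R : R) kk => p p0 q q0.
  by congr Complex; field; rewrite p0 q0.
have FN (k : nat) : fourier (derived_functional 2 F) (- Posz k) = 0.
  rewrite fourier_derived2// fourier_complex// !fourier_negz// Aa Ab Ba Bb.
  rewrite [Complex 0 1 * _]complex_mulE complex_addE complex_mulE.
  rewrite (_ : 0 = Complex 0 0)//; congr Complex; ring.
have FE (k : int) : fourier (derived_functional 2 F) k = if 0 < k then Complex (P `|k|%N) (- Q `|k|%N) else 0.
  case: k => k; last by rewrite NegzE FN.
  by rewrite FP ltz_nat; case: k => //=; rewrite P0 Q0 oppr0.
exists (derived_functional 2 F); split=> //; split; first exact: derived_functional_distribution.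
rewrite esum_Posz; last 2 first.
- by move=> k; rewrite lee_fin mulr_ge0 ?powR_ge0// sqr_ge0.
- by move=> n; rewrite NegzE FN Normc.normc0 expr0n mulr0.
apply: (@le_lt_trans _ _ (2 * S ^+ 2 * 2)%:E); last by rewrite ltry.
apply: (@nneseries_le_bound (fun k => (1 + (Posz k)%:~R ^+ 2) `^ (- 3%:R) *
  Normc.normc (fourier (derived_functional 2 F) (Posz k)) ^+ 2)).
  by move=> k; rewrite mulr_ge0 ?powR_ge0// sqr_ge0.
move=> n; apply: (@le_trans _ _ (\sum_(k < n) 2 * S ^+ 2 * (k%:R ^+ 2)^-1)); last first.
  by rewrite -mulr_sumr ler_wpM2l ?sum_inv_sqr_le// mulr_ge0 ?sqr_ge0.
apply: ler_sum => k _; rewrite FP normc_sqr sqrrN -[(Posz k)%:~R]/(k%:R).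
have [->|k0] := posnP k; first by rewrite P0 Q0 mulr0n expr0n/= mulr0n addr0 invr0 !mulr0.
have kk : 0 < k%:R :> R by rewrite ltr0n.
rewrite powRN powR_mulrn; last by rewrite addr_ge0// sqr_ge0.
(* Since [k^4 <= (1 + k^2)^3], coefficients of order [k] leave terms of order [1 / k^2]. *)
apply: (@le_trans _ _ (((1 + k%:R ^+ 2) ^+ 3)^-1 * (2 * (k%:R ^+ 2 * S ^+ 2)))).
  by rewrite ler_wpM2l// invr_ge0 exprn_ge0// addr_ge0// sqr_ge0.
rewrite ler_pdivrMl; last by rewrite exprn_gt0// addr_gt0// exprn_gt0.
rewrite -subr_ge0; move: (k%:R : R) kk => p p0.
rewrite (_ : _ - _ = 2 * S ^+ 2 * (1 + 3 * p ^+ 2 + 2 * p ^+ 4 + p ^+ 6) / p ^+ 2); last first.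
  by field; rewrite gt_eqF.
rewrite divr_ge0 ?sqr_ge0// mulr_ge0 ?mulr_ge0 ?sqr_ge0//.
by rewrite !addr_ge0 ?mulr_ge0 ?exprn_ge0// ltW.
Qed.

End Existence.

(** * Uniqueness from Fourier coefficients, and the Hopf differential *)

Section HopfDifferential.
Context {R : realType}.
Implicit Types (x y t : R) (f g : R -> R) (D : @functional R).
Local Notation T := ((pi : R) *+ 2).
Local Notation C := (complex R).

Lemma derive1n_fejer n j f : smooth f -> periodic f T ->
  derive1n j (fejer n f) = fejer n (derive1n j f).
Proof.
move=> sf fT; elim: j => [//|j IH]; rewrite derive1nS IH; apply/funext => x.
apply: is_derive1_val; apply: is_derive_fejer; last exact: derive1n_periodic.
  by move=> y; exact: smooth_is_derive.
exact: smooth_continuous.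
Qed.

Lemma fejer_derivatives_cvg f N e : smooth f -> periodic f T -> 0 < e ->
  exists n0, forall n, (n0 <= n)%N -> (0 < n)%N -> forall j, (j <= N)%N ->
    forall x, `|fejer n (derive1n j f) x - derive1n j f x| <= e.
Proof.
move=> sf fT e0; have H j : exists n0, forall n, (n0 <= n)%N -> (0 < n)%N ->
    forall x, `|fejer n (derive1n j f) x - derive1n j f x| <= e.
  have cf := smooth_continuous (n := j) sf; apply: cvg_fejer e0.
    exact: continuous_L1.
  by apply: continuous_circle_regular => //; exact: derive1n_periodic.
elim: N => [|N [n1 IH]].
  by have [n0 Hn] := H 0%N; exists n0 => n n0n n_gt0 j; rewrite leqn0 => /eqP ->; exact: Hn.
have [n0 Hn] := H N.+1; exists (maxn n0 n1) => n; rewrite geq_max => /andP[h0 h1] n_gt0 j.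
by rewrite leq_eqVlt => /predU1P[->|]; [exact: Hn|exact: IH].
Qed.

Lemma distribution0 D : is_distribution D -> D (fun=> 0) = 0.
Proof.
move=> [lin _]; have t0 := @test_function0 R; have := lin 1 _ _ t0 t0.
rewrite (_ : (fun x : R => 1 * 0 + 0 : C) = fun=> 0); last by apply/funext => x; rewrite mulr0 addr0.
by rewrite mul1r => /esym/eqP; rewrite -subr_eq0 addrK => /eqP.
Qed.

Lemma normc_ge0 (z : C) : 0 <= Normc.normc z.
Proof. by case: z => p q; exact: sqrtr_ge0. Qed.

Lemma distribution_trigpoly D n (a b a' b' : nat -> R) : is_distribution D ->
  (forall k, D (expi k) = 0) ->
  test_function (fun x => Complex (trigpoly n a b x) (trigpoly n a' b' x)) /\
  D (fun x => Complex (trigpoly n a b x) (trigpoly n a' b' x)) = 0.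
Proof.
move=> dD De; elim: n => [|n [tn Dn]].
  rewrite (_ : (fun x => _) = fun=> 0); first by split; [exact: test_function0|exact: distribution0].
  by apply/funext => x; rewrite /trigpoly !big_ord0.
(* With [A = a n + i a' n] and [B = b n + i b' n], these are [(A - i B) / 2] and [(A + i B) / 2],
   the coefficients of [A cos (n x) + B sin (n x)] in [e^(i n x)] and [e^(- i n x)]. *)
pose al : C := Complex ((a n + b' n) / 2) ((a' n - b n) / 2).
pose be : C := Complex ((a n - b' n) / 2) ((a' n + b n) / 2).
have tp := test_function_expi (Posz n) : test_function (expi (Posz n) : R -> C).
have tm := test_function_expi (- Posz n) : test_function (expi (- Posz n) : R -> C).
have [t1 _] := test_function_lincomb be tm tn.
have [t2 _] := test_function_lincomb al tp t1.
have E : (fun x => Complex (trigpoly n.+1 a b x) (trigpoly n.+1 a' b' x)) =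
  fun x => al * expi (Posz n) x + (be * expi (- Posz n) x + Complex (trigpoly n a b x) (trigpoly n a' b' x)).
  apply/funext => x; rewrite !trigpolyS /expi mulrNz mulNr cosN sinN -[(Posz n)%:~R]/(n%:R).
  by rewrite !complex_mulE !complex_addE; congr Complex; field.
rewrite E; split=> //.
have [lin _] := dD; rewrite lin// lin// !De !mulr0 !add0r.
exact: Dn.
Qed.

(* The Fejer means of a test function converge to it together with all derivatives. *)
Lemma distribution_eq0 D : is_distribution D -> (forall k, D (expi k) = 0) ->
  forall phi, test_function phi -> D phi = 0.
Proof.
move=> dD De phi tphi; have [_ [N [K DK]]] := dD; have [phiT sr si] := tphi.
pose f x := complex.Re (phi x); pose g x := complex.Im (phi x).
have fT : periodic f T by move=> x; rewrite /f phiT.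
have gT : periodic g T by move=> x; rewrite /g phiT.
apply: Normc.eq0_normc; apply/eqP; rewrite eq_le normc_ge0 andbT.
apply/ler_addgt0Pr => e e0; rewrite add0r.
(* The real and the imaginary part contribute [d] each; the sign of [K] is unknown, whence the
   absolute value. *)
pose d := e / (2 * (`|K| + 1)).
have K1 : 0 < `|K| + 1 by rewrite ltr_wpDl.
have d0 : 0 < d by rewrite divr_gt0// mulr_gt0.
have [n1 h1] := fejer_derivatives_cvg N sr fT d0.
have [n2 h2] := fejer_derivatives_cvg N si gT d0.
pose n := (maxn n1 n2).+1.
have {}h1 := h1 n (leqW (leq_maxl _ _)) isT.
have {}h2 := h2 n (leqW (leq_maxr _ _)) isT.
have L h : smooth h -> L1 h by move=> sh; apply: continuous_L1; exact: (smooth_continuous (n := 0)).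
pose psi x : C := Complex (fejer n f x) (fejer n g x).
have [tpsi Dpsi] : test_function psi /\ D psi = 0.
  have := @distribution_trigpoly D n
    (fun j => (n%:R * T)^-1 * fejer_weight n j * acoef f j)
    (fun j => (n%:R * T)^-1 * fejer_weight n j * bcoef f j)
    (fun j => (n%:R * T)^-1 * fejer_weight n j * acoef g j)
    (fun j => (n%:R * T)^-1 * fejer_weight n j * bcoef g j) dD De.
  rewrite (_ : (fun x => _) = psi)//; apply/funext => x.
  by rewrite /psi !fejerE; [|exact: L..].
have [tchi dchi] := test_function_lincomb (-1) tphi tpsi.
have -> : Normc.normc (D phi) = Normc.normc (D (fun x => -1 * phi x + psi x)).
  have [lin _] := dD; rewrite lin// Dpsi addr0 mulN1r.
  by case: (D phi) => p q; rewrite complex_oppE /= !sqrrN.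
apply: (@le_trans _ _ (K * (d + d))).
  apply: DK => // j x jN; rewrite dchi /cderive.
  rewrite (derive1n_fejer n j sr fT) (derive1n_fejer n j si gT) mulN1r complex_oppE complex_addE.
  apply: (le_trans (normc_le_norm _ _)); rewrite lerD// addrC; [exact: h1|exact: h2].
apply: (@le_trans _ _ (`|K| * (d + d))); first by rewrite ler_wpM2r ?ler_norm// addr_ge0// ltW.
rewrite (_ : _ * (d + d) = e * (`|K| / (`|K| + 1))); last by rewrite /d; field; rewrite gt_eqF.
by rewrite ler_piMr ?(ltW e0)// ler_pdivrMr// mul1r lerDl.
Qed.

Lemma distribution_eq_fourier (D E : @functional R) : is_distribution D -> is_distribution E ->
  (forall k, fourier D k = fourier E k) -> distribution_eq D E.
Proof.
move=> [lD [N [K bD]]] [lE [N' [K' bE]]] DE phi tphi; apply/eqP; rewrite -subr_eq0; apply/eqP.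
apply: (@distribution_eq0 (fun phi => D phi - E phi)) => //; last first.
  move=> k; have := DE (- k); rewrite /fourier opprK => /mulfI -> //; first by rewrite subrr.
  by rewrite (inj_eq (@complexI _) _ 0) invr_eq0 gt_eqF// period_gt0.
split; first by move=> a u v tu tv; rewrite lD// lE//; ring.
exists (maxn N N'), (K + K') => u M tu uM; rewrite mulrDl.
apply: (@le_trans _ _ (Normc.normc (D u) + Normc.normc (E u))).
  have := @le_normcD R (D u) (- E u); rewrite normcN; exact.
apply: lerD; [apply: bD|apply: bE] => // j x jN; apply: uM.
  by rewrite (leq_trans jN)// leq_maxl.
by rewrite (leq_trans jN)// leq_maxr.
Qed.

Context {m : nat}.
Implicit Types (u v : R -> 'rV[R]_m).

Lemma ae_hopf_coef u v k : H_half u -> H_half v ->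
  {ae (@lebesgue_measure R), forall x, u x = v x} -> hopf_coef u k = hopf_coef v k.
Proof.
move=> [u2 _] [v2 _] uv.
suff E n : vfourier u (Posz n) = vfourier v (Posz n).
  rewrite /hopf_coef; case: (0 < k); last by [].
  by apply: eq_bigr => ab _; rewrite (E ab.1) (E ab.2).
apply/rowP => j; rewrite !mxE /component.
have [f2 _] := circle_L2_component j u2; have [g2 _] := circle_L2_component j v2.
rewrite !fourier_nat; [|exact: L2_L1..].
have mf := L2_measurable f2; have mg := L2_measurable g2.
have ae (w : R -> R) : {ae (@lebesgue_measure R), forall x, u x 0 j * w x = v x 0 j * w x}.
  have [A [mA A0 uA]] := uv; exists A; split; [exact: mA|exact: A0|].
  by move=> x /= h; apply: uA => /= E; apply: h; rewrite E.
congr Complex; first congr (_ * _).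
  apply: ae_eq_Ic; last exact: ae.
    apply: measurable_funM => //; exact: continuous_measurable (@continuous_cosM _ _).
  apply: measurable_funM => //; exact: continuous_measurable (@continuous_cosM _ _).
congr (- (_ * _)); apply: ae_eq_Ic; last exact: ae.
  apply: measurable_funM => //; exact: continuous_measurable (@continuous_sinM _ _).
apply: measurable_funM => //; exact: continuous_measurable (@continuous_sinM _ _).
Qed.

Lemma exists_hopf_differential u : H_half u ->
  exists D : functional, in_Hs (- 3%:R) D /\ is_hopf_differential u D.
Proof.
move=> uH; have u2 := uH.1; have L j := circle_L2_component j u2.
pose v (j : 'I_m) x : R := u x 0 j.
pose S j := fine (gagliardo (v j)) / 2.
have vS j n : \sum_(s < n) s%:R * coef2 (v j) s <= S j.
  by have [f2 fT] := L j; apply: gagliardo_partial_sum => //; exact: H_half_gagliardo.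
pose P k := T ^- 2 * \sum_(j < m) hopf_re (v j) k.
pose Q k := T ^- 2 * \sum_(j < m) hopf_im (v j) k.
pose S' := T ^- 2 * \sum_(j < m) S j.
have T2 : 0 <= T ^- 2 by rewrite invr_ge0 sqr_ge0.
have bound (h : (R -> R) -> nat -> R) k : (forall j, `|h (v j) k| <= k%:R * S j) ->
    `|T ^- 2 * \sum_(j < m) h (v j) k| <= k%:R * S'.
  move=> hS; rewrite normrM (ger0_norm T2) /S' mulrCA ler_wpM2l// mulr_sumr.
  by apply: le_trans (ler_norm_sum _ _ _) _; exact: ler_sum.
have P0 : P 0%N = 0 by rewrite /P big1 ?mulr0// => j _; rewrite /hopf_re big_ord0.
have Q0 : Q 0%N = 0 by rewrite /Q big1 ?mulr0// => j _; rewrite /hopf_im big_ord0.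
have [||D [DH DF]] := @exists_distribution R P Q S' P0 Q0.
- by move=> k; apply: (bound (@hopf_re R)) => j; exact: hopf_re_le.
- by move=> k; apply: (bound (@hopf_im R)) => j; exact: hopf_im_le.
exists D; split=> //; split; first exact: DH.1.
move=> k; rewrite DF; case: ifPn => k0; last by rewrite /hopf_coef (negbTE k0).
case: k k0 => // k _; rewrite hopf_coefE; last by move=> j; exact: L2_L1 (L j).1.
by rewrite complex_mulE /P /Q; congr Complex; ring.
Qed.

End HopfDifferential.

Theorem proposition1p6 (R : realType) (m : nat) (hm : (1 <= m)%N) :
  (forall u : R -> 'rV[R]_m, H_half u ->
     exists T : functional, in_Hs (- 3%:R) T /\ is_hopf_differential u T) /\
  (* uniqueness, and independence of the representative of u *)
  (forall (u v : R -> 'rV[R]_m) (T S : functional),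
     H_half u -> H_half v ->
     {ae (@lebesgue_measure R), forall x, u x = v x} ->
     is_hopf_differential u T -> is_hopf_differential v S ->
     distribution_eq T S) /\
  (forall (u : R -> 'rV[R]_m) (T : functional),
     H_half u -> is_hopf_differential u T ->
     (stationary u <-> distribution_eq T zero_distribution)).
Proof.
split; first exact: exists_hopf_differential.
split=> [u v T S uH vH uv [dT fT] [dS fS]|u T uH [dT fT]].
  by apply: distribution_eq_fourier => // k; rewrite fT fS; exact: ae_hopf_coef.
have T0 : (pi : R) *+ 2 != 0 by rewrite gt_eqF// period_gt0.
have u1 j : L1 (fun x => u x 0 j) by exact: L2_L1 (circle_L2_component j uH.1).1.
(* By [hopf_coefE], stationarity means that all Fourier coefficients of [T] vanish;
   [distribution_eq0] passes from the coefficients to [T], and testing with [expi] leads back. *)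
rewrite (stationaryE uH); split=> [uk phi tphi|T_0 k].
  apply: distribution_eq0 => // k; have := fT (- k); rewrite /fourier opprK.
  have -> : hopf_coef u (- k) = 0.
    have [n [->|->]] : exists n : nat, - k = Posz n \/ - k = Negz n.
    - by exists (if - k is Posz n then n else if - k is Negz n then n else 0%N); case: (- k) => n; [left|right].
    - by rewrite hopf_coefE// (uk n).1 (uk n).2 oppr0 mulr0.
    - by [].
  move=> /eqP; rewrite mulf_eq0 => /orP[|/eqP //].
  by rewrite (inj_eq (@complexI _) _ 0) invr_eq0 (negbTE T0).
have : hopf_coef u (Posz k) = 0.
  by rewrite -fT /fourier T_0 ?mulr0//; exact: test_function_expi.
rewrite hopf_coefE// complex_mulE => -[/eqP e1 /eqP e2]; move: e1 e2.
rewrite !mul0r subr0 addr0 mulrN oppr_eq0 !mulf_eq0 invr_eq0 expf_eq0/= (negbTE T0)/=.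
by move=> /eqP e1 /eqP e2.
Qed.
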